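(* For every constant $k>3$, there exists a randomized algorithm that, given query access to an $N$-vertex graph $G$ of degree bound $d$ that is $\epsilon$-far from having no simple cycles of length at least $k$, finds a simple cycle of length at least $k$ in $G$ in expected time $\widetilde{O}(\mathrm{poly}(d^k/\epsilon)\cdot\sqrt{N})$. Furthermore, the cycle found has length at most $\mathrm{poly}(d^k\cdot\epsilon^{-1}\log N)$.
   Context: Graphs are $G=([N],E)$ with maximum degree at most $d$. The algorithm accesses $G$ via neighbor queries: for $v\in[N]$ and $1\le i\le d$ it may ask for the $i$-th neighbor of $v$ (answer $0$ if $v$ has fewer than $i$ neighbors); it is given $N$, $d$, $\epsilon$. Basic vertex-manipulation operations are counted at unit cost. $G$ is $\epsilon$-far from a property $\Pi$ (here: having no simple cycle of length at least $k$, equivalently being $C_k$-minor free) if for every $N$-vertex graph $G'=([N],E')$ in $\Pi$ the symmetric difference of $E$ and $E'$ has more than $\epsilon dN$ elements. A simple cycle of length $t$ is a closed walk $(v_1,\dots,v_t,v_1)$ with $t\ge3$ and $v_1,\dots,v_t$ distinct. *)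

(* Defs.v *)
From HB Require Import structures.
From mathcomp Require Import all_boot all_order all_algebra.
From mathcomp Require Import boolp classical_sets reals ereal sequences exp.

Set Implicit Arguments.
Unset Strict Implicit.
Unset Printing Implicit Defensive.

Import Order.TTheory GRing.Theory Num.Theory.

(** * Graphs *)

Record sgraph (N : nat) := SGraph {
  adj : rel 'I_N;
  adj_sym : symmetric adj;
  adj_irr : irreflexive adj }.

Section Graphs.
Variables (N : nat) (G : sgraph N).

Definition max_degree_le (d : nat) : Prop :=
  forall v : 'I_N, (#|[set u | adj G v u]| <= d)%N.

(* An edge {x, y} is represented by its increasing pair. *)
Definition edges : {set 'I_N * 'I_N} :=
  [set e : 'I_N * 'I_N | (e.1 < e.2)%N && adj G e.1 e.2].

Definition simple_cycle (c : seq 'I_N) : bool :=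
  [&& 3 <= size c, uniq c & cycle (adj G) c]%N.

Definition no_long_cycle (k : nat) : Prop :=
  forall c : seq 'I_N, simple_cycle c -> (size c < k)%N.

(* The order in which the neighbors of a vertex are listed is arbitrary. *)
Definition neighbor_lists (nb : 'I_N -> seq 'I_N) : Prop :=
  forall v, uniq (nb v) /\ forall u, (u \in nb v) = adj G v u.

End Graphs.

Definition edge_dist (N : nat) (G G' : sgraph N) : nat :=
  #|(edges G :\: edges G') :|: (edges G' :\: edges G)|.

Definition far (N d : nat) (eps : rat) (P : sgraph N -> Prop) (G : sgraph N) :
    Prop :=
  forall G' : sgraph N, P G' -> (eps * (d * N)%:R < (edge_dist G G')%:R :> rat)%R.

(** * Randomized word-RAM programs with neighbor queries

  The memory consists of arrays named by natural numbers; a program mentions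
  finitely many of them, and cell 0 of an array can serve as a scalar variable.
  Arithmetic is modulo 2 ^ w, where w is the word length.  The vertex set is
  {1, ..., N} on the machine side, i.e. [v : 'I_N] is the word [v.+1], so that
  0 is never a vertex. *)

Definition memory := nat -> nat -> nat.

Inductive binop := Add | Sub | Mul | Div | Mod | Eq | Lt.

Inductive expr :=
| Const of nat
| Read of nat & expr                      (* array, index *)
| Op of binop & expr & expr.

(* In [Store], [Query] and [Rand], the first two arguments are the array and
   the index of the cell receiving the result. *)
Inductive cmd :=
| Store of nat & expr & expr
| Query of nat & expr & expr & expr       (* ..., vertex, neighbor number *)
| Rand of nat & expr & expr               (* ..., b: uniform in {1, ..., b} *)
| Then of cmd & cmd
| Cond of expr & cmd & cmd
| While of expr & cmd.

(* The commands that remain to be executed, and the memory. *)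
Definition config := (seq cmd * memory)%type.

Definition binop_fun (o : binop) (x y : nat) : nat :=
  match o with
  | Add => x + y
  | Sub => x - y
  | Mul => x * y
  | Div => x %/ y
  | Mod => x %% y
  | Eq => x == y
  | Lt => x < y
  end%N.

Fixpoint eval (w : nat) (m : memory) (e : expr) : nat :=
  match e with
  | Const n => n %% 2 ^ w
  | Read a i => m a (eval w m i)
  | Op o e1 e2 => binop_fun o (eval w m e1) (eval w m e2) %% 2 ^ w
  end%N.

Definition write (m : memory) (a i x : nat) : memory :=
  fun a' i' => if (a' == a) && (i' == i) then x else m a' i'.

Definition outcomes (b : nat) : seq nat := if b is 0 then [:: 0] else iota 1 b.

(* The i-th neighbor of v, for i >= 1, or 0 if there is none. *)
Definition answer (N : nat) (nb : 'I_N -> seq 'I_N) (v i : nat) : nat :=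
  match v, i with
  | v'.+1, i'.+1 =>
      if insub v' is Some u then nth 0 [seq (val x).+1 | x <- nb u] i' else 0
  | _, _ => 0
  end.

Section Semantics.
Variables (w N : nat) (nb : 'I_N -> seq 'I_N).

(* The equiprobable configurations after one step; each step has unit cost. *)
Definition next (s : config) : seq config :=
  let: (cs, m) := s in
  let ev := eval w m in
  match cs with
  | [::] => [:: s]
  | Store a i e :: K => [:: (K, write m a (ev i) (ev e))]
  | Query a i v j :: K =>
      [:: (K, write m a (ev i) (answer nb (ev v) (ev j)))]
  | Rand a i b :: K =>
      [seq (K, write m a (ev i) x) | x <- outcomes (ev b)]
  | Then c1 c2 :: K => [:: (c1 :: c2 :: K, m)]
  | Cond e c1 c2 :: K => [:: ((if ev e != 0 then c1 else c2) :: K, m)]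
  | While e c :: K =>
      [:: (if ev e != 0 then c :: While e c :: K else K, m)]
  end.

Local Open Scope ring_scope.

(* The probability that the execution from s halts after exactly t steps, with
   a final memory satisfying P. *)
Fixpoint halt_prob (R : realType) (P : memory -> Prop) (t : nat) (s : config) :
    R :=
  match t, s.1 with
  | 0, [::] => (`[< P s.2 >])%:R
  | 0, _ :: _ => 0
  | _.+1, [::] => 0
  | t'.+1, _ :: _ =>
      (\sum_(s' <- next s) halt_prob R P t' s') / (size (next s))%:R
  end.

Definition success_prob (R : realType) (P : memory -> Prop) (s : config) :
    \bar R :=
  (\sum_(0 <= t <oo) (halt_prob R P t s)%:E)%E.

(* The expected number of steps, for executions that halt almost surely. *)
Definition expected_time (R : realType) (s : config) : \bar R :=
  (\sum_(0 <= t <oo) (t%:R * halt_prob R (fun=> True) t s)%:E)%E.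

End Semantics.

(* Words have O(log) bits; c is the constant hidden in the O. *)
Definition word_length (c N d : nat) (eps : rat) : nat :=
  (c * (trunc_log 2 (N + d + `|numq eps| + `|denq eps|)).+1)%N.

(* The input is in array 0, all other cells being initially 0. *)
Definition input (N d : nat) (eps : rat) : memory :=
  fun a i => if a == 0 then nth 0 [:: N; d; `|numq eps|; `|denq eps|]%N i else 0.

(* The output is in array 1: the length of the cycle, then its vertices. *)
Definition outputs (N : nat) (m : memory) (c : seq 'I_N) : Prop :=
  mkseq (fun i => m 1 i.+1) (m 1 0) = [seq (val v).+1 | v <- c].

(* Main.v *)
Require Import Defs.
From HB Require Import structures.
From mathcomp Require Import all_boot all_order all_algebra.
From mathcomp Require Import boolp classical_sets reals ereal sequences exp.
From mathcomp Require filter ereal_normedtype.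
From mathcomp Require Import fintype finset ring lra zify.

(* Order the edges by [edge_key] and let H consist of the edges uv of G such that
   no walk of at most k - 2 edges, all of larger key, leads from u to v. Every
   cycle of H has length at least k. If G is far from having no long cycle, then
   either many vertices lie on cycles of length between k and 2k, or many edges
   of H lie outside a spanning forest of H: otherwise one can destroy all long
   cycles by deleting the edges close to those vertices and to those edges.

   In the first case, a walk from such a vertex follows the cycle with
   probability at least (d + 1)^(-2k). In the second case, by counting, there is
   a signing of the edges of H such that every 2-coloring of the vertices
   disagrees with many signs, and one argues as for the bipartiteness tester of
   Goldreich and Ron. Remove from the double cover of H, as long as possible,
   sets of vertices having a coloring of small cost. The set U of the remaining
   vertices is large, and by a Cheeger inequality a random walk observed only
   when it visits U forgets its sign. By Kac's lemma, the excursions outside U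
   are short for most starting points. Hence, among about sqrt N walks from the
   same vertex, two are likely to end at the same vertex with opposite signs.
   This is impossible if the walks only explore a tree; so recording the first
   visits in a search tree, which does not require knowing the signs, yields a
   cycle of H. *)

(** The obstacle is that short cycles may overlap and form long ones, so that acyclicity of H alone
    does not bound the cycles of G. When no cycle has length between k and 2k, a cycle assembled
    from two short ones is again short. Lying on a common short cycle is then a transitive relation
    between edges, and an exceptional edge can be removed together with its class, which stays
    within a ball of radius k.

    Signs are needed because H may be bipartite: the parity of lengths is replaced by a labelling of
    the edges. Colorings induce few labellings, since a spanning forest determines each of them, so
    some signing is far from all. Describing one difference takes about 2 log N bits, which is why
    log N enters the scale Y. Signs occur in the analysis only.

    The walks need not equidistribute over U; only their signs must be forgotten. It suffices that
    antisymmetric functions on the double cover contract, and this requires expansion only of sets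
    that contain at most one lift of each vertex. Peeling provides exactly that, without decomposing
    the graph into well-connected parts. *)

Set Implicit Arguments.
Unset Strict Implicit.
Unset Printing Implicit Defensive.

Import Order.TTheory GRing.Theory Num.Theory.
Local Open Scope ring_scope.

(** * Expectations over random tapes *)

Section Expectation.
Variable R : realFieldType.

Definition avg (b : nat) (F : nat -> R) : R :=
  (\sum_(x <- outcomes b) F x) / (size (outcomes b))%:R.

(** The bounds [bs] are fixed before the run, so that a randomized computation is a deterministic
    function of a tape. Programs analyzed this way must draw the same sequence of bounds on every
    run. *)
Fixpoint expect (bs : seq nat) (F : seq nat -> R) : R :=
  if bs is b :: bs' then avg b (fun x => expect bs' (fun l => F (x :: l)))
  else F [::].

Fixpoint is_tape (bs l : seq nat) : bool :=
  match bs, l with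
  | [::], [::] => true
  | b :: bs', x :: l' => (x \in outcomes b) && is_tape bs' l'
  | _, _ => false
  end.

Lemma size_outcomes_gt0 b : (0 < size (outcomes b))%N.
Proof. by case: b => // b; rewrite size_iota. Qed.

Lemma size_outcomes_neq0 b : (size (outcomes b))%:R != 0 :> R.
Proof. by rewrite pnatr_eq0 -lt0n size_outcomes_gt0. Qed.

Lemma eq_avg b F F' : (forall x, x \in outcomes b -> F x = F' x) ->
  avg b F = avg b F'.
Proof. by move=> h; rewrite /avg; congr (_ / _); exact: eq_big_seq. Qed.

Lemma le_avg b F F' : (forall x, x \in outcomes b -> F x <= F' x) ->
  avg b F <= avg b F'.
Proof.
move=> h; rewrite /avg ler_wpM2r ?invr_ge0 ?ler0n //.
by rewrite big_seq [leRHS]big_seq; apply: ler_sum.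
Qed.

Lemma avg_cst b c : avg b (fun=> c) = c.
Proof.
rewrite /avg big_const_seq iter_addr_0 count_predT -[c *+ _]mulr_natr.
by rewrite mulfK ?size_outcomes_neq0.
Qed.

Lemma avgD b F F' : avg b (fun x => F x + F' x) = avg b F + avg b F'.
Proof. by rewrite /avg big_split mulrDl. Qed.

Lemma avgZ b c F : avg b (fun x => c * F x) = c * avg b F.
Proof. by rewrite /avg -mulr_sumr mulrA. Qed.

Lemma avg_sum (I : Type) (r : seq I) (P : pred I) b (F : I -> nat -> R) :
  avg b (fun x => \sum_(i <- r | P i) F i x) = \sum_(i <- r | P i) avg b (F i).
Proof. by rewrite /avg exchange_big /= mulr_suml. Qed.

Lemma avg_ge0 b F : (forall x, x \in outcomes b -> 0 <= F x) -> 0 <= avg b F.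
Proof. by move=> h; rewrite -(avg_cst b 0) le_avg. Qed.

Lemma avg_ge1 b F x : (forall y, y \in outcomes b -> 0 <= F y) ->
  x \in outcomes b -> F x / (size (outcomes b))%:R <= avg b F.
Proof.
move=> F0 xb; rewrite /avg ler_wpM2r ?invr_ge0 ?ler0n // (big_rem x) //=.
rewrite lerDl big_seq sumr_ge0 // => y /mem_rem; exact: F0.
Qed.

Lemma eq_expect bs F F' : (forall l, is_tape bs l -> F l = F' l) ->
  expect bs F = expect bs F'.
Proof.
elim: bs F F' => [|b bs IH] F F' h /=; first exact: h.
by apply: eq_avg => x xb; apply: IH => l hl; apply: h; rewrite /= xb.
Qed.

Lemma le_expect bs F F' : (forall l, is_tape bs l -> F l <= F' l) ->
  expect bs F <= expect bs F'.
Proof.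
elim: bs F F' => [|b bs IH] F F' h /=; first exact: h.
by apply: le_avg => x xb; apply: IH => l hl; apply: h; rewrite /= xb.
Qed.

Lemma expect_cst bs c : expect bs (fun=> c) = c.
Proof.
elim: bs => //= b bs IH; rewrite -[RHS](avg_cst b).
exact: eq_avg.
Qed.

Lemma expectD bs F F' :
  expect bs (fun x => F x + F' x) = expect bs F + expect bs F'.
Proof.
elim: bs F F' => //= b bs IH F F'; rewrite -avgD; apply: eq_avg => x _.
exact: IH.
Qed.

Lemma expectZ bs c F : expect bs (fun x => c * F x) = c * expect bs F.
Proof.
elim: bs F => //= b bs IH F; rewrite -avgZ; apply: eq_avg => x _; exact: IH.
Qed.

Lemma expect_sum (I : Type) (r : seq I) (P : pred I) bs (F : I -> seq nat -> R) :
  expect bs (fun x => \sum_(i <- r | P i) F i x) =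
  \sum_(i <- r | P i) expect bs (F i).
Proof.
elim: bs F => //= b bs IH F; rewrite -avg_sum; apply: eq_avg => x _.
by rewrite IH.
Qed.

Lemma expect_ge0 bs F : (forall l, is_tape bs l -> 0 <= F l) -> 0 <= expect bs F.
Proof. by move=> h; rewrite -(expect_cst bs 0) le_expect. Qed.

Lemma expect_cat bs bs' F :
  expect (bs ++ bs') F =
  expect bs (fun l => expect bs' (fun l' => F (l ++ l'))).
Proof.
by elim: bs F => //= b bs IH F; apply: eq_avg => x _; rewrite IH.
Qed.

Lemma is_tape_size bs l : is_tape bs l -> size l = size bs.
Proof. by elim: bs l => [|b bs IH] [|x l] //= /andP[_ /IH ->]. Qed.

End Expectation.

(** * Censored random walks *)

Section CensoredWalk.
Variables (R : realFieldType) (T : finType) (D : nat) (phi : T -> nat -> T).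
Hypothesis phi_sym : forall x y,
  count (fun c => phi x c == y) (outcomes D) =
  count (fun c => phi y c == x) (outcomes D).

Implicit Types (f g h : T -> R) (U : {set T}).

Definition walk_op f x : R := avg D (fun c => f (phi x c)).
Definition inner f g : R := \sum_x f x * g x.
Definition restr U f x : R := if x \in U then f x else 0.
Definition one : T -> R := fun=> 1.
Definition point (y : T) : T -> R := fun x => (x == y)%:R.

Lemma innerC f g : inner f g = inner g f.
Proof. by apply: eq_bigr => x _; rewrite mulrC. Qed.

Lemma walk_opE f x :
  walk_op f x = \sum_y (count (fun c => phi x c == y) (outcomes D))%:R * f y
                / (size (outcomes D))%:R.
Proof.
rewrite /walk_op /avg -mulr_suml; congr (_ / _).
elim: (outcomes D) => [|c l IH].
  by rewrite big_nil big1 // => y _; rewrite mul0r.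
rewrite big_cons IH /=; under [RHS]eq_bigr do rewrite natrD mulrDl.
rewrite big_split /=; congr (_ + _).
rewrite (bigD1 (phi x c)) //= eqxx mul1r big1 ?addr0 // => y ny.
by rewrite eq_sym (negPf ny) mul0r.
Qed.

Lemma walk_op_adj f g : inner (walk_op f) g = inner f (walk_op g).
Proof.
rewrite /inner; under eq_bigr do rewrite walk_opE mulr_suml.
under [RHS]eq_bigr do rewrite walk_opE mulr_sumr.
rewrite exchange_big /=; apply: eq_bigr => x _; apply: eq_bigr => y _.
by rewrite phi_sym; ring.
Qed.

Lemma walk_opD f g x : walk_op (fun y => f y + g y) x = walk_op f x + walk_op g x.
Proof. exact: avgD. Qed.

Lemma walk_op_sum (I : Type) (r : seq I) (F : I -> T -> R) x :
  walk_op (fun y => \sum_(i <- r) F i y) x = \sum_(i <- r) walk_op (F i) x.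
Proof. exact: avg_sum. Qed.

Lemma le_walk_op f g : (forall y, f y <= g y) -> forall x, walk_op f x <= walk_op g x.
Proof. by move=> h x; apply: le_avg. Qed.

Lemma walk_op_cst c x : walk_op (fun=> c) x = c.
Proof. exact: avg_cst. Qed.

Lemma restr_adj U f g : inner (restr U f) g = inner f (restr U g).
Proof.
by apply: eq_bigr => x _; rewrite /restr; case: ifP; rewrite ?mul0r ?mulr0.
Qed.

Lemma restr_id U f : restr U (restr U f) = restr U f.
Proof. by apply: funext => x; rewrite /restr; case: (x \in U). Qed.

Lemma le_restr U f g : (forall x, f x <= g x) -> forall x, restr U f x <= restr U g x.
Proof. by move=> h x; rewrite /restr; case: ifP. Qed.

Variables (U : {set T}) (ell : nat).

Definition leave f := walk_op (restr (~: U) f).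
Definition excursion j f := iter j leave (walk_op (restr U f)).
(* [ret l f x] is the expected value of [f] at the first return to [U], over
   the walks from [x] that return within [l] steps. *)
Definition ret l f x : R := \sum_(j < l) excursion j f x.
Definition cens_op f := restr U (ret ell f).

Lemma retS l f x :
  ret l.+1 f x = walk_op (fun y => if y \in U then f y else ret l f y) x.
Proof.
rewrite /ret big_ord_recl /= /excursion /=.
have -> : \sum_(i < l) leave (iter i leave (walk_op (restr U f))) x =
  walk_op (restr (~: U) (ret l f)) x.
  rewrite -[LHS]walk_op_sum; congr (walk_op _ _); apply: funext => y.
  by rewrite /restr; case: ifP => // _; rewrite big1.
rewrite -walk_opD; congr (walk_op _ _); apply: funext => y.
by rewrite /restr inE; case: (y \in U); rewrite ?addr0 ?add0r.
Qed.

Lemma ret_restr l f : ret l (restr U f) = ret l f.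
Proof.
by apply: funext => x; apply: eq_bigr => j _; rewrite /excursion restr_id.
Qed.

Lemma cens_op_restr f : cens_op (restr U f) = cens_op f.
Proof. by rewrite /cens_op ret_restr. Qed.

Lemma leave_adj f g :
  inner (leave f) g = inner f (restr (~: U) (walk_op g)).
Proof. by rewrite walk_op_adj restr_adj. Qed.

Lemma iter_leave_adj j f g :
  inner (iter j leave f) g = inner f (iter j (fun h => restr (~: U) (walk_op h)) g).
Proof. by elim: j g => //= j IH g; rewrite leave_adj IH; congr inner; rewrite -[LHS]iterSr. Qed.

Lemma walk_leave_swap j g :
  walk_op (iter j (fun h => restr (~: U) (walk_op h)) g) = iter j leave (walk_op g).
Proof. by elim: j => //= j ->. Qed.

(** Read backwards, an excursion of [j] steps outside [U] from [x] to [y] is one from [y] to [x].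
    Truncation depends on [j] alone, so it loses mass but keeps the operator symmetric. *)
Lemma cens_op_adj f g : inner (cens_op f) g = inner f (cens_op g).
Proof.
have E f' g' : inner (cens_op f') g' =
    \sum_(j < ell) inner (excursion j f') (restr U g').
  by rewrite restr_adj /inner; under eq_bigr do rewrite mulr_suml;
    rewrite exchange_big.
rewrite [RHS]innerC !E; apply: eq_bigr => j _.
by rewrite /excursion iter_leave_adj walk_op_adj walk_leave_swap innerC.
Qed.

Lemma retD l f g x : ret l (fun y => f y + g y) x = ret l f x + ret l g x.
Proof.
elim: l x => [|l IH] x; first by rewrite /ret !big_ord0 addr0.
rewrite !retS -walk_opD; congr (walk_op _ _); apply: funext => y.
by case: ifP => // _; exact: IH.
Qed.

Lemma retZ l c f x : ret l (fun y => c * f y) x = c * ret l f x.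
Proof.
elim: l x => [|l IH] x; first by rewrite /ret !big_ord0 mulr0.
rewrite !retS /walk_op -avgZ; apply: eq_avg => y _.
by case: ifP => // _; exact: IH.
Qed.

Lemma ret_sum (I : Type) (r : seq I) l (F : I -> T -> R) x :
  ret l (fun y => \sum_(i <- r) F i y) x = \sum_(i <- r) ret l (F i) x.
Proof.
elim: l x => [|l IH] x.
  by rewrite /ret !big_ord0 big1 // => i _; rewrite big_ord0.
under eq_bigr do rewrite retS; rewrite retS -walk_op_sum.
congr (walk_op _ _); apply: funext => y.
by case: ifP => // _; exact: IH.
Qed.

Lemma le_ret l f g : (forall y, f y <= g y) -> forall x, ret l f x <= ret l g x.
Proof.
move=> fg; elim: l => [|l IH] x; first by rewrite /ret !big_ord0.
by rewrite !retS; apply: le_walk_op => y; case: ifP.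
Qed.

Lemma ret0 l x : ret l (fun=> 0) x = 0.
Proof. by rewrite -[RHS](mul0r (ret l (fun=> 0) x)) -retZ; congr (ret _ _ _); apply: funext => y; rewrite mul0r. Qed.

Lemma ret_ge0 l f : (forall y, 0 <= f y) -> forall x, 0 <= ret l f x.
Proof. by move=> f0 x; rewrite -(ret0 l x); apply: le_ret. Qed.

Lemma cens_opD f g x :
  cens_op (fun y => f y + g y) x = cens_op f x + cens_op g x.
Proof. by rewrite /cens_op /restr; case: ifP; rewrite ?addr0 ?retD. Qed.

Lemma cens_opZ c f x : cens_op (fun y => c * f y) x = c * cens_op f x.
Proof. by rewrite /cens_op /restr; case: ifP; rewrite ?mulr0 ?retZ. Qed.

Lemma cens_op_sum (I : Type) (r : seq I) (F : I -> T -> R) x :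
  cens_op (fun y => \sum_(i <- r) F i y) x = \sum_(i <- r) cens_op (F i) x.
Proof.
by rewrite /cens_op /restr; case: ifP => _; rewrite ?ret_sum // big1.
Qed.

Lemma le_cens_op f g : (forall y, f y <= g y) ->
  forall x, cens_op f x <= cens_op g x.
Proof. by move=> fg; apply: le_restr; apply: le_ret. Qed.

Lemma cens_op_ge0 f : (forall y, 0 <= f y) -> forall x, 0 <= cens_op f x.
Proof. by move=> f0 x; rewrite /cens_op /restr; case: ifP => // _; exact: ret_ge0. Qed.

Lemma iter_cens_op_ge0 j f : (forall y, 0 <= f y) ->
  forall x, 0 <= iter j cens_op f x.
Proof. by move=> f0; elim: j => //= j IH x; exact: cens_op_ge0. Qed.

Lemma iter_cens_op_adj j f g :
  inner (iter j cens_op f) g = inner f (iter j cens_op g).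
Proof. by elim: j g => //= j IH g; rewrite cens_op_adj IH; congr inner; rewrite -[LHS]iterSr. Qed.

Lemma iter_cens_opE j f x : x \in U ->
  iter j cens_op (restr U f) x = iter j (ret ell) f x.
Proof.
move=> xU; suff -> : iter j cens_op (restr U f) = restr U (iter j (ret ell) f).
  by rewrite /restr xU.
by elim: j => //= j ->; rewrite cens_op_restr.
Qed.

(* [surv j x] is the probability that the walk from [x] avoids [U] during its
   first [j] steps. *)
Definition surv j : T -> R := iter j leave (fun=> 1).

Lemma surv_ge0 j x : 0 <= surv j x.
Proof.
elim: j x => [|j IH] x; first exact: ler01.
by rewrite /surv /=; apply: avg_ge0 => c _; rewrite /restr; case: ifP => // _; exact: IH.
Qed.

Lemma surv_decr j x : surv j.+1 x <= surv j x.
Proof.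
elim: j x => [|j IH] x.
  rewrite /surv /= -[leRHS](walk_op_cst 1 x); apply: le_walk_op => y.
  by rewrite /restr; case: ifP.
rewrite /surv /=; apply: le_walk_op; apply: le_restr; exact: IH.
Qed.

Lemma ret_one l x : ret l (fun=> 1) x = 1 - surv l x.
Proof.
elim: l x => [|l IH] x; first by rewrite /ret big_ord0 subrr.
transitivity (walk_op (fun=> 1) x - leave (surv l) x); last by rewrite walk_op_cst.
rewrite retS /leave /walk_op -[X in _ - X]mul1r -mulNr -avgZ -avgD.
apply: eq_avg => y _; rewrite /restr inE IH; case: ifP => _ /=.
  by rewrite mulr0 addr0.
by rewrite mulN1r.
Qed.

Lemma cens_op_one x : cens_op (restr U (fun=> 1)) x = restr U (fun y => 1 - surv ell y) x.
Proof.
by rewrite cens_op_restr /cens_op /restr; case: ifP => // _; rewrite ret_one.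
Qed.

Lemma cens_op_le1 f : (forall y, f y <= 1) -> (forall y, 0 <= f y) ->
  forall x, cens_op f x <= restr U (fun=> 1) x.
Proof.
move=> f1 f0 x; rewrite -cens_op_restr.
apply: (@le_trans _ _ (cens_op (restr U (fun=> 1)) x)).
  by apply: le_cens_op; apply: le_restr.
by rewrite cens_op_one; apply: le_restr => y; rewrite gerBl surv_ge0.
Qed.

(** Probability that the walk from [x], its starting point included, first meets [U] at a time less
    than [m]. The summands are the terms of Kac's sum after transposition. *)
Definition hits m x : R :=
  \sum_(j < m) iter j (fun h => restr (~: U) (walk_op h)) (restr U (fun=> 1)) x.

Lemma hits_le1 m x : hits m x <= 1.
Proof.
elim: m x => [|m IH] x; first by rewrite /hits big_ord0.
rewrite /hits big_ord_recl /=.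
have -> : \sum_(i < m) restr (~: U) (walk_op (iter i (fun h => restr (~: U) (walk_op h))
     (restr U (fun=> 1)))) x = restr (~: U) (walk_op (hits m)) x.
  rewrite /restr; case: ifP => // _; last by rewrite big1.
  by rewrite -walk_op_sum.
rewrite /restr inE; case: ifP => _ /=; first by rewrite addr0.
by rewrite add0r -[leRHS](walk_op_cst 1 x); apply: le_walk_op.
Qed.

(* Kac's lemma in truncated form: by reversibility, the left-hand side counts
   the starting points of walks entering [U] for the first time at step [j],
   and these events are disjoint for different [j]. *)
Lemma kac : inner (restr U (fun=> 1)) (surv ell) *+ ell <= #|T|%:R.
Proof.
have H m : \sum_(j < m) inner (restr U (fun=> 1)) (surv j) <= #|T|%:R.
  rewrite /inner exchange_big /=.
  rewrite (_ : \sum_x _ = \sum_x hits m x).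
    rewrite -sum1_card natr_sum; apply: ler_sum => x _; exact: hits_le1.
  rewrite exchange_big /= [RHS]exchange_big /=; apply: eq_bigr => j _.
  rewrite -/(inner _ _) innerC iter_leave_adj /inner.
  by apply: eq_bigr => x _; rewrite mul1r.
apply: le_trans (H ell); rewrite -[X in _ *+ X]card_ord -sumr_const.
apply: ler_sum => j _; apply: ler_sum => x _; apply: ler_wpM2l.
  by rewrite /restr; case: ifP.
rewrite -[in surv ell](subnK (ltnW (ltn_ord j))); elim: (ell - j)%N => //= i IHi.
by apply: le_trans IHi; exact: surv_decr.
Qed.

Lemma iter_cens_op_le1 j x : iter j cens_op (restr U (fun=> 1)) x <= 1.
Proof.
have r1 y : (0 <= restr U (fun=> 1) y) && (restr U (fun=> 1) y <= 1) by rewrite /restr; case: ifP; rewrite ?lexx ler01.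
elim: j x => [|j IH] x /=; first by have /andP[] := r1 x.
apply: le_trans (_ : restr U (fun=> 1) x <= 1); last by have /andP[] := r1 x.
by apply: cens_op_le1 => // y; apply: iter_cens_op_ge0 => z; have /andP[] := r1 z.
Qed.

(** One more step loses the inner product of [surv ell] with the current iterate [h], and [h <= 1].
    Hence no step loses more than the first one. *)
Lemma cens_mass t :
  #|U|%:R - inner (restr U (fun=> 1)) (surv ell) *+ t <=
  inner (restr U (fun=> 1)) (iter t cens_op (restr U (fun=> 1))).
Proof.
elim: t => [|t IH].
  rewrite mulr0n subr0 /inner -sum1_card natr_sum [leLHS]big_mkcond /=.
  by apply: ler_sum => x _; rewrite /restr; case: ifP; rewrite ?mulr1 ?mulr0.
rewrite iterSr; set e := restr U _ in IH *.
rewrite -iter_cens_op_adj; set h := iter t _ _ in IH *.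
have h1 x : h x <= 1 by exact: iter_cens_op_le1.
apply: le_trans (_ : inner e h - inner e (surv ell) <= _).
  by rewrite mulrS; move: IH; lra.
rewrite (innerC e h) /inner -sumrB; apply: ler_sum => x _; rewrite cens_op_one /e /restr.
case: ifP => _; last by rewrite !mulr0 mul0r subr0.
rewrite mulr1 mul1r mulrBr mulr1 lerD2l lerN2.
by rewrite -[leRHS]mul1r ler_wpM2r ?surv_ge0.
Qed.

(* First [t] visits to [U], each within [ell] steps of the previous one. *)
Fixpoint cens (t g : nat) x (l : seq nat) : option T :=
  match t, g, l with
  | 0, _, _ => Some x
  | _, 0, _ | _, _, [::] => None
  | t'.+1, g'.+1, c :: l' =>
      let y := phi x c in if y \in U then cens t' ell y l' else cens t g' y l'
  end%N.

(** A budget of [g] steps remains for the current excursion and of [ell] for each later one, so the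
    tape cannot run out before the outcome is decided. *)
Lemma expect_cens f n t (g : nat) x : ((if t is t'.+1 then t' * ell + g else 0) <= n)%N ->
  expect (nseq n D) (fun l => oapp f 0 (cens t g x l)) =
  if t is t'.+1 then ret g (iter t' (ret ell) f) x else f x.
Proof.
elim: n t g x => [|n IH] [|t] g x.
- by [].
- case: g => [_|g]; last by rewrite addnS ltn0.
  by rewrite /ret big_ord0.
- by move=> _; rewrite -[RHS](expect_cst (nseq n.+1 D)); apply: eq_expect => -[].
case: g => [_|g].
  rewrite /ret big_ord0 -[RHS](expect_cst (nseq n.+1 D)).
  by apply: eq_expect => -[].
rewrite addnS ltnS => le_n; rewrite retS /walk_op /=; apply: eq_avg => c _.
case: ifP => _; last exact: IH.
by rewrite IH; case: t le_n => //= t; rewrite mulSn; lia.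
Qed.

Definition adjacent x y := (x != y) && has (fun c => phi x c == y) (outcomes D).
Hypothesis phi_lazy : forall x, has (fun c => phi x c == x) (outcomes D).

Let Dr : R := (size (outcomes D))%:R.

Lemma cens_op_point x y : (0 < ell)%N -> x \in U -> y \in U ->
  has (fun c => phi x c == y) (outcomes D) -> Dr^-1 <= cens_op (point y) x.
Proof.
move=> l0 xU yU /hasP[c cD /eqP xc].
rewrite /cens_op /restr xU -(prednK l0) retS /walk_op.
set F := fun _ => _.
rewrite -[leLHS]mul1r (_ : 1 = F c); last by rewrite /F xc yU /point eqxx.
apply: avg_ge1 => // z _; rewrite /F; case: ifP => _; first by rewrite ler0n.
by apply: ret_ge0 => u; rewrite ler0n.
Qed.

Lemma cens_opE f x : cens_op f x = \sum_y cens_op (point y) x * f y.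
Proof.
under eq_bigr do rewrite mulrC -cens_opZ.
rewrite -cens_op_sum; congr (cens_op _ _); apply: funext => y.
rewrite (bigD1 y) //= /point eqxx mulr1 big1 ?addr0 // => z zy.
by rewrite eq_sym (negPf zy) mulr0.
Qed.

(* The variance of [w] under one censored step is at least the contribution of
   the pairs consisting of the starting point and one of its neighbors. *)
Lemma variance_le w x : (0 < ell)%N -> x \in U ->
  (cens_op w x) ^+ 2 + Dr^-2 * (\sum_(y in U | adjacent x y) (w x - w y) ^+ 2) <=
  cens_op (fun y => w y ^+ 2) x.
Proof.
move=> l0 xU; set k := fun y => cens_op (point y) x.
have k0 y : 0 <= k y by apply: cens_op_ge0 => z; rewrite ler0n.
have k1 : \sum_y k y <= 1.
  have -> : \sum_y k y = cens_op (fun=> 1) x.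
    by rewrite [RHS]cens_opE; apply: eq_bigr => y _; rewrite mulr1.
  apply: (@le_trans _ _ (restr U (fun=> 1) x)); last by rewrite /restr; case: ifP.
  by apply: cens_op_le1 => // y; rewrite ?ler01.
have E g : cens_op g x = \sum_y k y * g y by rewrite cens_opE.
set S2 := cens_op (fun y => w y ^+ 2) x.
have S20 : 0 <= S2 by apply: cens_op_ge0 => y; rewrite sqr_ge0.
(* Variance as half the mean square difference of two independent samples, for weights [k] of total
   at most 1. *)
have V : (\sum_y k y) * S2 - cens_op w x ^+ 2 =
    2^-1 * \sum_y \sum_z k y * k z * (w y - w z) ^+ 2.
  have H1 : \sum_y \sum_z k y * k z * (w y ^+ 2) = (\sum_y k y) * S2.
    rewrite mulrC /S2 E mulr_suml; apply: eq_bigr => y _.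
    by rewrite mulr_sumr; apply: eq_bigr => z _; ring.
  have H2 : \sum_y \sum_z k y * k z * (w z ^+ 2) = (\sum_y k y) * S2.
    rewrite /S2 E mulr_suml; apply: eq_bigr => y _.
    by rewrite mulr_sumr; apply: eq_bigr => z _; ring.
  have H3 : \sum_y \sum_z k y * k z * (w y * w z) = cens_op w x ^+ 2.
    rewrite expr2 !E mulr_suml; apply: eq_bigr => y _.
    by rewrite mulr_sumr; apply: eq_bigr => z _; ring.
  transitivity (2^-1 * (\sum_y \sum_z k y * k z * (w y ^+ 2) +
     \sum_y \sum_z k y * k z * (w z ^+ 2) - 2 * \sum_y \sum_z k y * k z * (w y * w z))).
    by rewrite H1 H2 H3; field.
  congr (_ * _); rewrite mulr_sumr -big_split -sumrB; apply: eq_bigr => y _.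
  rewrite mulr_sumr -big_split -sumrB; apply: eq_bigr => z _ /=; ring.
(* Laziness: staying at [x], a point of [U], already counts as a return. *)
have kx : Dr^-1 <= k x by apply: cens_op_point.
have D0 : 0 <= Dr^-1 by rewrite invr_ge0 ler0n.
set F := fun y z => k y * k z * (w y - w z) ^+ 2 in V *.
have F0 y z : 0 <= F y z by apply: mulr_ge0; [apply: mulr_ge0|exact: sqr_ge0].
have Q : Dr^-2 * (\sum_(y in U | adjacent x y) (w x - w y) ^+ 2) <= \sum_z F x z.
  rewrite mulr_sumr [leRHS](bigID (fun y => (y \in U) && adjacent x y)) /=.
  rewrite -[leLHS]addr0 lerD ?sumr_ge0 //; apply: ler_sum => y /andP[yU /andP[_ axy]].
  rewrite /F ler_wpM2r ?sqr_ge0 // -exprVn expr2 ler_pM //.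
  exact: cens_op_point.
have P : 2 * \sum_z F x z <= \sum_y \sum_z F y z.
  rewrite [leRHS](bigD1 x) //= mulr_natl mulr2n lerD2l (bigD1 x) //=.
  rewrite {1}/F subrr expr0n mulr0 add0r; apply: ler_sum => y _.
  rewrite (bigD1 x) //= (_ : F x y = F y x); last by rewrite /F; ring.
  by rewrite lerDl sumr_ge0.
have : (\sum_y k y) * S2 <= S2 by rewrite -[leRHS]mul1r ler_wpM2r.
by lra.
Qed.

(** Sum [variance_le] over [U]. The operator is symmetric and substochastic, so it does not increase
    the sum of [w ^+ 2]; what one step loses is at least the Dirichlet form on the edges inside
    [U]. *)
Lemma energy_le w : (0 < ell)%N ->
  inner (cens_op w) (cens_op w) +
  Dr^-2 * (\sum_(x in U) \sum_(y in U | adjacent x y) (w x - w y) ^+ 2) <=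
  inner w w.
Proof.
move=> l0; apply: le_trans (_ : inner (restr U (fun=> 1)) (cens_op (fun y => w y ^+ 2)) <= _).
  rewrite mulr_sumr big_mkcond -big_split; apply: ler_sum => x _ /=.
  case: (boolP (x \in U)) => xU; last first.
    by rewrite /cens_op /restr (negPf xU) !mul0r add0r.
  rewrite -expr2; apply: le_trans (variance_le w l0 xU) _.
  by rewrite /restr xU mul1r.
rewrite -cens_op_adj; apply: ler_sum => x _; rewrite -expr2 -[leRHS]mul1r.
apply: ler_wpM2r; first exact: sqr_ge0.
apply: (@le_trans _ _ (restr U (fun=> 1) x)); last by rewrite /restr; case: ifP.
by apply: cens_op_le1 => y; rewrite /restr; case: ifP.
Qed.

End CensoredWalk.

(** * A discrete coarea inequality *)

Section Cheeger.
Variables (R : realFieldType) (T : finType).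
Implicit Types (e : rel T) (h : T -> R) (S : {set T}).

Definition boundary e S : {set T * T} :=
  [set p : T * T | e p.1 p.2 && ((p.1 \in S) != (p.2 \in S))].

(* Layer-cake decomposition: subtract from [h] its least positive value on the
   support, by induction on the size of the support. *)
Lemma layer_cake e (a : R) h : (forall x, 0 <= h x) ->
  (forall S, S != set0 -> {in S, forall x, 0 < h x} ->
     a * #|S|%:R <= #|boundary e S|%:R) ->
  a * \sum_x h x <= \sum_(p : T * T | e p.1 p.2) `|h p.1 - h p.2|.
Proof.
move: {2}_.+1 (ltnSn #|[set x | 0 < h x]|) => n.
elim: n h => // n IH h hn h0 hS.
set S := [set x | 0 < h x] in hn.
have [S0|/set0Pn[x0 x0S]] := eqVneq S set0.
  rewrite big1 ?mulr0 ?sumr_ge0 // => x _; apply/eqP; rewrite eq_le h0 andbT leNgt.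
  by apply/negP => hx; move/setP/(_ x): S0; rewrite !inE hx.
pose x1 := [arg min_(i < x0 in S) h i]%O.
have [x1S x1min] : x1 \in S /\ {in S, forall y, h x1 <= h y}.
  by rewrite /x1; case: arg_minP => // i iS hi.
set c := h x1 in x1min *; have c0 : 0 < c by move: x1S; rewrite inE.
pose h' x := h x - c * (x \in S)%:R.
have hN x : x \notin S -> h x = 0.
  by rewrite inE -leNgt => hx; apply/eqP; rewrite eq_le hx h0.
have h'0 x : 0 <= h' x.
  rewrite /h'; case: (boolP (x \in S)) => xS; last by rewrite mulr0 subr0.
  by rewrite mulr1 subr_ge0 x1min.
have h'S x : 0 < h' x -> 0 < h x.
  by move=> hx; apply: lt_le_trans hx _; rewrite /h' gerBl mulr_ge0 ?ler0n // ltW.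
have hn' : (#|[set x | 0 < h' x]%R| < n)%N.
  apply: (@leq_trans #|S|); last by [].
  apply: proper_card; apply/properP; split.
    by apply/subsetP => x; rewrite !inE; exact: h'S.
  by exists x1 => //; rewrite inE /h' x1S mulr1 subrr ltxx.
have H1 : a * #|S|%:R <= #|boundary e S|%:R.
  by apply: hS => [|x]; [apply/set0Pn; exists x0|rewrite inE].
have : a * \sum_x h' x <= \sum_(p : T * T | e p.1 p.2) `|h' p.1 - h' p.2|.
  by apply: IH => // S' S'0 S'h; apply: hS => // x /S'h /h'S.
have -> : \sum_x h' x = \sum_x h x - c * #|S|%:R.
  rewrite sumrB; congr (_ - _); rewrite -mulr_sumr; congr (_ * _).
  by rewrite -sum1_card natr_sum [RHS]big_mkcond /=; apply: eq_bigr => x _; case: ifP.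
have -> : \sum_(p | e p.1 p.2) `|h p.1 - h p.2| =
    \sum_(p | e p.1 p.2) `|h' p.1 - h' p.2| + c * #|boundary e S|%:R.
  rewrite -sum1_card natr_sum mulr_sumr [in X in _ + X](eq_bigl (fun p : T * T =>
    e p.1 p.2 && ((p.1 \in S) != (p.2 \in S)))); last by move=> p; rewrite inE.
  rewrite big_mkcondr -big_split /=; apply: eq_bigr => -[x y] /= _; rewrite /h'.
  case: (boolP (x \in S)) => xS; case: (boolP (y \in S)) => yS /=;
    rewrite ?(mulr0, mulr1, subr0, addr0) //.
  - by congr `|_|; ring.
  - rewrite (hN y yS) !subr0 !ger0_norm // ?subrK //.
    by rewrite subr_ge0 x1min.
  - rewrite (hN x xS) !sub0r !normrN !ger0_norm // ?subrK //.
    by rewrite subr_ge0 x1min.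
have := ler_wpM2l (ltW c0) H1.
move: (\sum_x h x) (\sum_(p | _) _) (#|S|%:R) (#|boundary e S|%:R) => B A X Y.
by lra.
Qed.

End Cheeger.

(** * Spectral gap on antisymmetric functions *)

Section Involution.
Variables (R : realFieldType) (T : finType) (D d : nat) (phi : T -> nat -> T).
Variables (iota : T -> T) (U : {set T}) (ell : nat).
Hypothesis phi_sym : forall x y,
  count (fun c => phi x c == y) (outcomes D) =
  count (fun c => phi y c == x) (outcomes D).
Hypothesis phi_lazy : forall x, has (fun c => phi x c == x) (outcomes D).
Hypothesis iotaK : involutive iota.
Hypothesis iota_phi : forall x c, phi (iota x) c = iota (phi x c).
Hypothesis iotaU : forall x, (iota x \in U) = (x \in U).
Hypothesis adj_deg : forall x, (#|[set y | adjacent D phi x y]| <= d)%N.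
Hypothesis ell_gt0 : (0 < ell)%N.

Local Notation K := (cens_op (R := R) D phi U ell).
Local Notation inner := (@inner R T).
Let Dr : R := (size (outcomes D))%:R.

Lemma iota_bij : bijective iota.
Proof. by exists iota. Qed.

Lemma ret_iota l (f : T -> R) x :
  ret D phi U l (f \o iota) x = ret D phi U l f (iota x).
Proof.
elim: l x => [|l IH] x; first by rewrite /ret !big_ord0.
by rewrite !retS; apply: eq_avg => c _; rewrite iota_phi iotaU IH.
Qed.

Lemma cens_op_iota (f : T -> R) x : K (f \o iota) x = K f (iota x).
Proof. by rewrite /cens_op /restr iotaU ret_iota. Qed.

Lemma iter_cens_op_iota j (f : T -> R) x :
  iter j K (f \o iota) x = iter j K f (iota x).
Proof.
elim: j x => //= j IH x; rewrite -cens_op_iota; congr (cens_op _ _ _ _ _ _).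
by apply: funext => y; rewrite IH.
Qed.

Definition cut_rel x y := [&& adjacent D phi x y, x \in U & y \in U].

(* [a] is the expansion of the sections of the double cover contained in [U]. *)
Definition expanding (a : R) := forall S : {set T},
  S != set0 -> {subset S <= U} -> {in S, forall x, iota x \notin S} ->
  a * #|S|%:R <= #|boundary cut_rel S|%:R.

(** Cheeger's argument for the square of the positive part of [w]. By antisymmetry, its level sets
    are disjoint from their images under [iota], so the expansion of such sets suffices, and the
    positive part carries half of the square norm. *)
Lemma cens_op_contract (a b : R) (w : T -> R) :
  0 < a -> 0 < b -> 16 * d%:R * Dr ^+ 2 * b < a ^+ 2 -> (0 < d)%N ->
  expanding a -> (forall x, w (iota x) = - w x) ->
  (forall x, x \notin U -> w x = 0) ->
  inner (K w) (K w) <= (1 - b) * inner w w.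
Proof.
move=> a0 b0 hab d0 hexp wi wU; rewrite leNgt; apply/negP => hK.
set E := \sum_(p : T * T | cut_rel p.1 p.2) (w p.1 - w p.2) ^+ 2.
have DrE : 0 < Dr by rewrite ltr0n size_outcomes_gt0.
have hE : E < Dr ^+ 2 * b * inner w w.
  have := energy_le phi_sym U phi_lazy w ell_gt0.
  have -> : \sum_(x in U) \sum_(y in U | adjacent D phi x y) (w x - w y) ^+ 2 = E.
    rewrite pair_big_dep /=; apply: eq_bigl => -[x y] /=.
    by rewrite /cut_rel; case: (x \in U); case: (y \in U); case: (adjacent D phi x y).
  move=> h1; have {}h1 : Dr ^- 2 * E < b * inner w w by move: h1 hK; rewrite -/Dr; lra.
  by rewrite -mulrA -ltr_pdivrMl ?exprn_gt0.
pose h x := (Num.max (w x) 0) ^+ 2.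
have h0 x : 0 <= h x by exact: sqr_ge0.
have hh : inner w w = 2 * \sum_x h x.
  rewrite mulr_natl mulr2n {1}(reindex iota) /=; last exact: onW_bij iota_bij.
  rewrite -big_split; apply: eq_bigr => x _ /=; rewrite /h wi.
  case: (lerP (w x) 0) => wx.
    by rewrite maxEle oppr_le0 leNgt; case: ltP => //= ?; [ring|have -> : w x = 0 by lra]; ring.
  by rewrite maxEle oppr_le0 (ltW wx); ring.
have w0 : 0 <= inner w w by apply: sumr_ge0 => x _; rewrite -expr2 sqr_ge0.
(* Weight in Young's inequality [F1]. With this choice the sum of the squares contributes half of
   [a * \sum_x h x], and the hypothesis with the factor 16 keeps the term in [E] below the other
   half. *)
set m : R := 8 * d%:R / a.
have dR : 0 < d%:R :> R by rewrite ltr0n.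
have m0 : 0 < m by rewrite divr_gt0 ?mulr_gt0.
have F1 (u v z : R) : u * (v + z) <= m / 2 * u ^+ 2 + m^-1 * (v ^+ 2 + z ^+ 2).
  rewrite -subr_ge0 (_ : _ - _ = m^-1 / 2 * ((m * u - (v + z)) ^+ 2 + (v - z) ^+ 2)).
    by rewrite mulr_ge0 ?addr_ge0 ?sqr_ge0 // divr_ge0 ?invr_ge0 // ltW.
  by field; rewrite gt_eqF.
have Hcake : a * \sum_x h x <= \sum_(p | cut_rel p.1 p.2) `|h p.1 - h p.2|.
  apply: layer_cake => // S S0 Sh.
  have Sw x : x \in S -> 0 < w x.
    move=> /Sh; rewrite /h; case: (lerP (w x) 0) => // _.
    by rewrite expr0n ltxx.
  apply: hexp => // x xS.
    by apply/negPn/negP => /wU wx; move: (Sw x xS); rewrite wx ltxx.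
  by apply/negP => /Sw; rewrite wi; move: (Sw x xS); lra.
have Hle : \sum_(p | cut_rel p.1 p.2) `|h p.1 - h p.2| <=
    m / 2 * E + m^-1 * (2 * d%:R * inner w w).
  have Hsum g : (forall x, 0 <= g x) ->
      \sum_(p : T * T | cut_rel p.1 p.2) g p.1 <= d%:R * \sum_x g x :> R.
    move=> g0; rewrite -(pair_big_dep predT cut_rel (fun x _ => g x)) /=.
    rewrite mulr_sumr; apply: ler_sum => x _; rewrite sumr_const -[leLHS]mulr_natl.
    rewrite ler_wpM2r // ler_nat; apply: leq_trans (adj_deg x).
    apply: subset_leq_card; apply/subsetP => y.
    by rewrite unfold_in inE => /and3P[].
  have Hsum2 : \sum_(p : T * T | cut_rel p.1 p.2) (w p.1 ^+ 2 + w p.2 ^+ 2) <=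
      2 * d%:R * inner w w.
    rewrite big_split /=.
    have E1 : \sum_(p : T * T | cut_rel p.1 p.2) w p.1 ^+ 2 <= d%:R * inner w w.
      rewrite (_ : inner w w = \sum_x w x ^+ 2); last by apply: eq_bigr => x _; rewrite expr2.
      by apply: (Hsum (fun x => w x ^+ 2)) => x; rewrite sqr_ge0.
    suff E2 : \sum_(p : T * T | cut_rel p.1 p.2) w p.2 ^+ 2 =
        \sum_(p : T * T | cut_rel p.1 p.2) w p.1 ^+ 2 by rewrite E2; lra.
    rewrite (reindex (fun p : T * T => (p.2, p.1))) /=; last first.
      by apply: onW_bij; exists (fun p : T * T => (p.2, p.1)); case.
    apply: eq_bigl => -[x y] /=; rewrite /cut_rel /adjacent (eq_sym y).
    by rewrite !has_count phi_sym; case: (x \in U); rewrite ?andbT ?andbF.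
  apply: le_trans (_ : m / 2 * E + m^-1 *
    \sum_(p : T * T | cut_rel p.1 p.2) (w p.1 ^+ 2 + w p.2 ^+ 2) <= _); last first.
    by rewrite lerD2l ler_wpM2l // invr_ge0 ltW.
  rewrite /E !mulr_sumr -big_split; apply: ler_sum => -[x y] _ /=.
  have T1 : `|h x - h y| <= `|w x - w y| * (`|w x| + `|w y|).
    rewrite /h subr_sqr normrM; apply: ler_pM => //.
      have := ler_norm (w x - w y); have := ler_norm (w y - w x).
      rewrite (distrC (w y)).
      by case: (lerP (w x) 0) => ?; case: (lerP (w y) 0) => ?;
        rewrite ler_norml => *; apply/andP; split; lra.
    have := ler_norm (w x); have := ler_norm (w y).
    have := normr_ge0 (w x); have := normr_ge0 (w y).
    by case: (lerP (w x) 0) => ?; case: (lerP (w y) 0) => ?;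
        rewrite ler_norml => *; apply/andP; split; lra.
  apply: le_trans T1 _.
  have -> : (w x - w y) ^+ 2 = `|w x - w y| ^+ 2 by rewrite real_normK ?num_real.
  have -> : w x ^+ 2 = `|w x| ^+ 2 by rewrite real_normK ?num_real.
  have -> : w y ^+ 2 = `|w y| ^+ 2 by rewrite real_normK ?num_real.
  exact: F1.
have mE : m * a = 8 * d%:R by rewrite /m divfK // gt_eqF.
have mV : m^-1 * (8 * d%:R) = a by rewrite -mE mulrA mulVf ?mul1r // gt_eqF.
have C1 : m / 2 * E <= m / 2 * (Dr ^+ 2 * b * inner w w).
  by rewrite ler_pM2l; [exact: ltW|exact: divr_gt0].
have C2 : m * (Dr ^+ 2 * b) < a / 2.
  rewrite -(ltr_pM2r a0) mulrAC mE.
  by move: hab; lra.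
have S0 : 0 < \sum_x h x.
  rewrite lt_neqAle sumr_ge0 // andbT eq_sym; apply/negP => /eqP hz.
  have E0 : 0 <= E by apply: sumr_ge0 => p _; exact: sqr_ge0.
  by move: hE; rewrite hh hz; lra.
have := ltr_pM2r S0; move=> /(_ (m * (Dr ^+ 2 * b)) (a / 2)); rewrite C2 => C3.
move: Hcake Hle C1; rewrite hh.
have -> : m^-1 * (2 * d%:R * (2 * \sum_x h x)) = (m^-1 * (8 * d%:R)) * (\sum_x h x) / 2 by field; rewrite gt_eqF.
rewrite mV; move: C3; set s := \sum_x h x; set q := m * (Dr ^+ 2 * b).
have -> : m / 2 * (Dr ^+ 2 * b * (2 * s)) = q * s by rewrite /q; field.
by move: (\sum_(p | _) _) => X; lra.
Qed.

Lemma iter_cens_op_contract (a b : R) (w : T -> R) t :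
  0 < a -> 0 < b -> b <= 1 -> 16 * d%:R * Dr ^+ 2 * b < a ^+ 2 -> (0 < d)%N ->
  expanding a -> (forall x, w (iota x) = - w x) ->
  (forall x, x \notin U -> w x = 0) ->
  inner (iter t K w) (iter t K w) <= (1 - b) ^+ t * inner w w.
Proof.
move=> a0 b0 b1 hab d0 hexp wi wU.
elim: t => [|t IH]; first by rewrite expr0 mul1r.
rewrite exprS -mulrA iterS; apply: le_trans (ler_wpM2l _ IH); last by rewrite subr_ge0.
apply: cens_op_contract hexp _ _ => // x.
  rewrite -iter_cens_op_iota (_ : w \o iota = fun y => -1 * w y).
    elim: t x {IH} => [|t IH] x /=; first by rewrite mulN1r.
    rewrite (_ : iter t K _ = fun y => -1 * iter t K w y).
      by rewrite cens_opZ mulN1r.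
    by apply: funext => y; rewrite IH mulN1r.
  by apply: funext => y /=; rewrite wi mulN1r.
by move=> xU; case: t {IH} => [|t]; [exact: wU|rewrite /= /cens_op /restr (negPf xU)].
Qed.

End Involution.

(** * Signed double covers *)

Section DoubleCover.
Variables (R : realFieldType) (V : finType) (D d : nat) (psi : V -> nat -> V).
Variable sg : V -> V -> bool.
Hypothesis psi_sym : forall x y,
  count (fun c => psi x c == y) (outcomes D) =
  count (fun c => psi y c == x) (outcomes D).
Hypothesis psi_lazy : forall x, has (fun c => psi x c == x) (outcomes D).
Hypothesis sg_sym : symmetric sg.
Hypothesis sg_refl : irreflexive sg.
Hypothesis psi_deg : forall x, (#|[set y | adjacent D psi x y]| <= d)%N.

Definition lift (x : V * bool) c : V * bool :=
  (psi x.1 c, x.2 (+) sg x.1 (psi x.1 c)).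
Definition flip (x : V * bool) : V * bool := (x.1, ~~ x.2).
Definition cover (U : {set V}) : {set V * bool} := [set x | x.1 \in U].

Lemma flipK : involutive flip.
Proof. by case=> v b; rewrite /flip negbK. Qed.

Lemma lift_flip x c : lift (flip x) c = flip (lift x c).
Proof. by rewrite /lift /flip /= addNb. Qed.

Lemma cover_flip U x : (flip x \in cover U) = (x \in cover U).
Proof. by rewrite !inE. Qed.

Lemma liftE x y c : (lift x c == y) = (psi x.1 c == y.1) && (x.2 (+) sg x.1 y.1 == y.2).
Proof. by rewrite /lift -pair_eqE /=; case: eqVneq => // ->. Qed.

Lemma lift_sym x y :
  count (fun c => lift x c == y) (outcomes D) =
  count (fun c => lift y c == x) (outcomes D).
Proof.
rewrite (eq_count (liftE x y)) (eq_count (liftE y x)) sg_sym.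
have -> : (y.2 (+) sg y.1 x.1 == x.2) = (x.2 (+) sg y.1 x.1 == y.2).
  by case: (x.2); case: (y.2); case: (sg _ _).
case: (_ == y.2); last by rewrite !(eq_count (a2 := pred0)) // => c; rewrite andbF.
have E (b : V) z : count (fun c => (psi b c == z) && true) (outcomes D) =
    count (fun c => psi b c == z) (outcomes D) by apply: eq_count => c; rewrite andbT.
by rewrite !E.
Qed.

Lemma lift_lazy x : has (fun c => lift x c == x) (outcomes D).
Proof.
have /hasP[c cD pc] := psi_lazy x.1; apply/hasP; exists c => //.
by rewrite liftE pc sg_refl addbF eqxx.
Qed.

Lemma adjacent_lift x y : adjacent D lift x y =
  adjacent D psi x.1 y.1 && (x.2 (+) sg x.1 y.1 == y.2).
Proof.
rewrite /adjacent (eq_has (liftE x y)).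
have -> : has (fun c => (psi x.1 c == y.1) && (x.2 (+) sg x.1 y.1 == y.2)) (outcomes D)
  = has (fun c => (psi x.1 c == y.1)) (outcomes D) && (x.2 (+) sg x.1 y.1 == y.2).
  by elim: (outcomes D) => //= c l ->; rewrite andb_orl.
case: x y => [u b] [v b'] /=; rewrite -pair_eqE /= negb_and.
case: eqVneq => [->|] //=; rewrite sg_refl addbF.
by case: (b == b'); rewrite ?andbF.
Qed.

Lemma lift_deg x : (#|[set y | adjacent D lift x y]| <= d)%N.
Proof.
apply: leq_trans (psi_deg x.1); rewrite -(card_in_imset (f := fst)).
  apply: subset_leq_card; apply/subsetP => v /imsetP[y + ->].
  by rewrite !inE adjacent_lift => /andP[].
move=> y z; rewrite !inE !adjacent_lift => /andP[_ /eqP Ey] /andP[_ /eqP Ez] E.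
by case: y z Ey Ez E => [u e] [v e'] /= <- <- ->.
Qed.

Definition violated (chi : V -> bool) : {set V * V} :=
  [set p : V * V | adjacent D psi p.1 p.2 &&
     (chi p.1 (+) chi p.2 != sg p.1 p.2)].

(** The potential of the peeling. Arcs crossing the border of [W] are charged as soon as one end is
    removed, so that later removals do not pay for them again. *)
Definition peel_cost (W : {set V}) (chi : V -> bool) : {set V * V} :=
  [set p : V * V | [&& adjacent D psi p.1 p.2, (p.1 \in W) || (p.2 \in W) &
     ~~ [&& p.1 \in W, p.2 \in W & chi p.1 (+) chi p.2 == sg p.1 p.2]]].

(** The set [S] contains at most one lift of each vertex, so it is a coloring of its projection. A
    newly charged arc, lifted from an end lying in [S], leaves [S]: otherwise both ends would be
    colored in agreement with the sign. *)
Lemma peel_step (W : {set V}) (chi : V -> bool) (S : {set V * bool}) :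
  {subset S <= cover (~: W)} -> {in S, forall x, flip x \notin S} ->
  exists (W' : {set V}) (chi' : {ffun V -> bool}), #|W'| = (#|W| + #|S|)%N /\
    (#|peel_cost W' chi'| <=
     #|peel_cost W chi| + #|boundary (cut_rel D lift (cover (~: W))) S|)%N.
Proof.
move=> SU Sf; pose Ws := [set x.1 | x in S].
pose chi' := [ffun v => if v \in Ws then (v, true) \in S else chi v].
have WsW v : v \in Ws -> v \notin W.
  by move=> /imsetP[x /SU]; rewrite !inE => ? ->.
have chiS v : v \in Ws -> (v, chi' v) \in S.
  rewrite /chi' ffunE => vW; rewrite vW; move: vW => /imsetP[[u b] xS /= ->].
  case: b xS => xS; first by rewrite xS.
  by have := Sf _ xS; rewrite /flip /= => /negPf ->.
have chiW v b : (v, b) \in S -> (v \in Ws) * (chi' v = b).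
  move=> xS; have vW : v \in Ws by apply/imsetP; exists (v, b).
  split=> //; have := chiS _ vW; have := Sf _ xS; rewrite /flip /=.
  by case: (chi' v); case: (b) => // /negPf ->.
exists (W :|: Ws), chi'; split.
  rewrite cardsU; have -> : W :&: Ws = set0.
    by apply/setP => v; rewrite !inE andbC; case: (boolP (v \in Ws)) => // /WsW/negPf.
  rewrite cards0 subn0 card_in_imset // => -[u b] [v b'] uS vS /= uv.
  rewrite uv in uS *; have [_ <-] := chiW _ _ uS; by have [_ <-] := chiW _ _ vS.
pose g (p : (V * bool) * (V * bool)) := (p.1.1, p.2.1).
apply: leq_trans (_ : #|peel_cost W chi :|:
   g @: boundary (cut_rel D lift (cover (~: W))) S| <= _)%N; last first.
  rewrite cardsU; apply: leq_trans (leq_subr _ _) _.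
  by rewrite leq_add2l leq_imset_card.
apply: subset_leq_card; apply/subsetP => -[u v]; rewrite !inE /= => /and3P[auv uvW' nsat].
rewrite auv /=; case: (boolP ((u \in W) || (v \in W))) => uvW /=.
  apply/orP; left; apply: contra nsat => /and3P[uW vW sat].
  by rewrite uW vW /= !ffunE !ifN // (contraTN (@WsW _)).
case/norP: uvW => uW vW; rewrite (negPf uW) (negPf vW) /= in uvW' nsat.
apply/imsetP; case/orP: uvW' => hWs.
  exists ((u, chi' u), (v, chi' u (+) sg u v)) => //.
  rewrite inE /cut_rel adjacent_lift /= auv eqxx !inE /= uW vW /= chiS //=.
  apply/negP => vS; have [vWs chiv] := chiW _ _ (idP vS).
  by move: nsat; rewrite vWs hWs /= chiv addbA addbb addFb eqxx.
exists ((u, chi' v (+) sg u v), (v, chi' v)) => //.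
rewrite inE /cut_rel adjacent_lift /= auv -addbA addbb addbF eqxx !inE /= uW vW /= chiS //=.
rewrite eqb_id; apply/negP => uS; have [uWs chiu] := chiW _ _ (idP uS).
by move: nsat; rewrite uWs hWs /= chiu addbAC addbb addFb eqxx.
Qed.

(** Take [W] maximal among the sets of cost at most [a * #|W|]: a set contradicting the expansion of
    the complement could be added to [W]. *)
Lemma expanding_core (a del : R) : 0 <= a ->
  (forall chi : {ffun V -> bool}, (a + del * d%:R) * #|V|%:R < #|violated chi|%:R) ->
  exists U : {set V}, del * #|V|%:R <= #|U|%:R /\
    expanding D lift flip (cover U) a.
Proof.
move=> a0 hviol.
pose P (q : {set V} * {ffun V -> bool}) := #|peel_cost q.1 q.2|%:R <= a * #|q.1|%:R.
have P0 : P (set0, [ffun=> false]).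
  rewrite /P /= cards0 mulr0 (_ : peel_cost _ _ = set0) ?cards0 //.
  by apply/setP => p; rewrite !inE andbF.
have [[W chi] /= PW maxW] := @arg_maxnP _ (set0, [ffun=> false]) P (fun q => #|q.1|) P0.
exists (~: W); split.
  rewrite leNgt; apply/negP => Usmall; have := hviol chi; apply/negP; rewrite -leNgt.
  (* A violated arc is charged to [W] or starts outside [W]. If the complement were small, [chi]
     would violate too few arcs. *)
  apply: le_trans (_ : (#|peel_cost W chi| + #|~: W| * d)%:R <= _).
    rewrite ler_nat; apply: leq_trans (_ : #|peel_cost W chi :|:
      [set p : V * V | (p.1 \in ~: W) && adjacent D psi p.1 p.2]| <= _)%N.
      apply: subset_leq_card; apply/subsetP => -[u v]; rewrite !inE /=.
      move=> /andP[-> /negPf ->]; rewrite !andbF /= andbT.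
      by case: (u \in W); rewrite ?orbT.
    rewrite cardsU; apply: leq_trans (leq_subr _ _) _; rewrite leq_add2l.
    rewrite -sum1_card (eq_bigl (fun p : V * V => (p.1 \in ~: W) && adjacent D psi p.1 p.2));
      last by move=> p; rewrite inE.
    rewrite -(pair_big_dep (fun x => x \in ~: W) (adjacent D psi) (fun _ _ => 1%N)) /=.
    rewrite -sum_nat_const; apply: leq_sum => u _; apply: leq_trans (psi_deg u).
    by rewrite sum1_card; apply: subset_leq_card; apply/subsetP => v; rewrite inE.
  rewrite natrD natrM mulrDl lerD //.
    by apply: le_trans PW _; rewrite ler_wpM2l // ler_nat max_card.
  by rewrite mulrAC ler_wpM2r // ltW.
move=> S S0 SU Sf; rewrite leNgt; apply/negP => hS.
have [W' [chi' [cW' pW']]] := peel_step chi SU Sf.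
have /maxW /= : P (W', chi').
  rewrite /P /= cW'; apply: le_trans (_ : (#|peel_cost W chi| +
     #|boundary (cut_rel D lift (cover (~: W))) S|)%:R <= _); first by rewrite ler_nat.
  by rewrite !natrD mulrDr lerD // ltW.
by rewrite cW' -{2}[#|W|]addn0 leq_add2l leqn0 cards_eq0 (negPf S0).
Qed.

Variables (U : {set V}) (ell t : nat) (a b : R).
Hypothesis ell_gt0 : (0 < ell)%N.
Hypothesis t_gt0 : (0 < t)%N.
Hypothesis d_gt0 : (0 < d)%N.
Hypothesis a_gt0 : 0 < a.
Hypothesis b_gt0 : 0 < b.
Hypothesis b_le1 : b <= 1.
Hypothesis hab : 16 * d%:R * (size (outcomes D))%:R ^+ 2 * b < a ^+ 2.
Hypothesis hexp : expanding D lift flip (cover U) a.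
Hypothesis hell : (4 * #|V| * t <= ell * #|U|)%N.
Hypothesis hdecay : (1 - b) ^+ t * (8 * #|V|)%:R <= 1.

Local Notation K := (cens_op (R := R) D lift (cover U) ell).
Local Notation one := (fun=> 1 : R).

Lemma sum_cover (F : V * bool -> R) :
  \sum_y F y = \sum_v (F (v, true) + F (v, false)).
Proof.
rewrite (eq_bigr (fun p => F (p.1, p.2))); last by case.
rewrite -(pair_bigA _ (fun v c => F (v, c))) /=.
by apply: eq_bigr => v _; rewrite big_bool.
Qed.

Definition walk_end (s : V) (l : seq nat) : option (V * bool) :=
  cens lift (cover U) ell t ell (s, false) l.

Definition end_prob (L : nat) s (y : V * bool) : R :=
  expect (nseq L D) (fun l => (walk_end s l == Some y)%:R).

(** The expectation of a function of the endpoint is given by [expect_cens]; symmetry of the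
    operator turns it into the law of the endpoint, an iterate of a point mass. *)
Lemma end_probE L s y : (t * ell <= L)%N -> s \in U ->
  end_prob L s y = iter t K (point R (s, false)) y.
Proof.
move=> tL sU; rewrite /end_prob.
transitivity (expect (nseq L D) (fun l => oapp (point R y) 0 (walk_end s l))).
  by apply: eq_expect => l _; case: walk_end => [z|] //=.
have sU' : (s, false) \in cover U by rewrite inE.
rewrite expect_cens; last by case: (t) tL => // t'; rewrite mulSn addnC.
have -> : (if t is t'.+1 then ret D lift (cover U) ell (iter t' (ret D lift (cover U) ell) (point R y)) (s, false) else point R y (s, false)) = iter t K (restr (cover U) (point R y)) (s, false).
  by rewrite iter_cens_opE //; case: (t).
have E (f : V * bool -> R) z : f z = inner f (point R z).
  rewrite /inner (bigD1 z) //= /point eqxx mulr1 big1 ?addr0 // => u uz.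
  by rewrite (negPf uz) mulr0.
rewrite [LHS]E (iter_cens_op_adj lift_sym) innerC [RHS]E.
have -> : iter t K (point R (s, false)) = restr (cover U) (iter t K (point R (s, false))).
  by case: (t) t_gt0 => //= t' _; rewrite /cens_op restr_id.
by rewrite -restr_adj restr_id.
Qed.

Definition mass s : R := iter t K (restr (cover U) one) (s, false).

Lemma sum_end_prob L s : (t * ell <= L)%N -> s \in U ->
  \sum_v (end_prob L s (v, true) + end_prob L s (v, false)) = mass s.
Proof.
move=> tL sU; transitivity (\sum_y end_prob L s y).
  by rewrite sum_cover.
transitivity (inner (iter t K (point R (s, false))) (restr (cover U) one)).
  apply: eq_bigr => y _; rewrite end_probE //.
  case: (t) t_gt0 => //= t' _; rewrite /cens_op /restr.
  by case: (y \in _); rewrite ?mulr1 ?mul0r.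
rewrite (iter_cens_op_adj lift_sym) innerC /inner (bigD1 (s, false)) //=.
rewrite /point eqxx mulr1 big1 ?addr0 // => z zs.
by rewrite (negPf zs) mulr0.
Qed.

(** The difference of the point masses at the two lifts of [s] is antisymmetric of square norm 2,
    and [t] censored steps contract it. Since the walk commutes with [flip], the result records the
    differences of the end probabilities at opposite lifts. *)
Lemma end_prob_diff L s : (t * ell <= L)%N -> s \in U ->
  \sum_v (end_prob L s (v, true) - end_prob L s (v, false)) ^+ 2 *
    (8 * #|V|)%:R <= 1.
Proof.
move=> tL sU.
pose w0 y := point R (s, false) y - point R (s, true) y.
have E y : iter t K w0 y = end_prob L s y - end_prob L s (flip y).
  rewrite !end_probE // -(iter_cens_op_iota D ell lift_flip (cover_flip U)).
  have -> : point R (s, false) \o flip = point R (s, true).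
    apply: funext => -[v c]; rewrite /point /flip /= -!pair_eqE /=.
    by case: c.
  elim: (t) y => // j IH y /=.
  rewrite (_ : iter j K w0 = fun y => iter j K (point R (s, false)) y +
     -1 * iter j K (point R (s, true)) y).
    by rewrite cens_opD cens_opZ mulN1r.
  by apply: funext => z; rewrite IH mulN1r.
have H := @iter_cens_op_contract R _ D d lift flip (cover U) ell lift_sym lift_lazy
  flipK lift_flip (cover_flip U) lift_deg ell_gt0 a b w0 t a_gt0 b_gt0 b_le1 hab d_gt0 hexp.
have {}H : inner (iter t K w0) (iter t K w0) <= (1 - b) ^+ t * 2.
  have -> : 2 = inner w0 w0 :> R.
    rewrite /inner (bigD1 (s, false)) //= (bigD1 (s, true)) /=; last first.
      by rewrite -pair_eqE /= andbF.
    rewrite [X in _ + (_ + X)](_ : _ = 0).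
      by rewrite /w0 /point !eqxx -!pair_eqE /= ?eqxx ?andbF /=; ring.
    apply: big1 => y /andP[y1 y2].
    by rewrite /w0 /point (negPf y1) (negPf y2) subrr mul0r.
  apply: H => [[v c]|[v c] /=].
    by rewrite /w0 /point /flip -!pair_eqE /= opprB; case: c => /=; rewrite ?andbF ?andbT.
  rewrite inE /= /w0 /point -!pair_eqE /= => vU.
  by rewrite (_ : (v == s) = false) ?subrr //; apply: contraNF vU => /eqP ->.
have E2 : inner (iter t K w0) (iter t K w0) =
    2 * \sum_v (end_prob L s (v, true) - end_prob L s (v, false)) ^+ 2.
  rewrite /inner sum_cover mulr_sumr; apply: eq_bigr => v _.
  by rewrite !E /flip /=; ring.
move: H hdecay; rewrite E2 -mulr_suml; set X := \sum_v _; set Y := (1 - b) ^+ t => H1 H2.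
by have := ler_wpM2r (ler0n R (8 * #|V|)) H1; lra.
Qed.

(** By Kac's lemma a visit loses mass at most [2 * #|V| / ell], so [hell] bounds the loss of [t]
    visits by a quarter of the mass [2 * #|U|]. The average of [mass] over [U] is thus at least 3/4;
    as [mass <= 1], half of the vertices have mass at least 1/2. *)
Lemma mass_ge : exists S0 : {set V},
  [/\ S0 \subset U, (#|U| <= 2 * #|S0|)%N & {in S0, forall s, 2^-1 <= mass s}].
Proof.
pose S0 := [set s in U | 2^-1 <= mass s]; exists S0; split.
- by apply/subsetP => s; rewrite inE => /andP[].
- have m1 s : mass s <= 1 by exact: iter_cens_op_le1.
  have H := cens_mass R lift_sym (cover U) ell t.
  have Hk := kac R lift_sym (cover U) ell.
  have cU : #|cover U| = (2 * #|U|)%N.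
    rewrite (_ : cover U = finset.setX U [set: bool]).
      by rewrite cardsX cardsT card_bool mulnC.
    by apply/setP => x; rewrite !inE andbT.
  have S2 : inner (restr (cover U) one) (iter t K (restr (cover U) one)) =
      2 * \sum_(s in U) mass s.
    rewrite /inner sum_cover mulr_sumr [RHS]big_mkcond /=; apply: eq_bigr => v _.
    rewrite /restr !inE /=; case: ifP => _; last by rewrite !mul0r addr0.
    rewrite !mul1r -/(restr _ _) /mass mulr_natl mulr2n; congr (_ + _).
    rewrite -[(v, true)]/(flip (v, false)) -(iter_cens_op_iota D ell lift_flip (cover_flip U)).
    congr (iter _ _ _ _); apply: funext => y /=.
    by rewrite /restr cover_flip.
  set k := inner _ (surv _ _ _ _ _) in H Hk.
  have kt : k *+ t <= #|U|%:R / 2.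
    have e0 : 0 < ell%:R :> R by rewrite ltr0n.
    rewrite -(ler_pM2r e0) -[k *+ t]mulr_natr mulrAC.
    move: Hk; rewrite -[k *+ ell]mulr_natr card_prod card_bool => Hk.
    have := ler_wpM2r (ler0n R t) Hk.
    have : (4 * #|V| * t)%:R <= (ell * #|U|)%:R :> R by rewrite ler_nat.
    by rewrite !natrM; lra.
  have S3 : \sum_(s in U) mass s <= 2^-1 * #|U|%:R + 2^-1 * #|S0|%:R.
    apply: le_trans (_ : \sum_(s in U) (2^-1 + 2^-1 * (s \in S0)%:R) <= _).
      apply: ler_sum => s sU; rewrite inE sU /=.
      case: (lerP 2^-1 (mass s)) => [_|/ltW] /=; have := m1 s; rewrite ?mulr1 ?mulr0; lra.
    rewrite big_split /= sumr_const -[2^-1 *+ _]mulr_natr lerD2l -mulr_sumr ler_wpM2l //.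
    rewrite -natr_sum ler_nat -sum1_card big_mkcond [leqRHS]big_mkcond /=.
    by apply: leq_sum => s _; case: (s \in U); case: (s \in S0).
  rewrite -(ler_nat R) natrM; move: H; rewrite S2 cU natrM; lra.
- by move=> s; rewrite inE => /andP[].
Qed.

End DoubleCover.

(** * Collisions of walks *)

Section Birthday.
Variables (R : realFieldType) (V : finType) (bs : seq nat).
Variable out : seq nat -> option (V * bool).
Implicit Types (F : seq (seq nat) -> R) (y z : V * bool).

Definition chunks n (l : seq nat) := reshape (nseq n (size bs)) l.
Definition mexp n F : R := expect (flatten (nseq n bs)) (fun l => F (chunks n l)).

Lemma mexp0 F : mexp 0 F = F [::].
Proof. by []. Qed.

Lemma mexpS n F : mexp n.+1 F = expect bs (fun l => mexp n (fun ls => F (l :: ls))).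
Proof.
rewrite /mexp /= expect_cat; apply: eq_expect => l hl; apply: eq_expect => l' _.
by rewrite /chunks /= take_size_cat ?drop_size_cat ?(is_tape_size hl).
Qed.

Lemma eq_mexp n F F' : F =1 F' -> mexp n F = mexp n F'.
Proof. by move=> h; apply: eq_expect => l _; apply: h. Qed.

Lemma mexp_cat m n F :
  mexp (m + n) F = mexp m (fun ls => mexp n (fun ls' => F (ls ++ ls'))).
Proof.
elim: m F => [|m IH] F; first by rewrite mexp0.
rewrite addSn !mexpS; apply: eq_expect => l _; exact: IH.
Qed.

Lemma mexp_lin n (a b : R) F G :
  mexp n (fun ls => a * F ls + b * G ls) = a * mexp n F + b * mexp n G.
Proof. by rewrite /mexp expectD !expectZ. Qed.

Definition cnt y (ls : seq (seq nat)) : R := (count (fun l => out l == Some y) ls)%:R.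
Definition out_prob y : R := expect bs (fun l => (out l == Some y)%:R).

Lemma mexp_cnt n y : mexp n (cnt y) = n%:R * out_prob y.
Proof.
elim: n => [|n IH]; first by rewrite mexp0 mul0r.
rewrite mexpS -natr1 mulrDl mul1r -IH addrC -[mexp n _](expect_cst bs) -expectD.
apply: eq_expect => l _; rewrite -[_%:R in RHS](expect_cst (flatten (nseq n bs))) -expectD.
by apply: eq_expect => l' _; rewrite /cnt /= natrD.
Qed.

(** Second moments of multinomial counts, by adding one sample at a time. *)
Lemma mexp_cnt2 n y z : mexp n (fun ls => cnt y ls * cnt z ls) =
  n%:R * ((y == z)%:R * out_prob y) + n%:R * (n%:R - 1) * (out_prob y * out_prob z).
Proof.
elim: n => [|n IH]; first by rewrite mexp0 /cnt /= !mul0r addr0.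
rewrite mexpS; transitivity (expect bs (fun l =>
  (y == z)%:R * (out l == Some y)%:R + (n%:R * out_prob z) * (out l == Some y)%:R +
  ((n%:R * out_prob y) * (out l == Some z)%:R +
   mexp n (fun ls => cnt y ls * cnt z ls)))).
  apply: eq_expect => l _; rewrite -!mexp_cnt.
  transitivity (mexp n (fun ls => (out l == Some y)%:R * (y == z)%:R +
     (out l == Some y)%:R * cnt z ls + ((out l == Some z)%:R * cnt y ls + cnt y ls * cnt z ls))).
    apply: eq_mexp => ls; rewrite /cnt /= !natrD.
    have -> : (out l == Some y)%:R * (y == z)%:R = (out l == Some y)%:R * (out l == Some z)%:R :> R.
      case: (out l =P Some y) => [->|_]; last by rewrite !mul0r.
      by rewrite !mul1r.
    by ring.
  by rewrite /mexp !expectD !expectZ expect_cst; ring.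
rewrite !expectD !expectZ expect_cst IH /out_prob -natr1; ring.
Qed.

Definition opposite_pair (ls : seq (seq nat)) :=
  [exists v, has (fun l => out l == Some (v, true)) ls &&
             has (fun l => out l == Some (v, false)) ls].

(* Second moment method: the number X of pairs consisting of a walk of the
   first half and a walk of the second half that end at the same vertex with
   opposite signs satisfies E[X^2] <= 8 E[X]^2. *)
Lemma birthday (M : nat) :
  2^-1 <= \sum_v (out_prob (v, true) + out_prob (v, false)) ->
  \sum_v (out_prob (v, true) - out_prob (v, false)) ^+ 2 * (8 * #|V|)%:R <= 1 ->
  (32 * #|V| <= M ^ 2)%N -> (0 < M)%N ->
  8^-1 <= mexp (M + M) (fun ls => (opposite_pair ls)%:R).
Proof.
set f := fun v => out_prob (v, true); set g := fun v => out_prob (v, false).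
move=> h1 h2 hM M0.
have f0 v : 0 <= f v by apply: expect_ge0 => l _; rewrite ler0n.
have g0 v : 0 <= g v by apply: expect_ge0 => l _; rewrite ler0n.
set eta := \sum_v f v * g v.
have Q : (\sum_v (f v + g v)) ^+ 2 <= #|V|%:R * \sum_v (f v + g v) ^+ 2.
  have : 0 <= \sum_u \sum_v ((f u + g u) - (f v + g v)) ^+ 2.
    by apply: sumr_ge0 => u _; apply: sumr_ge0 => v _; exact: sqr_ge0.
  have -> : \sum_u \sum_v ((f u + g u) - (f v + g v)) ^+ 2 =
     2 * (#|V|%:R * \sum_v (f v + g v) ^+ 2) - 2 * (\sum_v (f v + g v)) ^+ 2.
    have sumc (c : R) : \sum_(v : V) c = #|V|%:R * c by rewrite sumr_const mulr_natl.
    transitivity (\sum_u ((#|V|%:R * (f u + g u) ^+ 2 + \sum_v (f v + g v) ^+ 2) -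
        2 * (f u + g u) * \sum_v (f v + g v))).
      apply: eq_bigr => u _; rewrite -sumc mulr_sumr -big_split -sumrB /=.
      by apply: eq_bigr => v _; ring.
    rewrite sumrB big_split /= sumc -mulr_sumr -mulr_suml -mulr_sumr.
    by ring.
  by lra.
set q2 := \sum_v (f v + g v) ^+ 2 in Q.
(* Collisions with opposite signs make up a quarter of [q2], up to the imbalance of the signs, which
   the second hypothesis makes at most half of [q2]. *)
have E4 : 4 * eta = q2 - \sum_v (f v - g v) ^+ 2.
  by rewrite mulr_sumr -sumrB; apply: eq_bigr => v _; ring.
have V0 : 0 < #|V|%:R :> R.
  rewrite ltr0n; case: (posnP #|V|) => // hV; move: h1; rewrite big1; first by lra.
  by move=> v; have := card0_eq hV v; rewrite inE.
have q2V : 1 <= 4 * #|V|%:R * q2.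
  have : 2^-1 ^+ 2 <= (\sum_v (f v + g v)) ^+ 2.
    by rewrite ler_pXn2r // nnegrE ?invr_ge0 //; lra.
  by rewrite exprVn; lra.
have e8 : q2 <= 8 * eta.
  rewrite -mulr_suml natrM in h2.
  have : \sum_v (f v - g v) ^+ 2 * #|V|%:R <= q2 / 2 * #|V|%:R by rewrite -mulr_suml; lra.
  by rewrite -mulr_suml ler_pM2r //; lra.
(* The expected number of opposite pairs between the two halves; it is at least 1 by the choice of
   [M]. *)
set m : R := M%:R ^+ 2 * eta.
have m1 : 1 <= m.
  have hM' : 32 * #|V|%:R <= M%:R ^+ 2 :> R by rewrite -natrX -natrM ler_nat.
  have eta0 : 0 <= eta by apply: sumr_ge0 => v _; rewrite mulr_ge0.
  rewrite /m; apply: le_trans (_ : 32 * #|V|%:R * eta <= _); last exact: ler_wpM2r.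
  by have := ler_wpM2l (ltW V0) e8; lra.
pose X ls ls' : R := \sum_v cnt (v, true) ls * cnt (v, false) ls'.
have EX : mexp M (fun ls => mexp M (fun ls' => X ls ls')) = m.
  transitivity (mexp M (fun ls => \sum_v (M%:R * g v) * cnt (v, true) ls)).
    apply: eq_mexp => ls; rewrite /mexp /X expect_sum; apply: eq_bigr => v _.
    by rewrite expectZ -/(mexp M (cnt _)) mexp_cnt -/(g v); ring.
  rewrite /mexp expect_sum /m /eta mulr_sumr; apply: eq_bigr => v _.
  by rewrite expectZ -/(mexp M (cnt _)) mexp_cnt -/(f v); ring.
have EX2 : mexp M (fun ls => mexp M (fun ls' => X ls ls' ^+ 2)) <= 8 * m ^+ 2.
  pose A u v : R := M%:R * ((u == v)%:R * f u) + M%:R * (M%:R - 1) * (f u * f v).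
  pose B u v : R := M%:R * ((u == v)%:R * g u) + M%:R * (M%:R - 1) * (g u * g v).
  have -> : mexp M (fun ls => mexp M (fun ls' => X ls ls' ^+ 2)) =
      \sum_u \sum_v A u v * B u v.
    transitivity (mexp M (fun ls => \sum_u \sum_v B u v *
        (cnt (u, true) ls * cnt (v, true) ls))).
      apply: eq_mexp => ls; transitivity (mexp M (fun ls' => \sum_u \sum_v
         (cnt (u, true) ls * cnt (v, true) ls) * (cnt (u, false) ls' * cnt (v, false) ls'))).
        apply: eq_mexp => ls'; rewrite expr2 mulr_suml; apply: eq_bigr => u _.
        by rewrite mulr_sumr; apply: eq_bigr => v _; ring.
      rewrite /mexp expect_sum; apply: eq_bigr => u _; rewrite expect_sum.
      apply: eq_bigr => v _; rewrite expectZ -/(mexp M (fun ls => cnt (u, false) ls * cnt (v, false) ls)).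
      by rewrite mexp_cnt2 mulrC -pair_eqE /= andbT.
    rewrite /mexp expect_sum; apply: eq_bigr => u _; rewrite expect_sum.
    apply: eq_bigr => v _; rewrite expectZ -/(mexp M (fun ls => cnt (u, true) ls * cnt (v, true) ls)).
    by rewrite mexp_cnt2 mulrC -pair_eqE /= andbT.
  have M1 : 1 <= M%:R :> R by rewrite ler1n.
  set K := M%:R * (M%:R - 1) : R.
  have K0 : 0 <= K by rewrite mulr_ge0 ?ler0n // subr_ge0.
  have KM : K <= M%:R ^+ 2 by rewrite /K expr2; nra.
  have -> : \sum_u \sum_v A u v * B u v =
      m + \sum_u M%:R * K * (f u * g u * (f u + g u)) + K ^+ 2 * eta ^+ 2.
    have -> : K ^+ 2 * eta ^+ 2 = \sum_u K ^+ 2 * (f u * g u) * eta.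
      by rewrite -mulr_suml -mulr_sumr -/eta; ring.
    have -> : m = \sum_u M%:R ^+ 2 * (f u * g u) by rewrite -mulr_sumr.
    rewrite -!big_split; apply: eq_bigr => u _ /=.
    have -> : eta = f u * g u + \sum_(v | v != u) f v * g v by rewrite /eta (bigD1 u).
    rewrite (bigD1 u) //= [K ^+ 2 * _ * (_ + _)]mulrDr mulr_sumr.
    rewrite (eq_bigr (fun i => K ^+ 2 * (f u * g u) * (f i * g i))).
      have alg (n p q l w : R) : (n * p + l * (p * p)) * (n * q + l * (q * q)) + w =
          n ^+ 2 * (p * q) + n * l * (p * q * (p + q)) + (l ^+ 2 * (p * q) * (p * q) + w).
        by ring.
      by rewrite /A /B -/K eqxx /= !mul1r; exact: alg.
    have alg (n p q p' q' l : R) : (n * (0 * p) + l * (p * p')) * (n * (0 * q) + l * (q * q')) =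
        l ^+ 2 * (p * q) * (p' * q') by ring.
    by move=> v vu; rewrite /A /B -/K eq_sym (negPf vu); exact: alg.
  (* Pairs of collisions that share one walk. Since [M ^ 2 * q2 <= 8 * m], no vertex expects more
     than [3 * m] walks from one half, which reduces this third-order term to a second-order one. *)
  have T2 : \sum_u M%:R * K * (f u * g u * (f u + g u)) <= 6 * m ^+ 2.
    have qm : M%:R ^+ 2 * q2 <= 8 * m by have := ler_wpM2l (exprn_ge0 2 (ler0n R M)) e8; rewrite /m; lra.
    have ym u : M%:R * (f u + g u) <= 3 * m.
      have : (M%:R * (f u + g u)) ^+ 2 <= 8 * m.
        apply: le_trans qm; rewrite exprMn ler_wpM2l ?exprn_ge0 // /q2 (bigD1 u) //=.
        by rewrite lerDl sumr_ge0 // => v _; rewrite sqr_ge0.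
      by have := sqr_ge0 (M%:R * (f u + g u) - 3); nra.
    apply: le_trans (_ : \sum_u (3 * m / 4) * (M%:R ^+ 2 * (f u + g u) ^+ 2) <= _).
      apply: ler_sum => u _.
      apply: le_trans (_ : M%:R ^+ 3 * (f u * g u * (f u + g u)) <= _).
        by apply: ler_wpM2r; [rewrite !mulr_ge0 ?addr_ge0|rewrite exprS ler_wpM2l].
      apply: le_trans (_ : (M%:R * (f u + g u)) * (M%:R ^+ 2 * ((f u + g u) ^+ 2 / 4)) <= _).
        rewrite [leRHS](_ : _ = M%:R ^+ 3 * ((f u + g u) ^+ 2 / 4 * (f u + g u))); last by ring.
        rewrite ler_wpM2l ?exprn_ge0 // ler_wpM2r ?addr_ge0 //.
        by have := sqr_ge0 (f u - g u); lra.
      rewrite [leRHS](_ : _ = (3 * m) * (M%:R ^+ 2 * ((f u + g u) ^+ 2 / 4))); last by ring.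
      by rewrite ler_wpM2r // mulr_ge0 ?exprn_ge0 // divr_ge0 // sqr_ge0.
    rewrite -mulr_sumr -mulr_sumr -/q2.
    by have := ler_wpM2l (_ : 0 <= 3 * m / 4) qm; rewrite expr2 => /(_ _); lra.
  have T3 : K ^+ 2 * eta ^+ 2 <= m ^+ 2.
    have eta0 : 0 <= eta by apply: sumr_ge0 => v _; rewrite mulr_ge0.
    rewrite [leRHS]exprMn; apply: ler_wpM2r; first exact: sqr_ge0.
    by rewrite ler_pXn2r // nnegrE // (le_trans K0).
  have T4 : m <= m ^+ 2 by rewrite expr2; nra.
  by lra.
have m0 : 0 < m by lra.
(* In place of the Cauchy-Schwarz inequality: the indicator of [X != 0] is at least
   [2 * th * X - th ^+ 2 * X ^+ 2], and this [th] gives the best bound available from the two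
   moments. *)
pose th := (8 * m)^-1.
have thm : th * m = 8^-1 by rewrite /th invfM -mulrA mulVf ?mulr1 // gt_eqF.
rewrite mexp_cat; apply: le_trans (_ : mexp M (fun ls => mexp M (fun ls' =>
   2 * th * X ls ls' + - th ^+ 2 * X ls ls' ^+ 2)) <= _).
  have -> : mexp M (fun ls => mexp M (fun ls' =>
      2 * th * X ls ls' + - th ^+ 2 * X ls ls' ^+ 2)) = 2 * th * m - th ^+ 2 *
      mexp M (fun ls => mexp M (fun ls' => X ls ls' ^+ 2)).
    transitivity (2 * th * mexp M (fun ls => mexp M (X ls)) + (- th ^+ 2) *
        mexp M (fun ls => mexp M (fun ls' => X ls ls' ^+ 2))).
      by rewrite -mexp_lin; apply: eq_mexp => ls; exact: mexp_lin.
    by rewrite mulNr EX.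
  have th0 : 0 <= th ^+ 2 by rewrite sqr_ge0.
  have := ler_wpM2l th0 EX2; rewrite -mulrA thm.
  have -> : th ^+ 2 * (8 * m ^+ 2) = 8 * (th * m) ^+ 2 by ring.
  by rewrite thm; lra.
apply: le_expect => ls _; apply: le_expect => ls' _.
set x := X _ _; set l1 := chunks _ _ in x *; set l2 := chunks _ _ in x *.
have [->|x0] := eqVneq x 0; first by rewrite expr0n !mulr0 addr0 ler0n.
suff -> : opposite_pair (l1 ++ l2).
  by have := sqr_ge0 (th * x - 1); rewrite /=; lra.
apply/existsP; have : [exists v, cnt (v, true) l1 * cnt (v, false) l2 != 0].
  apply: contraNT x0 => /existsPn h; apply/eqP; apply: big1 => v _.
  by apply/eqP/negPn; exact: h.
move=> /existsP[v]; rewrite mulf_eq0 negb_or /cnt !pnatr_eq0 -!lt0n -!has_count.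
by move=> /andP[h h']; exists v; rewrite !has_cat h h' orbT.
Qed.

End Birthday.

Local Open Scope nat_scope.

(** * Long cycles and short cycles *)

Section CycleSurgery.
Variables (V : finType) (r : rel V) (k : nat).
Hypothesis r_sym : symmetric r.
Implicit Types (x y a b u v : V) (c s p q C D : seq V).

Definition scycle c := [&& 3 <= size c, uniq c & cycle r c].

Definition links x p y := zip (x :: p) (rcons p y).
Definition pairs c := zip c (rot 1 c).
Definition cedge c a b := ((a, b) \in pairs c) || ((b, a) \in pairs c).

Lemma cedge_sym c : symmetric (cedge c).
Proof. by move=> a b; rewrite /cedge orbC. Qed.

Lemma pairs_cat x p y q : pairs (x :: p ++ y :: q) = links x p y ++ links y q x.
Proof.
rewrite /pairs rot1_cons (_ : rcons _ _ = rcons p y ++ rcons q x).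
  by rewrite -cat_cons zip_cat //= size_rcons.
by rewrite cat_rcons rcons_cat rcons_cons.
Qed.

Lemma mem_zip_uniq x0 s t a b : uniq s -> size s = size t ->
  ((a, b) \in zip s t) = (a \in s) && (nth x0 t (index a s) == b).
Proof.
elim: s t => [|x s IH] [|y t] //= /andP[xs us] [st].
rewrite !inE IH // -pair_eqE /= (eq_sym x a) (eq_sym b y).
case: eqVneq => [->|] //=; by rewrite (negPf xs) orbF.
Qed.

Lemma mem_pairs c a b : uniq c -> ((a, b) \in pairs c) = (a \in c) && (next c a == b).
Proof.
move=> uc; rewrite /pairs next_nth; case: c uc => [|y c] uc //.
rewrite rot1_cons (mem_zip_uniq y) ?size_rcons //.
case: (boolP (a \in y :: c)) => //= ac; congr (_ == _); rewrite nth_rcons.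
case: ltnP => // h; rewrite if_same [RHS]nth_default //.
Qed.

Lemma cedge_rot i c a b : uniq c -> cedge (rot i c) a b = cedge c a b.
Proof. by move=> uc; rewrite /cedge !mem_pairs ?rot_uniq // !next_rot // !mem_rot. Qed.

Lemma scycle_rot i c : scycle (rot i c) = scycle c.
Proof. by rewrite /scycle size_rot rot_uniq rot_cycle. Qed.

Lemma cedgeE c a b : uniq c ->
  cedge c a b = (a \in c) && ((next c a == b) || (prev c a == b)).
Proof.
move=> uc; rewrite /cedge !mem_pairs //.
have -> : (b \in c) && (next c b == a) = (a \in c) && (prev c a == b).
  apply/andP/andP => -[h /eqP <-].
    by rewrite mem_next h prev_next.
  by rewrite mem_prev h next_prev.
by rewrite andb_orr.
Qed.

Lemma cedge_mem c a b : uniq c -> cedge c a b -> (a \in c) && (b \in c).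
Proof.
move=> uc; rewrite cedgeE // => /andP[ac /orP[] /eqP <-]; by rewrite ?mem_next ?mem_prev ac.
Qed.

Lemma cedge_rel c a b : scycle c -> cedge c a b -> r a b.
Proof.
move=> /and3P[_ uc cc]; rewrite /cedge !mem_pairs // => /orP[] /andP[ac /eqP <-].
  exact: next_cycle.
by rewrite r_sym; apply: next_cycle.
Qed.

Lemma next_neq_prev c a : scycle c -> a \in c -> next c a != prev c a.
Proof.
move=> /and3P[sc uc _] ac; have [i c' E] := rot_to ac.
apply/negP => np; move: sc.
have : next c (next c a) = a by rewrite (eqP np) next_prev.
rewrite -!(next_rot i uc) -(size_rot i); move: uc; rewrite -(rot_uniq i) E.
case: c' {E} => [|x [|y c']]; [by move=> _ _|by move=> _ _|].
move=> + + _; rewrite /= !inE !negb_or eqxx => /and3P[/and3P[ax ay _] /andP[xy _] _].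
rewrite 1?(eq_sym x a) (negPf ax) eqxx => ya; by rewrite ya eqxx in ay.
Qed.

Lemma cedge_even c : scycle c -> forall v, \big[addb/false]_u cedge c v u = false.
Proof.
move=> sc v; have uc : uniq c by case/and3P: sc.
case: (boolP (v \in c)) => vc; last first.
  by apply: big1 => u _; rewrite cedgeE // (negPf vc).
have np := next_neq_prev sc vc.
rewrite (bigD1 (next c v)) //= (bigD1 (prev c v)) /=; last by rewrite eq_sym.
rewrite big1; first by rewrite !cedgeE // vc !eqxx orbT.
move=> u /andP[u1 u2]; rewrite cedgeE // vc (eq_sym _ u) (negPf u1).
by rewrite (eq_sym _ u) (negPf u2).
Qed.

Lemma path_rev x p y : path r x (rcons p y) = path r y (rcons (rev p) x).
Proof.
rewrite -(eq_path (e := fun z => r^~ z)); last by move=> a b; rewrite r_sym.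
by rewrite -rev_path last_rcons belast_rcons rev_cons.
Qed.

Lemma links_rev x p y a b : ((a, b) \in links y (rev p) x) = ((b, a) \in links x p y).
Proof.
rewrite /links -rev_cons -rev_rcons -rev_zip ?size_rcons // mem_rev.
elim: (x :: p) (rcons p y) => [|c s IH] [|d t]; rewrite /= ?in_nil //.
by rewrite /= !inE IH -!pair_eqE /= andbC.
Qed.

Lemma cycle_cat x p y q :
  cycle r (x :: p ++ y :: q) = path r x (rcons p y) && path r y (rcons q x).
Proof. by rewrite /= rcons_cat /= cat_path rcons_path /= andbA. Qed.

(** The arc through [c2] is replaced by the ear [p]. The size condition excludes a degenerate cycle
    on [x] and [y] alone. *)
Lemma reroute x c1 y c2 p : scycle (x :: c1 ++ y :: c2) ->
  path r x (rcons p y) -> uniq p -> ~~ has (mem (x :: c1 ++ y :: c2)) p ->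
  0 < size c1 + size p -> scycle (x :: c1 ++ y :: rev p).
Proof.
move=> /and3P[_ uC cC] hp up dis ps; apply/and3P; split.
- by rewrite /= size_cat /= size_rev; lia.
- have hp' z : z \in p -> z \notin x :: c1 ++ y :: c2.
    by move=> zp; apply: contra dis => zC; apply/hasP; exists z.
  move: uC hp'; rewrite -!cat_cons !cat_uniq => /and3P[-> /hasPn h1 _] hp'.
  rewrite andTb cons_uniq rev_uniq up mem_rev andbT; apply/andP; split.
    apply/hasPn => z; rewrite inE mem_rev => /orP[/eqP ->|/hp'].
      by apply: h1; rewrite mem_head.
    by rewrite mem_cat => /norP[].
  by apply/negP => /hp'; rewrite mem_cat mem_head orbT.
by rewrite cycle_cat -path_rev hp andbT; move: cC; rewrite cycle_cat => /andP[].
Qed.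

Lemma reroute2 x c1 y c2 p : scycle (x :: c1 ++ y :: c2) ->
  path r x (rcons p y) -> uniq p -> ~~ has (mem (x :: c1 ++ y :: c2)) p ->
  0 < size c2 + size p -> scycle (y :: c2 ++ x :: p).
Proof.
move=> hC hp up dis ps; rewrite -[p]revK; apply: (@reroute _ _ _ c1) => //.
- by move: hC; rewrite -(scycle_rot (size (x :: c1))) -cat_cons rot_size_cat.
- by rewrite -path_rev.
- by rewrite rev_uniq.
- rewrite has_rev; apply: contra dis => /hasP[z zp /= zC]; apply/hasP; exists z => //=.
  by move: zC; rewrite !inE !mem_cat !inE; case: (z == x); case: (z == y);
    case: (z \in c1); case: (z \in c2).
- by rewrite size_rev.
Qed.

Lemma links_in p q x y : (last x p, head y q) \in links x (p ++ q) y.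
Proof.
elim: p x => [|a p IH] x /=; last by rewrite inE IH orbT.
by case: q => [|b q]; rewrite /links /= mem_head.
Qed.

(** This gap in the cycle lengths is what removing the vertices of intermediate cycles achieves: two
    short cycles can no longer combine into a long one of length at most [2 * k]. *)
Definition no_mid := forall c, scycle c -> size c < k \/ 2 * k < size c.

Definition share a b u v := exists D, [/\ scycle D, size D < k, cedge D a b & cedge D u v].

Lemma share_swap a b u v : share a b u v -> share a b v u.
Proof. by case=> D [? ? ? ?]; exists D; split=> //; rewrite cedge_sym. Qed.

(* If [D2] passes through the edge [cd] and meets [D1] in two vertices, the
   portion of [D2] around [cd] between its closest vertices of [D1] on both
   sides, completed by one of the arcs of [D1], is a cycle. *)
Lemma share_trans a b u v (c d : V) : no_mid -> share a b u v -> share u v c d -> share a b c d.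
Proof.
move=> nm [D1 [s1 k1 D1ab D1uv]] [D2 [s2 k2 D2uv D2cd]].
wlog cdD : c d D2cd / (c, d) \in pairs D2.
  move=> H; case/orP: (D2cd) => h; first exact: H.
  by apply: share_swap; apply: H => //; rewrite cedge_sym.
have [D1cd|D1cd] := boolP (cedge D1 c d); first by exists D1.
have u1 : uniq D1 by case/and3P: s1.
have [sD2 u2 cy2] := and3P s2.
have /andP[uD1 vD1] := cedge_mem u1 D1uv.
have /andP[uD2 vD2] := cedge_mem u2 D2uv.
have uv : u != v.
  have nn w : w \in D2 -> (next D2 w == w) = false.
    move=> wD; apply/negP => /eqP nw; have := next_neq_prev s2 wD.
    by rewrite -{2}nw prev_next // nw eqxx.
  move: D2uv; rewrite cedgeE // uD2 /=; apply: contraTneq => <-.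
  rewrite nn //=; apply/negP => /eqP pu; have := nn u uD2.
  by rewrite -{1}pu next_prev // eqxx.
(* [E] is [D2] cut open at the edge [cd], so that a search for [D1] from each end finds the closest
   vertex on that side. *)
have [E [[uE memE sE] [cE hE lE]]] : exists E,
    [/\ uniq E, E =i D2 & size E = size D2] /\
    [/\ cycle r E, head c E = d & last d E = c].
  move: cdD; rewrite mem_pairs // => /andP[cD /eqP nc].
  have [i s Es] := rot_to cD; exists (rot 1 (c :: s)).
  rewrite -Es !rot_uniq !size_rot !rot_cycle; split; split => //.
  - by move=> z; rewrite !mem_rot.
  - rewrite Es rot1_cons; move: nc; rewrite -(next_rot i u2) Es.
    by case: s {Es} => [|z s] /=; rewrite eqxx.
  - by rewrite Es rot1_cons last_rcons.
have hE1 : has (mem D1) E by apply/hasP; exists u; rewrite ?memE.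
case: (split_find hE1) uE memE sE cE hE lE => y E1 E2' yD1 nE1 uE memE sE cE hE lE.
(* The two searches must find different vertices: one of [u] and [v] differs from [y]. *)
have hE2 : has (mem D1) (rev E2').
  have hz z : z \in D2 -> z \in D1 -> z != y -> has (mem D1) (rev E2').
    move=> zD2 zD1 zy; rewrite has_rev; apply/hasP; exists z => //.
    move: zD2; rewrite -memE mem_cat mem_rcons inE (negPf zy) /= => /orP[zE1|//].
    by move/hasPn: nE1 => /(_ z zE1); rewrite /= zD1.
  have [uy|uy] := eqVneq u y; last exact: (hz u).
  by apply: (hz v) => //; rewrite -uy eq_sym.
move: (revK E2'); case: (split_find hE2) => x E4' E3' xD1 nE4 E2'E.
set E4 := rev E4'; set E3 := rev E3'.
have E2E : E2' = E3 ++ x :: E4 by rewrite -E2'E rev_cat rev_rcons.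
have {E2'E} nE4 : ~~ has (mem D1) E4 by rewrite has_rev.
move: uE memE sE cE hE lE; rewrite E2E cat_rcons => uE memE sE cE hE lE.
set p := E4 ++ E1.
have Erot : rot (size (E1 ++ y :: E3)) (E1 ++ y :: E3 ++ x :: E4) = x :: p ++ y :: E3.
  rewrite (_ : E1 ++ y :: E3 ++ x :: E4 = (E1 ++ y :: E3) ++ x :: E4); last by rewrite -catA.
  by rewrite rot_size_cat /p cat_cons -catA.
have hp : path r x (rcons p y).
  by move: cE; rewrite -(rot_cycle (size (E1 ++ y :: E3))) Erot cycle_cat => /andP[].
have up : uniq (x :: p ++ y :: E3) by rewrite -Erot rot_uniq.
have sp : size p + 2 <= size D2.
  by move: (congr1 size Erot); rewrite size_rot sE /= size_cat /= => ->; rewrite addn2 addnS !ltnS leq_addr.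
have cdp : (c, d) \in links x p y.
  have := links_in E4 E1 x y.
  have -> : last x E4 = c by rewrite -lE !last_cat /= last_cat.
  by have -> : head y E1 = d by rewrite -hE; case: (E1).
have dis : ~~ has (mem D1) p by rewrite has_cat negb_or nE4.
have upp : uniq p by move: up => /= /andP[_]; rewrite cat_uniq => /andP[].
have xy : x != y.
  by move: up => /= /andP[+ _]; rewrite mem_cat inE; case: eqVneq; rewrite // orbT.
have [i t Et] := rot_to xD1.
have yt : y \in t.
  have h : y \in x :: t by rewrite -Et mem_rot.
  by move: h; rewrite inE eq_sym (negPf xy).
case/splitPr: yt Et => c1 c2 Et.
have s1' : scycle (x :: c1 ++ y :: c2) by rewrite -Et scycle_rot.
have dis' : ~~ has (mem (x :: c1 ++ y :: c2)) p.
  by rewrite -Et (eq_has (a2 := mem D1)) // => z; rewrite /= mem_rot.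
have szD : size D1 = size c1 + size c2 + 2.
  by rewrite -(size_rot i) Et /= size_cat /=; clear; lia.
have ncd z w : (z, w) \in pairs (x :: c1 ++ y :: c2) -> cedge D1 z w.
  by move=> h; rewrite -(cedge_rot i) // Et /cedge h.
have D1ab' : cedge (x :: c1 ++ y :: c2) a b by rewrite -Et cedge_rot.
(* The new cycle is shorter than [D1] and [D2] together, hence shorter than [2 * k], and [no_mid]
   makes it short. *)
have fin D : scycle D -> size D <= size c1 + size c2 + size p + 2 ->
    cedge D a b -> cedge D c d -> share a b c d.
  move=> sD szD' Dab Dcd; exists D; split=> //.
  by have [//|] := nm D sD; move: szD' szD sp k1 k2; clear; lia.
have arc1 : ((a, b) \in links x c1 y) || ((b, a) \in links x c1 y) -> share a b c d.
  move=> hab; apply: (fin (x :: c1 ++ y :: rev p)).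
  - apply: reroute dis' _ => //; rewrite lt0n addn_eq0 !size_eq0; apply/negP => /andP[/eqP c10 /eqP p0].
    move: cdp; rewrite p0 /links /= inE => /eqP[cx dy]; case/negP: D1cd.
    by apply: ncd; rewrite pairs_cat c10 /links /= cx dy mem_head.
  - by rewrite /= size_cat /= size_rev; clear; lia.
  - by rewrite /cedge pairs_cat !mem_cat; case/orP: hab => ->; rewrite ?orbT.
  - by rewrite /cedge pairs_cat !mem_cat !links_rev cdp !orbT.
have arc2 : ((a, b) \in links y c2 x) || ((b, a) \in links y c2 x) -> share a b c d.
  move=> hab; apply: (fin (y :: c2 ++ x :: p)).
  - apply: reroute2 dis' _ => //; rewrite lt0n addn_eq0 !size_eq0; apply/negP => /andP[/eqP c20 /eqP p0].
    move: cdp; rewrite p0 /links /= inE => /eqP[cx dy]; case/negP: D1cd.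
    by rewrite cedge_sym; apply: ncd; rewrite pairs_cat c20 mem_cat /links /= cx dy mem_head orbT.
  - by rewrite /= size_cat /=; clear; lia.
  - by rewrite /cedge pairs_cat !mem_cat; case/orP: hab => ->; rewrite ?orbT.
  - by rewrite /cedge pairs_cat !mem_cat cdp !orbT.
move: D1ab'; rewrite /cedge pairs_cat !mem_cat.
move=> /orP[/orP[]|/orP[]] h; [apply: arc1|apply: arc2|apply: arc1|apply: arc2];
  by rewrite h ?orbT.
Qed.

Section MinimalLongCycle.
Variable C : seq V.
Hypothesis sC : scycle C.
Hypothesis kC : 2 * k < size C.
Hypothesis minC : forall C', scycle C' -> k <= size C' -> size C <= size C'.

(** An ear shorter than both arcs would form with them two cycles shorter than [C], hence shorter
    than [k] by minimality. But their lengths add up to more than [size C], which exceeds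
    [2 * k]. *)
Lemma ear_bound x c1 y c2 p i : rot i C = x :: c1 ++ y :: c2 ->
  path r x (rcons p y) -> uniq p -> ~~ has (mem C) p ->
  minn (size c1) (size c2) <= size p.
Proof.
move=> EC hp up dis; rewrite leqNgt; apply/negP; rewrite leq_min => /andP[p1 p2].
have s' : scycle (x :: c1 ++ y :: c2) by rewrite -EC scycle_rot.
have dis' : ~~ has (mem (x :: c1 ++ y :: c2)) p.
  by rewrite -EC (eq_has (a2 := mem C)) // => z; rewrite /= mem_rot.
have szC : size C = size c1 + size c2 + 2.
  by rewrite -(size_rot i) EC /= size_cat /=; lia.
have h1 := reroute s' hp up dis' (ltn_addr _ (leq_ltn_trans (leq0n _) p1)).
have h2 := reroute2 s' hp up dis' (ltn_addr _ (leq_ltn_trans (leq0n _) p2)).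
have := minC h1; have := minC h2; rewrite /= !size_cat /= size_rev; lia.
Qed.

Definition cdist x y := let a := maxn (index x C) (index y C) - minn (index x C) (index y C) in
  minn a (size C - a).

Lemma cdistC x y : cdist x y = cdist y x.
Proof. by rewrite /cdist maxnC [minn (index x C) _]minnC. Qed.

Lemma ear_cdist x y p : x \in C -> y \in C -> x != y ->
  path r x (rcons p y) -> uniq p -> ~~ has (mem C) p -> cdist x y <= (size p).+1.
Proof.
wlog lt : x y p / index x C < index y C.
  move=> H xC yC xy hp up dis; case: (ltngtP (index x C) (index y C)) => h.
  - exact: H.
  - rewrite cdistC -(size_rev p); apply: H => //; rewrite 1?eq_sym //.
    + by rewrite -path_rev.
    + by rewrite rev_uniq.
    + by rewrite has_rev.
  - by move: xy; rewrite -(nth_index x xC) h nth_index // eqxx.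
move=> xC yC xy hp up dis; rewrite /cdist.
set i := index x C in lt *; set j := index y C in lt *.
have jC : j < size C by rewrite index_mem.
have EC : rot i C = x :: take (j - i.+1) (drop i.+1 C) ++ y :: (drop j.+1 C ++ take i C).
  rewrite /rot (drop_nth x) ?index_mem // nth_index // cat_cons; congr (_ :: _).
  rewrite -{1}(cat_take_drop (j - i.+1) (drop i.+1 C)) -catA -cat_cons; congr (_ ++ _).
  by rewrite drop_drop subnK // (drop_nth y) // nth_index.
have := ear_bound EC hp up dis.
rewrite size_cat size_take !size_drop size_take; move: xC; rewrite -index_mem -/i => iC.
have -> : (j - i.+1 < size C - i.+1) = true by lia.
by rewrite iC; lia.
Qed.

(** The cycle [C] is isometric: cut a path at its visits to [C]. Every piece is an ear, possibly a
    single edge, and is no shorter than the shorter arc of [C] between its ends. *)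
Lemma path_cdist n p x y : size p < n -> x \in C -> y \in C ->
  path r x (rcons p y) -> uniq (x :: p ++ [:: y]) -> cdist x y <= (size p).+1.
Proof.
elim: n p x y => // n IH p x y pn xC yC hp up.
have xy : x != y by move: up => /= /andP[+ _]; rewrite mem_cat inE negb_or => /andP[].
have [/hasP|nh] := boolP (has (mem C) p); last first.
  apply: ear_cdist => //; by move: up => /= /andP[_]; rewrite cat_uniq => /andP[].
move=> [z0 z0p z0C]; have : has (mem C) p by apply/hasP; exists z0.
move=> hh; case: (split_find hh) hp up pn => z p1 p2 zC nh hp up pn.
move: hp up pn; rewrite cat_rcons rcons_cat rcons_cons cat_path /= => /and3P[hp1 hz hp2].
rewrite mem_cat mem_cat !inE !negb_or -!andbA => /and5P[_ xz _ _].
rewrite -catA cat_uniq => /and3P[up1 _ up2] pn.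
have h1 : cdist x z <= (size p1).+1.
  by apply: ear_cdist => //; rewrite rcons_path hp1.
have h2 : cdist z y <= (size p2).+1.
  apply: IH => //; move: pn; rewrite size_cat /= addnS ltnS; apply: leq_ltn_trans (leq_addl _ _).
have tri : cdist x y <= cdist x z + cdist z y.
  move: xC yC zC; rewrite /cdist /= -!index_mem.
  by move: (index x C) (index y C) (index z C) (size C) => i j l m; clear; lia.
move: tri h1 h2; rewrite size_cat /=.
by move: (cdist x y) (cdist x z) (cdist z y) => a b c; clear; lia.
Qed.

(** The two vertices are at distance exactly [k] along [C], because [2 * k < size C], while a cycle
    shorter than [k] would join them by a path of fewer than [k] edges. *)
Lemma no_short_across D x : scycle D -> size D < k -> nth x C 0 \in D -> nth x C k \in D -> False.
Proof.
move=> sD kD xD yD; have uC : uniq C by case/and3P: sC.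
have C0 : 0 < size C by apply: leq_ltn_trans kC.
have Ck : k < size C by lia.
have d : cdist (nth x C 0) (nth x C k) = k.
  rewrite /cdist !index_uniq //; lia.
have k0 : 0 < k by apply: leq_ltn_trans kD.
set a := nth x C 0 in xD d; set b := nth x C k in yD d.
have ab : b != a by rewrite nth_uniq // -lt0n.
have [i t Et] := rot_to xD.
have bt : b \in t.
  have h : b \in a :: t by rewrite -Et mem_rot.
  by move: h; rewrite inE (negPf ab).
case/splitPr: bt Et => q1 q2 Et.
have := sD; rewrite -(scycle_rot i) Et => /and3P[_ uq]; rewrite cycle_cat => /andP[hq _].
have := @path_cdist _ q1 a b (ltnSn _) (mem_nth x C0) (mem_nth x Ck) hq.
rewrite d; have : size D = size q1 + size q2 + 2 by rewrite -(size_rot i) Et /= size_cat /=; lia.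
move=> sz h; have {}h : k <= (size q1).+1.
  apply: h; apply: subseq_uniq uq; rewrite -!cat_cons; apply: cat_subseq => //.
  by rewrite /= eqxx sub0seq.
by move: kD h; rewrite sz; clear; lia.
Qed.

End MinimalLongCycle.

End CycleSurgery.

(** * The cycle space modulo 2 *)

Section EvenSets.
Variable V : finType.
Implicit Types (z r : rel V).

(** Elements of the cycle space over the field with two elements. Unlike cycles they are closed
    under sums, which the exchange argument requires; acyclicity is therefore stated in the same
    terms. *)
Definition even_rel z := symmetric z /\ forall v, \big[addb/false]_u z v u = false.

Definition acyclic_rel r := forall z, even_rel z -> subrel z r -> forall u v, z u v = false.

Lemma even_relD z z' : even_rel z -> even_rel z' ->
  even_rel (fun u v => z u v (+) z' u v).
Proof.
move=> [s e] [s' e']; split=> [u v|v]; first by rewrite s s'.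
by rewrite big_split /= e e'.
Qed.

Lemma even_cedge r c : scycle r c -> even_rel (cedge c).
Proof. by move=> sc; split; [exact: cedge_sym|exact: cedge_even sc]. Qed.

Variables (key : V -> V -> nat).
Hypothesis key_sym : forall u v, key u v = key v u.
Hypothesis key_inj : forall a b c d, key a b = key c d -> (a = c /\ b = d) \/ (a = d /\ b = c).

Lemma key_rel z a b c d : symmetric z -> key a b = key c d -> z a b = z c d.
Proof. by move=> sz /key_inj[[-> ->]|[-> ->]]. Qed.

Variables (r h : rel V) (k : nat).
Hypothesis r_sym : symmetric r.
Hypothesis nomid : no_mid r k.
Hypothesis h_acyclic : acyclic_rel (fun u v => r u v && h u v).
Hypothesis short : forall a b, r a b -> ~~ h a b -> exists D,
  [/\ scycle r D, size D < k, cedge D a b &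
      forall c d, cedge D c d -> key a b <= key c d].

Variables (a0 b0 : V).
(** Equal keys mean equal unoriented edges. The second disjunct keeps [a0 b0] in its own class when
    it lies on no short cycle. *)
Definition class u v := `[< share r k a0 b0 u v >] || (key u v == key a0 b0).

Lemma class_sym : symmetric class.
Proof.
move=> u v; rewrite /class key_sym; congr (_ || _).
by apply/asboolP/asboolP; exact: share_swap.
Qed.

Lemma class_cycle D c d u v : scycle r D -> size D < k -> cedge D c d -> cedge D u v ->
  class c d -> class u v.
Proof.
move=> sD kD Dcd Duv; have S : share r k c d u v by exists D.
case/orP => [/asboolP h1|/eqP e]; apply/orP; left; apply/asboolP.
  exact: share_trans h1 S.
have : cedge D a0 b0 by rewrite -(key_rel (@cedge_sym _ D) e).
by exists D.
Qed.

(* Exchange argument: an edge of [z] outside [h] is replaced by the rest of a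
   short cycle in which it is minimal; the minimal key outside [h] increases
   and the intersection with each class keeps its parity. *)
Lemma class_even z : even_rel z -> subrel z r ->
  forall v, \big[addb/false]_u (z v u && class v u) = false.
Proof.
pose K := (\max_u \max_v key u v).+1.
have Kmax u v : key u v < K.
  by rewrite ltnS; apply: leq_trans (leq_bigmax u); exact: (leq_bigmax v).
suff H n : forall z, even_rel z -> subrel z r ->
    (forall u v, z u v -> ~~ h u v -> K - n <= key u v) ->
    forall v, \big[addb/false]_u (z v u && class v u) = false.
  by move=> ez sz; apply: (H K) => // u v _ _; rewrite subnn.
elim: n => [|n IH] {}z ez sz hz v.
  apply: big1 => u _; rewrite (h_acyclic ez) // => {}u w zuw.
  rewrite sz //=; apply/negPn/negP => nh; have := hz _ _ zuw nh.
  by rewrite subn0 leqNgt Kmax.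
case: (pselect (exists u v, [/\ z u v, ~~ h u v & key u v < K - n])) => [|no]; last first.
  apply: IH => // u w zuw nh; rewrite leqNgt; apply/negP => lt.
  by apply: no; exists u, w.
move=> [a [b [zab nh kab]]]; have := hz _ _ zab nh => kab'.
have [D [sD kD Dab minD]] := short (sz _ _ zab) nh.
pose z' u w := z u w (+) cedge D u w.
have ez' : even_rel z' by apply: even_relD ez (even_cedge sD).
have uniqkey u w : key u w = key a b -> z' u w = false.
  by move=> e; rewrite /z' (key_rel ez.1 e) (key_rel (@cedge_sym _ D) e) zab Dab.
have {}IH := IH z' ez'.
have : \big[addb/false]_u (z' v u && class v u) = false.
  apply: IH => [u w|u w z'uw nh'].
    by rewrite /z'; case: (boolP (z u w)) => [/sz ->//|_]; rewrite addFb => /(cedge_rel r_sym sD).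
  have kuw : key a b <= key u w.
    move: z'uw; rewrite /z'; case: (boolP (z u w)) => [zuw _|_]; last by rewrite addFb => /minD.
    have := hz _ _ zuw nh'; lia.
  have : key u w != key a b by apply: contraTneq z'uw => /uniqkey ->.
  lia.
have E u : z' v u && class v u = (z v u && class v u) (+) (cedge D v u && class v u).
  by rewrite /z' andb_addl.
rewrite (eq_bigr _ (fun u _ => E u)) big_split /=.
suff -> : \big[addb/false]_u (cedge D v u && class v u) = false by rewrite addbF.
(* A short cycle lies inside the class or avoids it, so adding [D] to [z] preserves the parities. *)
have [/existsP[c /existsP[d /andP[Dcd ccd]]]|no] :=
  boolP [exists c, exists d, cedge D c d && class c d].
  rewrite (eq_bigr (cedge D v)); first exact: cedge_even sD _.
  move=> u _; case: (boolP (cedge D v u)) => //= Dvu.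
  exact: class_cycle sD kD Dcd Dvu ccd.
apply: big1 => u _; apply: contraNF no => hvu.
by apply/existsP; exists v; apply/existsP; exists u.
Qed.

End EvenSets.

Section NoLong.
Variables (V : finType) (key : V -> V -> nat).
Hypothesis key_sym : forall u v, key u v = key v u.
Hypothesis key_inj : forall a b c d, key a b = key c d -> (a = c /\ b = d) \/ (a = d /\ b = c).
Variables (r h : rel V) (k : nat).
Hypothesis r_sym : symmetric r.
Hypothesis k_gt0 : 0 < k.
Hypothesis nomid : no_mid r k.
Hypothesis h_acyclic : acyclic_rel (fun u v => r u v && h u v).
Hypothesis short : forall a b, r a b -> ~~ h a b -> exists D,
  [/\ scycle r D, size D < k, cedge D a b &
      forall c d, cedge D c d -> key a b <= key c d].

(** Take a shortest long cycle [C]. By [class_even], at each vertex of [C] the class of its first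
    edge contains both edges of [C] or neither, so it spreads along [C]. Two edges of [C] that are
    [k] apart would then share a short cycle, against [no_short_across]. *)
Lemma no_long_scycle c : scycle r c -> size c < k.
Proof.
move=> sc; rewrite ltnNge; apply/negP => kc.
pose P n := `[< exists C, [/\ scycle r C, k <= size C & size C = n] >].
have exP : exists n, P n by exists (size c); apply/asboolP; exists c.
case: (ex_minnP exP) => m /asboolP[C [sC kC szC]] min.
have minC C' : scycle r C' -> k <= size C' -> size C <= size C'.
  by move=> s' k'; rewrite szC; apply: min; apply/asboolP; exists C'.
have kC2 : 2 * k < size C by case: (nomid sC) => //; rewrite ltnNge kC.
have uC : uniq C by case/and3P: sC.
case: C sC kC szC minC kC2 uC => // x C' sC _ _ minC kC2 uC; set C := x :: C' in sC minC kC2 uC.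
pose a i := nth x C i.
have na i : i < size C' -> next C (a i) = a i.+1.
  move=> hi; have hi' : i < size C by rewrite ltnW.
  have E : index (a i) C = i by rewrite index_uniq.
  transitivity (nth x C' (index (a i) C)); last by rewrite E.
  by rewrite next_nth mem_nth.
have pa i : i < size C' -> prev C (a i.+1) = a i by move=> hi; rewrite -na // prev_next.
have aC i : i < size C -> a i \in C by move=> hi; apply: mem_nth.
have szC' : size C = (size C').+1 by [].
have kC' : k < size C' by move: kC2; rewrite szC'; lia.
clearbody C.
have ce : forall i, i <= k -> class key r k (a 0) (a 1) (a i) (a i.+1).
  elim=> [|i IH] ik; first by rewrite /class eqxx orbT.
  have hi : i < size C' by lia.
  have hi' : i.+1 < size C' by lia.
  have := class_even key_inj r_sym nomid h_acyclic short
     (a 0) (a 1) (even_cedge sC) (fun u v => @cedge_rel _ _ r_sym C u v sC) (a i.+1).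
  have aiC : a i.+1 \in C by rewrite aC // szC' ltnS.
  have np := next_neq_prev sC aiC.
  rewrite (bigD1 (next C (a i.+1))) //= (bigD1 (prev C (a i.+1))) /=; last by rewrite eq_sym.
  rewrite big1; last first.
    move=> u /andP[u1 u2]; rewrite cedgeE // (eq_sym _ u) (negPf u1).
    by rewrite (eq_sym _ u) (negPf u2) andbF.
  rewrite !cedgeE // aiC !eqxx orbT /= addbF na // pa //.
  rewrite (class_sym key_sym _ _ _ _ (a i.+1) (a i)) IH ?(ltnW ik) //.
  by case: (class _ _ _ _ _ _ _).
have := ce k (leqnn k); rewrite /class => /orP[/asboolP[D [sD kD D0 Dk]]|/eqP/key_inj].
  have uD : uniq D by case/and3P: sD.
  have /andP[h0 _] := cedge_mem uD D0; have /andP[hk _] := cedge_mem uD Dk.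
  exact: (no_short_across r_sym sC kC2 minC sD kD h0 hk).
have inj i j : i < size C -> j < size C -> a i = a j -> i = j.
  by move=> hi hj /eqP; rewrite nth_uniq // => /eqP.
have s1 : k < size C by rewrite szC'; lia.
have s2 : k.+1 < size C by rewrite szC'; lia.
have s3 : 0 < size C by rewrite szC'.
have s4 : 1 < size C by lia.
by case=> -[/inj e /inj e']; move: (e s1) (e' s2); lia.
Qed.

End NoLong.

Lemma path_links (V : eqType) (e : rel V) x p y u v :
  path e x (rcons p y) -> (u, v) \in zip (x :: p) (rcons p y) -> e u v.
Proof.
elim: p x => [|z p IH] x /=.
  by rewrite andbT inE => exy /eqP[-> ->].
by move=> /andP[exz pz]; rewrite inE => /orP[/eqP[-> ->]|/(IH _ pz)].
Qed.

Lemma pairs_rotP (V : finType) (c : seq V) a b : uniq c -> (a, b) \in pairs c ->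
  exists i E, rot i c = b :: E /\ last b E = a.
Proof.
move=> uc; rewrite mem_pairs // => /andP[ac /eqP nab].
have bc : b \in c by rewrite -nab mem_next.
have [i E Ei] := rot_to bc; exists i, E; split=> //.
have := cycle_next uc; rewrite -(rot_cycle i) Ei /= rcons_path => /andP[_ /eqP nl].
by rewrite -(prev_next uc (last b E)) nl -nab prev_next.
Qed.

(** * Edges without a shortcut of larger key *)

Section ShortcutFree.
Variables (V : finType) (key : V -> V -> nat) (g : rel V) (k : nat).
Hypothesis key_sym : forall u v, key u v = key v u.
Hypothesis key_inj : forall a b c d, key a b = key c d -> (a = c /\ b = d) \/ (a = d /\ b = c).
Hypothesis g_sym : symmetric g.
Hypothesis g_irr : irreflexive g.

Definition above m : rel V := fun a b => g a b && (m < key a b).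

(** Walks instead of paths, with at most [j] edges: this is the relation that an enumeration of
    neighbor codes decides. *)
Fixpoint wreach m j u v := (u == v) ||
  (if j is j'.+1 then [exists x, above m u x && wreach m j' x v] else false).

Lemma wreachP m j u v : reflect
  (exists p, [/\ path (above m) u p, last u p = v & size p <= j]) (wreach m j u v).
Proof.
elim: j u => [|j IH] u /=.
  by rewrite orbF; apply: (iffP eqP) => [<-|[[|x p] [_ /= <- //]]]; exists [::].
apply: (iffP orP) => [[/eqP <-|/existsP[x /andP[ux /IH[p [hp lp sp]]]]]|].
- by exists [::].
- by exists (x :: p); split=> //=; rewrite ux.
- case=> -[[_ /= <- _]|x p [/= /andP[ux hp] lp sp]]; [by left|right].
  by apply/existsP; exists x; rewrite ux; apply/IH; exists p.
Qed.

Lemma above_sym m : symmetric (above m).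
Proof. by move=> a b; rewrite /above g_sym key_sym. Qed.

Lemma wreach_sym m j u v : wreach m j u v -> wreach m j v u.
Proof.
move=> /wreachP[p [hp <- sp]]; apply/wreachP; exists (rev (belast u p)); split.
- by rewrite rev_path -(eq_path (e := above m)) // => a b; rewrite above_sym.
- by case: p {hp sp} => [|x p] //=; rewrite rev_cons last_rcons.
- by rewrite size_rev size_belast.
Qed.

(* The edges that are not minimal in a cycle of length less than [k]. *)
Definition hadj u v := g u v && ~~ wreach (key u v) (k - 2) u v.

Lemma hadj_sym : symmetric hadj.
Proof.
move=> u v; rewrite /hadj g_sym key_sym; congr (_ && ~~ _).
by apply/idP/idP; exact: wreach_sym.
Qed.

Lemma hadj_g u v : hadj u v -> g u v.
Proof. by case/andP. Qed.

(** In a cycle shorter than [k], the edge of least key is bypassed by the rest of the cycle, a walk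
    of at most [k - 2] edges of larger key. *)
Lemma scycle_hadj c : scycle hadj c -> k <= size c.
Proof.
move=> sc; rewrite leqNgt; apply/negP => ck; have [s3 uc cyc] := and3P sc.
have [q0 q0c] : exists q0, q0 \in pairs c.
  case: c s3 {sc uc cyc ck} => // x c _; exists (nth (x, x) (pairs (x :: c)) 0).
  by rewrite mem_nth // /pairs size_zip size_rot minnn.
have [[a b] abc minab] : exists2 q, q \in pairs c & forall q', q' \in pairs c -> key q.1 q.2 <= key q'.1 q'.2.
  pose P := mem (pairs c).
  by case: (@arg_minnP _ q0 P (fun q => key q.1 q.2) q0c) => q qc hq; exists q.
have [i [E [Ei la]]] := pairs_rotP uc abc.
have sE : size E = (size c).-1 by rewrite -(size_rot i c) Ei.
have uE : uniq (b :: E) by rewrite -Ei rot_uniq.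
have hE : path hadj b E by move: cyc; rewrite -(rot_cycle i) Ei /= rcons_path => /andP[].
have nE : path (frel (next c)) b E.
  by have := cycle_next uc; rewrite -(rot_cycle i) Ei /= rcons_path => /andP[].
have w : wreach (key b a) (k - 2) b a.
  apply/wreachP; exists E; split; [|exact: la|by rewrite sE; lia].
  apply/(pathP b) => j hj; rewrite /above.
  have /(pathP b)/(_ _ hj) h1 := hE; have /(pathP b)/(_ _ hj) /= /eqP h2 := nE.
  rewrite (hadj_g h1) /=; set x := nth b (b :: E) j in h1 h2 *; set y := nth b E j in h1 h2 *.
  have xc : x \in c by rewrite -(mem_rot i) Ei mem_nth //= ltnW.
  have xyc : (x, y) \in pairs c by rewrite mem_pairs // xc h2 eqxx.
  rewrite key_sym ltn_neqAle (minab _ xyc) andbT; apply/eqP => /= e.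
  have ny : y = nth b (b :: E) j.+1 by [].
  have inj m n : m < size (b :: E) -> n < size (b :: E) ->
      nth b (b :: E) m = nth b (b :: E) n -> m = n.
    by move=> hm hn /eqP; rewrite nth_uniq // => /eqP.
  have hj1 : j.+1 < size (b :: E) by [].
  have hj0 : j < size (b :: E) by apply: ltnW.
  have h0 : 0 < size (b :: E) by [].
  have la' : a = nth b (b :: E) (size E) by rewrite -la (last_nth b).
  have hl : size E < size (b :: E) by [].
  (* An edge of the rest with the same key would be [ab] itself, which the distinctness of at least
     three vertices excludes. *)
  case: (key_inj e) => -[ea eb].
    by move: eb; rewrite ny => /(inj 0 j.+1 h0 hj1).
  have j0 : 0 = j by apply: inj.
  have : j.+1 = size E by apply: inj => //; rewrite -la' ea ny.
  by rewrite -j0 sE; move: s3; clear; lia.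
have : hadj b a by rewrite hadj_sym; move: abc; rewrite mem_pairs // => /andP[ac /eqP <-]; apply: next_cycle.
by rewrite /hadj w andbF.
Qed.

(** A shortcut contains a path, which the edge [ab] closes to a short cycle where [ab] has the least
    key. The path has an inner vertex because [ab] is not above its own key. *)
Lemma hadj_short a b : 1 < k -> g a b -> ~~ hadj a b -> exists D,
  [/\ scycle g D, size D < k, cedge D a b &
      forall c d, cedge D c d -> key a b <= key c d].
Proof.
move=> k1 gab; rewrite /hadj gab /= negbK => /wreachP[p [hp lp sp]].
move: hp lp sp; move=> hp; case/shortenP: (hp) => p' hp' up' sub lp' sp.
have {}sp : size p' <= k - 2.
  apply: leq_trans sp; apply: uniq_leq_size sub; by case/andP: up'.
have p'b : last a p' = b by [].
case/lastP: p' hp' up' {sub lp'} sp p'b => [|q z] hp' up' sp p'b.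
  by move: gab; rewrite -p'b g_irr.
rewrite last_rcons in p'b; rewrite p'b in hp' up' sp => {z p'b}.
exists (a :: q ++ [:: b]).
have gp : path g a (rcons q b) by apply: sub_path hp' => x y /andP[].
split.
- apply/and3P; split.
  + rewrite /= size_cat /=; case: q hp' {up' sp gp} => [|x q] /=; last by lia.
    by rewrite /above ltnn andbF.
  + by rewrite cats1.
  + by rewrite cycle_cat gp /= g_sym gab.
- by move: sp; rewrite size_rcons /= size_cat /=; lia.
- by rewrite /cedge pairs_cat !mem_cat /links /= mem_head !orbT.
- have K c d : (c, d) \in pairs (a :: q ++ [:: b]) -> key a b <= key c d.
    rewrite pairs_cat mem_cat => /orP[/(path_links hp')/andP[_ /ltnW //]|].
    by rewrite /links /= inE => /eqP[-> ->]; rewrite key_sym.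
  by move=> c d /orP[|] /K //; rewrite (key_sym d c).
Qed.

End ShortcutFree.

Section Balls.
Variables (V : finType) (g : rel V) (d : nat).
Hypothesis g_deg : forall v, #|[set u | g v u]| <= d.

Fixpoint ball j v : {set V} :=
  if j is j'.+1 then \bigcup_(u in v |: [set u | g v u]) ball j' u else [set v].

Lemma leq_card_bigcup (I : finType) (A : {set I}) (B : I -> {set V}) n :
  (forall i, #|B i| <= n) -> #|\bigcup_(i in A) B i| <= #|A| * n.
Proof.
move=> hB; rewrite -sum_nat_const; elim/big_rec2: _ => [|i s S _ IH]; first by rewrite cards0.
by apply: leq_trans (leq_card_setU _ _) (leq_add (hB i) IH).
Qed.

Lemma card_ball j v : #|ball j v| <= d.+1 ^ j.
Proof.
elim: j v => [|j IH] v /=; first by rewrite cards1.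
apply: leq_trans (leq_card_bigcup _ IH) _; rewrite expnS leq_mul2r; apply/orP; right.
by rewrite cardsU1 -add1n leq_add // leq_b1.
Qed.

Lemma ball_path j v p : path g v p -> size p <= j -> last v p \in ball j v.
Proof.
elim: j v p => [|j IH] v [|u p] //=; first by rewrite inE.
  by move=> _ _; apply/bigcupP; exists v; [rewrite !inE eqxx|exact: (IH v [::])].
by move=> /andP[gvu hp] sp; apply/bigcupP; exists u; [rewrite !inE gvu orbT|exact: IH].
Qed.

Lemma ball_cycle D u v j : scycle g D -> size D <= j -> u \in D -> v \in D -> v \in ball j u.
Proof.
move=> sD sj uD vD; have [i t Et] := rot_to uD.
have vt : v \in u :: t by rewrite -Et mem_rot.
have cy : path g u t.
  by case/and3P: sD => _ _; rewrite -(rot_cycle i) Et /= rcons_path => /andP[].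
have st : (size t).+1 = size D by rewrite -(size_rot i D) Et.
move: vt; rewrite inE => /orP[/eqP ->|vt]; first exact: (@ball_path _ _ [::]).
case/splitPr: vt cy st => p1 p2; rewrite -cat_rcons cat_path => /andP[h _] st.
rewrite -(last_rcons u p1 v); apply: ball_path => //.
by move: st; rewrite size_cat size_rcons; lia.
Qed.

Definition edge_ball j (S : {set V}) : {set V * V} :=
  [set p : V * V | (p.1 \in \bigcup_(u in S) ball j u) && g p.1 p.2].

Lemma card_edges_from (S : {set V}) : #|[set p : V * V | (p.1 \in S) && g p.1 p.2]| <= #|S| * d.
Proof.
rewrite -sum1_card (eq_bigl (fun p : V * V => (p.1 \in S) && g p.1 p.2)); last by move=> p; rewrite inE.
rewrite -(pair_big_dep (fun x => x \in S) g (fun _ _ => 1)) /= -sum_nat_const.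
apply: leq_sum => u _; apply: leq_trans (g_deg u).
by rewrite sum1_card; apply: subset_leq_card; apply/subsetP => v; rewrite inE.
Qed.

Lemma card_edge_ball j S : #|edge_ball j S| <= #|S| * (d.+1 ^ j * d).
Proof.
apply: leq_trans (card_edges_from _) _; rewrite mulnA leq_mul2r; apply/orP; right.
by apply: leq_card_bigcup => v; exact: card_ball.
Qed.

End Balls.

(** The shifted numbers are the machine words of the vertices. Both are at most [N], so the base
    [N.+1] lets the key determine the unordered pair. *)
Definition edge_key (N : nat) (u v : 'I_N) := minn u.+1 v.+1 * N.+1 + maxn u.+1 v.+1.

Lemma edge_key_sym N (u v : 'I_N) : edge_key u v = edge_key v u.
Proof. by rewrite /edge_key minnC maxnC. Qed.

Lemma edge_key_inj N (a b c d : 'I_N) : edge_key a b = edge_key c d ->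
  (a = c /\ b = d) \/ (a = d /\ b = c).
Proof.
move=> e; have lt (x y : 'I_N) : maxn x.+1 y.+1 < N.+1 by rewrite ltnS geq_max !ltn_ord.
have em : maxn a.+1 b.+1 = maxn c.+1 d.+1.
  by have := congr1 (modn^~ N.+1) e; rewrite /edge_key !modnMDl !modn_small.
move: e; rewrite /edge_key em => /addIn /eqP; rewrite eqn_mul2r /= => /eqP ei.
have [[/val_inj -> /val_inj ->]|[/val_inj -> /val_inj ->]] :
  (val a = val c /\ val b = val d) \/ (val a = val d /\ val b = val c);
  [|by left|by right].
by move: em ei => /=; clear; lia.
Qed.

(** * Destroying all long cycles by few deletions *)

Section Reduction.
Variables (N d k Z : nat) (G : sgraph N).
Hypothesis k_gt3 : 3 < k.
Hypothesis G_deg : max_degree_le G d.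
Hypothesis G_far : forall G' : sgraph N, no_long_cycle G' k -> d * N < Z * edge_dist G G'.

Local Notation g := (adj G).
Local Notation key := (@edge_key N).
Definition shortcut_free := hadj key g k.

Definition mid_vertices : {set 'I_N} :=
  [set v | `[< exists c, [/\ scycle g c, k <= size c <= 2 * k & v \in c] >]].

Variable T : {set 'I_N * 'I_N}.
Hypothesis T_acyclic : acyclic_rel (fun u v => (u, v) \in T).

Let F := [set p : 'I_N * 'I_N | shortcut_free p.1 p.2 && (p \notin T)].
Let g1 : rel 'I_N := fun u v => [&& g u v, u \notin mid_vertices & v \notin mid_vertices].
Let witness a b D := [/\ scycle g1 D, size D < k, cedge D a b &
  forall c e, cedge D c e -> key a b <= key c e].
(** Edges outside H that are no longer minimal on any short cycle once the vertices of
    [mid_vertices] have been isolated. *)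
Let bad2 := [set p : 'I_N * 'I_N | [&& g1 p.1 p.2, ~~ shortcut_free p.1 p.2 &
  ~~ `[< exists D, witness p.1 p.2 D >]]].
Let bad := F :|: bad2.
(** Whole classes are deleted, so that a surviving edge keeps all the short cycles of [g1] through
    it: the other edges of such a cycle lie in the same classes. *)
Let g3 : rel 'I_N := fun u v => g1 u v && ~~ [exists p in bad, class key g1 k p.1 p.2 u v].

Let g1_sym : symmetric g1.
Proof. by move=> u v; rewrite /g1 adj_sym; congr (_ && _); rewrite andbC. Qed.

Let g1_g u v : g1 u v -> g u v. Proof. by case/and3P. Qed.

Lemma sub_scycle (r r' : rel 'I_N) D : {in D &, subrel r r'} -> scycle r D -> scycle r' D.
Proof.
move=> sub /and3P[s u c]; apply/and3P; split=> //.
by apply: (sub_in_cycle (P := mem D)) c => //; exact/allP.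
Qed.

Let nomid1 : no_mid g1 k.
Proof.
move=> c sc; case: (ltnP (size c) k) => [|kc]; [by left|right].
rewrite ltnNge; apply/negP => ck.
case: c sc kc ck => [|x c] sc kc ck; first by case/and3P: sc.
have [y xy] : exists y, g1 x y.
  exists (next (x :: c) x); case/and3P: sc => _ u cy; apply: next_cycle => //; exact: mem_head.
case/and3P: xy => _ /negP + _; apply; rewrite inE; apply/asboolP; exists (x :: c).
split; [by apply: sub_scycle sc => u v _ _ /g1_g|by rewrite kc|exact: mem_head].
Qed.

Let g3_sym : symmetric g3.
Proof.
move=> u v; rewrite /g3 g1_sym; congr (_ && ~~ _); apply: eq_existsb => p.
by rewrite class_sym //; exact: edge_key_sym.
Qed.

Let g3_irr : irreflexive g3.
Proof. by move=> u; rewrite /g3 /g1 adj_irr. Qed.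

Let G3 := SGraph g3_sym g3_irr.

Let G3_no_long : no_long_cycle G3 k.
Proof.
move=> c sc; apply: (@no_long_scycle _ key (@edge_key_sym N) (@edge_key_inj N) g3
  (fun u v => (u, v) \in T) k) => //.
- exact: ltnW (ltnW (ltnW _)).
- move=> D sD; apply: nomid1; apply: sub_scycle sD => u v _ _; by case/andP.
- by move=> z ez sz; apply: T_acyclic ez _ => u v /sz /andP[].
move=> a b /andP[ab1 nbad] abT.
have cl p : p \in bad -> class key g1 k p.1 p.2 a b -> False.
  by move=> pb cp; move/negP: nbad; apply; apply/existsP; exists p; rewrite pb.
have abh : ~~ shortcut_free a b.
  apply/negP => abh; apply: (cl (a, b)); last by rewrite /class eqxx orbT.
  by rewrite !inE /= abh abT.
have /asboolP[D [sD kD Dab minD]] : `[< exists D, witness a b D >].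
  apply/negPn/negP => nw; apply: (cl (a, b)); last by rewrite /class eqxx orbT.
  by rewrite !inE /= ab1 abh nw orbT.
exists D; split=> //; have [s3 uD cD] := and3P sD.
apply/and3P; split=> //; apply: cycle_from_next => // x xD.
have Dx : cedge D x (next D x) by rewrite /cedge mem_pairs // xD eqxx.
rewrite /g3 (cedge_rel g1_sym sD Dx) /=; apply/negP => /existsP[p /andP[pb pc]].
apply: (cl p pb); exact: (class_cycle (@edge_key_inj N) g1_sym nomid1 sD kD Dx Dab pc).
Qed.

Let P := d.+1 ^ k * d.

(** The deleted edges meet [mid_vertices] or lie in the class of a bad edge, hence within distance
    [k] of it. A bad edge is in [F], or its short cycle passes through a vertex of [mid_vertices],
    so that it starts in the ball of radius [k] around that vertex. *)
Lemma reduction_bound :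
  d * N < Z * (2 * (#|mid_vertices| * d) + (#|F| + #|mid_vertices| * P) * P).
Proof.
apply: leq_trans (G_far G3_no_long) _; rewrite leq_mul2l; apply/orP; right.
pose A1 := [set p : 'I_N * 'I_N | (p.1 \in mid_vertices) && g p.1 p.2].
pose A2 := [set (p.2, p.1) | p in A1].
pose B := \bigcup_(b in bad) edge_ball g k [set b.1].
have bad_g b : b \in bad -> g b.1 b.2.
  by rewrite !inE => /orP[/andP[/hadj_g]|/andP[/g1_g]].
have cA1 : #|A1| <= #|mid_vertices| * d by apply: card_edges_from; exact: G_deg.
have cB : #|B| <= (#|F| + #|mid_vertices| * P) * P.
  apply: leq_trans (leq_card_bigcup _ (n := P) _) _.
    by move=> b; apply: leq_trans (card_edge_ball G_deg _ _) _; rewrite cards1 mul1n.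
  rewrite leq_mul2r; apply/orP; right; apply: leq_trans (leq_card_setU _ _) _.
  rewrite leq_add2l; apply: leq_trans (card_edge_ball G_deg k mid_vertices).
  apply: subset_leq_card; apply/subsetP => -[a b]; rewrite !inE /= => /and3P[ab1 nh nw].
  rewrite (g1_g ab1) andbT.
  have [|D [sD kD Dab minD]] := hadj_short (@edge_key_sym N) (@adj_sym _ G) (@adj_irr _ G) _ (g1_g ab1) nh.
    exact: ltnW (ltnW _).
  have uD : uniq D by case/and3P: sD.
  have /andP[aD _] := cedge_mem uD Dab.
  have [/hasP[w wD wm]|nw'] := boolP (has (mem mid_vertices) D).
    apply/bigcupP; exists w => //; exact: ball_cycle sD (ltnW kD) wD aD.
  case/negP: nw; apply/asboolP; exists D; split=> //.
  apply: sub_scycle sD => u v uD' vD' guv; rewrite /g1 guv /=.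
  by move/hasPn: nw' => h; rewrite (h u) ?(h v).
apply: (@leq_trans #|A1 :|: A2 :|: B|); last first.
  apply: leq_trans (leq_card_setU _ _) (leq_add _ cB).
  apply: leq_trans (leq_card_setU _ _) _; rewrite mul2n -addnn leq_add //.
  exact: leq_trans (leq_imset_card _ _) cA1.
apply: subset_leq_card; apply/subsetP => -[u v]; rewrite !inE /=.
have -> : [&& ~~ ((u < v) && g u v), u < v & g3 u v] = false.
  by rewrite /g3 /g1; case: (g u v); rewrite ?andbF //= andbT; case: (u < v).
rewrite orbF => /and3P[ng3 uv guv]; move: ng3; rewrite uv /= /g3 /g1 guv /=.
case: (boolP (u \in mid_vertices)) => um /=; first by move: um; rewrite inE => ->.
case: (boolP (v \in mid_vertices)) => vm /=.
  move=> _; apply/orP; left; apply/orP; right; apply/imsetP; exists (v, u) => //.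
  by rewrite inE /= vm adj_sym.
rewrite negbK => /existsP[[a b] /andP[abb cab]]; apply/orP; right.
apply/bigcupP; exists (a, b) => //; rewrite inE /= guv andbT.
apply/bigcupP; exists a; first by rewrite inE.
case/orP: cab => /= [/asboolP[D [sD kD Dab Duv]]|/eqP/edge_key_inj[[-> _]|[-> _]]].
- have uD : uniq D by case/and3P: sD.
  have /andP[aD _] := cedge_mem uD Dab; have /andP[uD' _] := cedge_mem uD Duv.
  have sD' : scycle g D by apply: sub_scycle sD => x y _ _ /g1_g.
  exact: ball_cycle sD' (ltnW kD) aD uD'.
- exact: (@ball_path _ _ _ _ [::]).
- apply: (@ball_path _ _ _ _ [:: b]) => /=; first by rewrite (bad_g _ abb).
  exact: ltnW (ltnW (ltnW _)).
Qed.

End Reduction.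

Lemma cycle_long (N k : nat) (G : sgraph N) c :
  scycle (shortcut_free k G) c -> simple_cycle G c /\ k <= size c.
Proof.
move=> sc; split; first by apply: sub_scycle sc => u v _ _ /hadj_g.
exact: (scycle_hadj (@edge_key_sym N) (@edge_key_inj N) (@adj_sym _ G) sc).
Qed.

(** * Signings far from balanced *)

Section Signing.
Variables (N : nat) (h : rel 'I_N).
Hypothesis h_sym : symmetric h.
Hypothesis h_irr : irreflexive h.
Local Notation V := 'I_N.
Implicit Types (S T : {set V * V}) (chi : {ffun V -> bool}).

Definition sym_closure S : rel V := fun u v => ((u, v) \in S) || ((v, u) \in S).
Definition arcs : {set V * V} := [set p : V * V | h p.1 p.2 && (p.1 < p.2)].
Definition delta chi : {set V * V} := [set p in arcs | chi p.1 (+) chi p.2].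
Definition symdiff S T : {set V * V} := [set p | (p \in S) (+) (p \in T)].

(** A cut meets every element of the cycle space in an even number of edges; the condition [u < v]
    counts each edge once. *)
Lemma even_delta (z : rel V) chi : even_rel z -> subrel z h ->
  \big[addb/false]_(u : V) \big[addb/false]_(v : V) ((u < v) && z u v && (chi u (+) chi v)) = false.
Proof.
move=> [zs ze] zh.
transitivity (\big[addb/false]_(u : V) (chi u && \big[addb/false]_(v : V) z u v)); last first.
  by apply: big1 => u _; rewrite ze andbF.
have -> : \big[addb/false]_(u : V) \big[addb/false]_(v : V) ((u < v) && z u v && (chi u (+) chi v)) =
    (\big[addb/false]_(u : V) \big[addb/false]_(v : V) ((u < v) && z u v && chi u)) (+)
    (\big[addb/false]_(u : V) \big[addb/false]_(v : V) ((u < v) && z u v && chi v)).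
  rewrite -big_split; apply: eq_bigr => u _; rewrite -big_split; apply: eq_bigr => v _ /=.
  by rewrite andb_addr.
rewrite [X in _ (+) X]exchange_big -big_split; apply: eq_bigr => u _ /=.
rewrite -big_split big_distrr /=; apply: eq_bigr => v _.
rewrite (zs v u); case: (ltngtP u v) => [||/val_inj ->]; rewrite ?andbF ?addbF ?addFb //=;
  rewrite ?(andbC (chi _)) //.
by case: (boolP (z v v)) => // /zh; rewrite h_irr.
Qed.

Lemma exists_spanning_forest : exists T0, [/\ T0 \subset arcs, acyclic_rel (sym_closure T0) &
  forall e, e \in arcs -> e \notin T0 -> ~ acyclic_rel (sym_closure (e |: T0))].
Proof.
pose P T := (T \subset arcs) && `[< acyclic_rel (sym_closure T) >].
have P0 : P set0.
  rewrite /P sub0set; apply/asboolP => z ez zs u v; apply/negP => /zs.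
  by rewrite /sym_closure !inE.
have [T0 /andP[T0a /asboolP ac] max] := @arg_maxnP _ set0 P (fun T => #|T|) P0.
exists T0; split=> // e ea eT ace.
have /max : P (e |: T0) by rewrite /P subUset sub1set ea T0a; exact/asboolP.
by rewrite /= cardsU1 eT ltnn.
Qed.

Variable T0 : {set V * V}.
Hypothesis T0_arcs : T0 \subset arcs.
Hypothesis T0_acyclic : acyclic_rel (sym_closure T0).
Hypothesis T0_max : forall e, e \in arcs -> e \notin T0 -> ~ acyclic_rel (sym_closure (e |: T0)).

Lemma sym_closure_h S : S \subset arcs -> subrel (sym_closure S) h.
Proof.
move=> /subsetP sub u v /orP[] /sub; rewrite inE /= => /andP[] //.
by rewrite h_sym.
Qed.

(** By maximality, any other arc closes a cycle with [T0]. A cut meets this cycle evenly and avoids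
    [T0], so it avoids the arc too. *)
Lemma delta_spanning chi : delta chi :&: T0 = set0 -> delta chi = set0.
Proof.
move=> d0; apply/setP => -[a b]; rewrite in_set0; apply/negP => abd.
have : (a, b) \in arcs by move: abd; rewrite inE => /andP[].
move=> aba; have abT : (a, b) \notin T0.
  by apply/negP => abT; move/setP/(_ (a, b)): d0; rewrite inE abd abT inE.
apply: (T0_max aba abT) => z ez zs.
have sub : (a, b) |: T0 \subset arcs by rewrite subUset sub1set aba.
have zh : subrel z h by move=> u v /zs; exact: sym_closure_h.
have chiT u v : (u, v) \in T0 -> chi u (+) chi v = false.
  move=> uvT; apply/negP => c; move/setP/(_ (u, v)): d0; rewrite inE in_set0 uvT andbT inE /=.
  by rewrite (subsetP T0_arcs) // c.
have [zab|nzab] := boolP (z a b); last first.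
  apply: T0_acyclic => // u v zuv; have := zs _ _ zuv; rewrite /sym_closure !inE.
  case: ((u, v) =P (a, b)) => [[ua vb]|_] /=; first by rewrite -ua -vb zuv in nzab.
  case: ((v, u) =P (a, b)) => [[va ub]|_] //=.
  by rewrite -va -ub ez.1 zuv in nzab.
have := even_delta chi ez zh; rewrite (bigD1 a) //= (bigD1 b) //=.
move: aba abd; rewrite !inE /= => /andP[hab lab] /andP[_ ->]; rewrite lab zab /=.
rewrite big1 ?addbF; last first.
  move=> v vb; apply/negP => /andP[/andP[lt /zs cl] c]; move: cl; rewrite /sym_closure !inE -!pair_eqE /=.
  rewrite eqxx (negPf vb) /= => /orP[/chiT|]; first by rewrite c.
  case/orP=> [/andP[/eqP va /eqP ab]|/(subsetP T0_arcs)].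
    by move: lt; rewrite va ltnn.
  by rewrite inE /= ltnNge (ltnW lt) andbF.
rewrite big1 // => u ua; apply: big1 => v _; apply/negP => /andP[/andP[lt /zs cl] c]; move: cl.
rewrite /sym_closure !inE -!pair_eqE /= (negPf ua) /= => /orP[/chiT|]; first by rewrite c.
case/orP=> [/andP[/eqP va /eqP ub]|/(subsetP T0_arcs)].
  by move: lt; rewrite va ub ltnNge (ltnW lab).
by rewrite inE /= ltnNge (ltnW lt) andbF.
Qed.

Lemma delta_inj chi chi' : delta chi :&: T0 = delta chi' :&: T0 -> delta chi = delta chi'.
Proof.
pose psi := [ffun u => chi u (+) chi' u].
have E p : (p \in delta psi) = (p \in delta chi) (+) (p \in delta chi').
  rewrite !inE !ffunE; case: (h _ _); case: (p.1 < p.2) => //=.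
  by case: (chi p.1); case: (chi p.2); case: (chi' p.1); case: (chi' p.2).
move=> e; have /delta_spanning/setP d0 : delta psi :&: T0 = set0.
  apply/setP => p; rewrite in_set0 inE E andb_addl.
  by move/setP/(_ p): e; rewrite [LHS]inE [RHS]inE => ->; rewrite addbb.
apply/setP => p; have := d0 p; rewrite E in_set0.
by case: (p \in delta chi); case: (p \in delta chi').
Qed.

(* Counting: every set of arcs within distance [r] of a coboundary is
   determined by the trace of the coboundary on the spanning forest and by the
   list of the differences. *)
Lemma exists_signing r : (N ^ 2).+1 ^ r < 2 ^ (#|arcs| - #|T0|) ->
  exists2 sg : {set V * V}, sg \subset arcs &
    forall chi, r < #|symdiff (delta chi) sg|.
Proof.
move=> hr; apply: contrapT => no.
have H (sg : {set V * V}) : sg \subset arcs -> exists chi, #|symdiff (delta chi) sg| <= r.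
  move=> sa; apply: contrapT => no'; apply: no; exists sg => // chi.
  by rewrite ltnNge; apply/negP => le; apply: no'; exists chi.
pose D S := if [pick chi | delta chi :&: T0 == S] is Some chi then delta chi else set0.
have DE chi : D (delta chi :&: T0) = delta chi.
  by rewrite /D; case: pickP => [chi' /eqP/delta_inj //|/(_ chi)]; rewrite eqxx.
(* Each of the [r] slots for differences holds an ordered pair or, as padding, [None]; this is the
   origin of the base [(N ^ 2).+1]. *)
pose f (q : {set V * V} * {ffun 'I_r -> option (V * V)}) :=
  symdiff (D q.1) [set p | [exists i, q.2 i == Some p]].
have : powerset arcs \subset f @: finset.setX (powerset T0) [set: {ffun 'I_r -> option (V * V)}].
  apply/subsetP => sg; rewrite inE => /H[chi hchi]; apply/imsetP.
  set B := symdiff _ _ in hchi.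
  exists (delta chi :&: T0, [ffun i : 'I_r => nth None [seq Some p | p <- enum B] i]).
    by rewrite !inE subsetIr.
  apply/setP => p; rewrite /f /= DE [RHS]inE.
  have -> : (p \in [set p | [exists i, [ffun i : 'I_r => nth None [seq Some p | p <- enum B] i] i == Some p]])
     = (p \in B).
    rewrite inE; apply/existsP/idP => [[i]|pB].
      rewrite ffunE; case: (ltnP i (size (enum B))) => hi; last first.
        by rewrite nth_default // size_map.
      by rewrite (nth_map p) // => /eqP[<-]; rewrite -mem_enum mem_nth.
    have lt : index p (enum B) < #|B| by rewrite cardE index_mem mem_enum.
    exists (Ordinal (leq_trans lt hchi)); rewrite ffunE (nth_map p) /= -?cardE //.
    by rewrite nth_index // mem_enum.
  by rewrite {1}/B [in X in _ (+) X]in_set addbA addbb addFb.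
move/subset_leq_card; move=> /leq_trans /(_ (leq_imset_card _ _)).
rewrite cardsX !card_powerset cardsT card_ffun card_option card_prod card_ord.
rewrite -{1}(subnK (subset_leq_card T0_arcs)) expnD mulnC leq_pmul2l ?expn_gt0 //.
by move=> le; move: (leq_trans hr le); rewrite mulnn card_ord ltnn.
Qed.

End Signing.

(** * Execution of programs *)

Section Execution.
Variables (w N : nat) (nb : 'I_N -> seq 'I_N).
Local Notation ev m e := (Defs.eval w m e).

(* [reds n bs l s s']: [s] reaches [s'] in [n] steps when the successive random
   choices, among [outcomes b] for the successive [b] in [bs], are [l]. *)
Fixpoint reds (n : nat) (bs l : seq nat) (s s' : config) : Prop :=
  match n, s with
  | 0, _ => [/\ bs = [::], l = [::] & s = s']
  | n'.+1, ([::], _) => False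
  | n'.+1, (Rand a i b :: K, m) =>
      if (bs, l) is (b' :: bs', x :: l') then
        [/\ b' = ev m b, x \in outcomes b' &
            reds n' bs' l' (K, write m a (ev m i) x) s']
      else False
  | n'.+1, _ => reds n' bs l (head s (Defs.next w nb s)) s'
  end.

Lemma reds_cat n1 n2 bs1 bs2 l1 l2 s1 s2 s3 :
  reds n1 bs1 l1 s1 s2 -> reds n2 bs2 l2 s2 s3 ->
  reds (n1 + n2) (bs1 ++ bs2) (l1 ++ l2) s1 s3.
Proof.
elim: n1 bs1 l1 s1 => [|n1 IH] bs1 l1 s1; first by case=> -> -> ->.
case: s1 => [[|c K] m] //.
case: c => [a i e|a i v j|a i b|c1 c2|e c1 c2|e c1];
  try (rewrite addSn /=; exact: IH).
rewrite addSn /=; case: bs1 => [|b' bs1]; case: l1 => [|x l1] //=.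
by case=> -> xb h h2; split=> //; exact: IH h h2.
Qed.

(** Total correctness for a given tape, with a bound on the time because branches differ in length.
    Quantifying over the continuation [K] makes the specifications composable. *)
Definition wp (c : cmd) (m : memory) (bs l : seq nat) (T : nat) (Q : memory -> Prop) :=
  exists n m', [/\ n <= T, Q m' & forall K, reds n bs l (c :: K, m) (K, m')].

Lemma wp_weaken c m bs l T T' (Q Q' : memory -> Prop) :
  T <= T' -> (forall m', Q m' -> Q' m') -> wp c m bs l T Q -> wp c m bs l T' Q'.
Proof.
move=> TT QQ [n [m' [nT Qm h]]]; exists n, m'; split=> //; [exact: leq_trans TT|exact: QQ].
Qed.

Lemma wp_rand a i b m x T (Q : memory -> Prop) : 0 < T -> x \in outcomes (ev m b) ->
  Q (write m a (ev m i) x) -> wp (Rand a i b) m [:: ev m b] [:: x] T Q.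
Proof. by move=> T0 xb Qm; exists 1, (write m a (ev m i) x). Qed.

Lemma wp_then c1 c2 m bs1 bs2 l1 l2 T1 T2 Q :
  wp c1 m bs1 l1 T1 (fun m1 => wp c2 m1 bs2 l2 T2 Q) ->
  wp (Then c1 c2) m (bs1 ++ bs2) (l1 ++ l2) (T1 + T2).+1 Q.
Proof.
move=> [n1 [m1 [h1 [n2 [m2 [h2 Qm r2]]] r1]]].
exists (n1 + n2).+1, m2; split; [by rewrite ltnS leq_add|by []|move=> K].
exact: reds_cat (r1 (c2 :: K)) (r2 K).
Qed.

Lemma wp_cond e c1 c2 m bs l T Q :
  wp (if ev m e != 0 then c1 else c2) m bs l T Q -> wp (Cond e c1 c2) m bs l T.+1 Q.
Proof.
by move=> [n [m' [h Qm r]]]; exists n.+1, m'; split=> // K; exact: (r K).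
Qed.

Lemma wp_while0 e c m T (Q : memory -> Prop) : 0 < T -> ev m e = 0 -> Q m ->
  wp (While e c) m [::] [::] T Q.
Proof. by move=> T0 e0 Qm; exists 1, m; split=> // K /=; rewrite e0. Qed.

Lemma wp_while1 e c m bs1 bs2 l1 l2 T1 T2 Q : ev m e != 0 ->
  wp c m bs1 l1 T1 (fun m1 => wp (While e c) m1 bs2 l2 T2 Q) ->
  wp (While e c) m (bs1 ++ bs2) (l1 ++ l2) (T1 + T2).+1 Q.
Proof.
move=> e1 [n1 [m1 [h1 [n2 [m2 [h2 Qm r2]]] r1]]].
exists (n1 + n2).+1, m2; split; [by rewrite ltnS leq_add|by []|move=> K].
by rewrite /= e1; exact: reds_cat (r1 (While e c :: K)) (r2 K).
Qed.

(** Every round consumes a piece of tape of the same shape, and the abstract state is folded over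
    the pieces. *)
Lemma wp_fold (St : Type) (F : St -> seq nat -> St) (Inv : nat -> St -> memory -> Prop)
    e c bs T n :
  (forall i st m l, i < n -> is_tape bs l -> Inv i st m ->
     ev m e != 0 /\ wp c m bs l T (Inv i.+1 (F st l))) ->
  (forall st m, Inv n st m -> ev m e = 0) ->
  forall ls i st m, all (is_tape bs) ls -> i + size ls = n -> Inv i st m ->
  wp (While e c) m (flatten (nseq (size ls) bs)) (flatten ls)
     (size ls * T.+1).+1 (Inv n (foldl F st ls)).
Proof.
move=> hstep hend; elim=> [|l ls IH] i st m /= hls hi Im.
  rewrite addn0 in hi; subst i; apply: wp_while0 => //; exact: hend Im.
case/andP: hls => hl hls; have lt : i < n by rewrite -hi; lia.
have [e1 h] := hstep i st m l lt hl Im.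
apply: (@wp_weaken _ _ _ _ (T + (size ls * T.+1).+1).+1 _ (Inv n (foldl F (F st l) ls))).
- by lia.
- by [].
apply: wp_while1 => //; apply: wp_weaken h => // m1 I1.
by apply: (IH i.+1) => //; rewrite -hi; lia.
Qed.

Lemma wp_for (Inv : nat -> memory -> Prop) e c T n m :
  (forall i m, i < n -> Inv i m -> ev m e != 0 /\ wp c m [::] [::] T (Inv i.+1)) ->
  (forall m, Inv n m -> ev m e = 0) -> Inv 0 m ->
  wp (While e c) m [::] [::] (n * T.+1).+1 (Inv n).
Proof.
move=> hstep hend I0.
have := @wp_fold unit (fun st _ => st) (fun i _ => Inv i) e c [::] T n.
move=> /(_ _ _ (nseq n [::]) 0 tt m).
rewrite size_nseq (_ : flatten (nseq n [::]) = [::] :> seq nat); last by elim: (n).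
apply=> //; last by rewrite all_nseq orbT.
by move=> i _ m1 l lt; case: l => // _ /(hstep i m1 lt).
Qed.

Local Notation B := (2 ^ w).

(** Evaluation in unbounded arithmetic. Under the overflow conditions collected by [fits], it
    replaces the modular evaluation in all specifications. *)
Fixpoint nev (m : memory) (e : expr) : nat :=
  match e with
  | Const n => n
  | Read a i => m a (nev m i)
  | Op o e1 e2 => binop_fun o (nev m e1) (nev m e2)
  end.

Fixpoint fits (m : memory) (e : expr) : Prop :=
  match e with
  | Const n => n < B
  | Read a i => fits m i
  | Op o e1 e2 => [/\ fits m e1, fits m e2 & binop_fun o (nev m e1) (nev m e2) < B]
  end.

Lemma eval_fits m e : fits m e -> ev m e = nev m e.
Proof.
elim: e => [n|a i IH|o e1 IH1 e2 IH2] /=; first exact: modn_small.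
  by move=> /IH ->.
by case=> /IH1 -> /IH2 -> h; exact: modn_small.
Qed.

Lemma wp_seq c1 c2 m bs l T1 T2 (Q1 Q : memory -> Prop) :
  wp c1 m [::] [::] T1 Q1 -> (forall m1, Q1 m1 -> wp c2 m1 bs l T2 Q) ->
  wp (Then c1 c2) m bs l (T1 + T2).+1 Q.
Proof. by move=> h1 h2; apply: (@wp_then _ _ _ [::] _ [::]); apply: wp_weaken h1. Qed.

Lemma wp_seq' c1 c2 m bs l T1 T2 (Q1 Q : memory -> Prop) :
  wp c1 m bs l T1 Q1 -> (forall m1, Q1 m1 -> wp c2 m1 [::] [::] T2 Q) ->
  wp (Then c1 c2) m bs l (T1 + T2).+1 Q.
Proof.
move=> h1 h2; rewrite -[bs]cats0 -[l]cats0; apply: wp_then.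
by apply: wp_weaken h1.
Qed.

Lemma wp_store a i e m T (Q : memory -> Prop) j x : 0 < T -> fits m i -> fits m e ->
  nev m i = j -> nev m e = x -> Q (write m a j x) -> wp (Store a i e) m [::] [::] T Q.
Proof.
move=> T0 fi fe <- <- Qm; exists 1, (write m a (nev m i) (nev m e)).
by rewrite /= !eval_fits.
Qed.

Lemma wp_query a i v j m T (Q : memory -> Prop) i0 x : 0 < T ->
  fits m i -> fits m v -> fits m j -> nev m i = i0 ->
  answer nb (nev m v) (nev m j) = x -> Q (write m a i0 x) -> wp (Query a i v j) m [::] [::] T Q.
Proof.
move=> T0 fi fv fj <- <- Qm; exists 1, (write m a (nev m i) (answer nb (nev m v) (nev m j))).
by rewrite /= !eval_fits.
Qed.

Lemma wp_store_then a i e c m bs l T (Q : memory -> Prop) j x : fits m i -> fits m e ->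
  nev m i = j -> nev m e = x -> wp c (write m a j x) bs l T Q ->
  wp (Then (Store a i e) c) m bs l T.+2 Q.
Proof.
move=> fi fe ei ee h; apply: (@wp_seq _ _ _ _ _ 1 T (fun m1 => m1 = write m a j x)).
  exact: (wp_store _ fi fe ei ee erefl).
by move=> m1 ->.
Qed.

Lemma wp_query_then a i v j c m bs l T (Q : memory -> Prop) i0 x :
  fits m i -> fits m v -> fits m j -> nev m i = i0 ->
  answer nb (nev m v) (nev m j) = x -> wp c (write m a i0 x) bs l T Q ->
  wp (Then (Query a i v j) c) m bs l T.+2 Q.
Proof.
move=> fi fv fj ei ee h; apply: (@wp_seq _ _ _ _ _ 1 T (fun m1 => m1 = write m a i0 x)).
  exact: (wp_query _ fi fv fj ei ee erefl).
by move=> m1 ->.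
Qed.

Lemma wp_if e c1 c2 m bs l T Q (b : bool) : fits m e -> (nev m e != 0) = b ->
  wp (if b then c1 else c2) m bs l T Q -> wp (Cond e c1 c2) m bs l T.+1 Q.
Proof. by move=> fe <-; rewrite -eval_fits //; exact: wp_cond. Qed.

End Execution.

Lemma count_onth (T : eqType) (s : seq T) y n : size s <= n ->
  count (fun i => onth s i == Some y) (iota 0 n) = count_mem y s.
Proof.
elim: s n => [|x s IH] [|n] //= sn.
  rewrite add0n; apply/eqP; rewrite -leqn0 leqNgt -has_count; apply/hasPn => i _.
  by case: i.
by rewrite -(addn0 1) iotaDl count_map -(IH n).
Qed.

Lemma onth_mem (T : eqType) (s : seq T) i y : onth s i = Some y -> y \in s.
Proof.
elim: s i => [|x s IH] [|i] //=; first by case=> ->; rewrite mem_head.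
by move=> /IH ys; rewrite inE ys orbT.
Qed.

(** * Exploration by random walks *)

Section Simulation.
Variables (N d : nat) (nb : 'I_N -> seq 'I_N) (g R : rel 'I_N).
Local Notation V := 'I_N.
Hypothesis nb_uniq : forall v, uniq (nb v).
Hypothesis nb_mem : forall v u, (u \in nb v) = g v u.
Hypothesis nb_size : forall v, size (nb v) <= d.
Hypothesis R_g : subrel R g.
Hypothesis R_sym : symmetric R.
Hypothesis R_irr : irreflexive R.

Definition nbr v x : option V := if x is x'.+1 then onth (nb v) x' else None.

(** A neighbor is listed once, so each [R]-neighbor has exactly one label and the walk is
    reversible. The label [d.+1] names no neighbor and makes it lazy. *)
Definition psi v x : V :=
  if nbr v x is Some u then (if R v u then u else v) else v.

Lemma count_psi x y : x != y ->
  count (fun c => psi x c == y) (outcomes d.+1) = R x y.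
Proof.
move=> xy; have -> : outcomes d.+1 = [seq i.+1 | i <- iota 0 d.+1].
  by rewrite /outcomes -(addn0 1) iotaDl.
rewrite count_map.
transitivity (count (fun i => (onth (nb x) i == Some y) && R x y) (iota 0 d.+1)).
  apply: eq_count => i; rewrite /= /psi /=.
  case E: (onth (nb x) i) => [u|] /=; last by rewrite (negPf xy).
  rewrite -[Some u == Some y]/(u == y); case: (boolP (R x u)) => [Rxu|nR].
    by case: eqVneq => [<-|].
  by rewrite (negPf xy); case: eqVneq => //= <-; rewrite (negPf nR).
case: (boolP (R x y)) => Rxy; last first.
  by rewrite (eq_count (a2 := pred0)) ?count_pred0 // => i; rewrite andbF.
rewrite (eq_count (a2 := fun i => onth (nb x) i == Some y)); last by move=> i; rewrite andbT.
rewrite count_onth; last exact: leqW.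
by rewrite count_uniq_mem // nb_mem R_g.
Qed.

Lemma psi_sym x y : count (fun c => psi x c == y) (outcomes d.+1) =
  count (fun c => psi y c == x) (outcomes d.+1).
Proof.
have [->|xy] := eqVneq x y; first by [].
by rewrite !count_psi 1?R_sym // eq_sym.
Qed.

Lemma psi_lazy x : has (fun c => psi x c == x) (outcomes d.+1).
Proof.
apply/hasP; exists d.+1; first by rewrite mem_iota ltnS leqnn.
by rewrite /psi /= onth_default // nb_size.
Qed.

Lemma adjacent_psi x y : adjacent d.+1 psi x y = R x y.
Proof.
rewrite /adjacent has_count; have [->|xy] := eqVneq x y; first by rewrite R_irr.
by rewrite count_psi //= lt0b.
Qed.

Lemma psi_deg x : #|[set y | adjacent d.+1 psi x y]| <= d.
Proof.
apply: leq_trans (nb_size x); rewrite -(card_uniqP (nb_uniq x)).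
by apply: subset_leq_card; apply/subsetP => y; rewrite inE adjacent_psi nb_mem => /R_g.
Qed.

(** The search tree shared by all walks from one vertex. [stop] is the far end of the first non-tree
    edge met, whose near end is [cur]. *)
Record sim := Sim {
  vis : seq V; par : V -> V; dep : V -> nat; cur : V; stop : option V }.

Definition upd (T : Type) (f : V -> T) v x : V -> T := fun u => if u == v then x else f u.

Definition sim0 s := Sim [:: s] (fun=> s) (fun=> 0) s None.

Definition restart s st :=
  if stop st is None then Sim (vis st) (par st) (dep st) s None else st.

Definition pstep st (l : seq nat) :=
  if stop st is Some _ then st else
  if nbr (cur st) (head 0 l) is Some u then
    if R (cur st) u then
      if u \notin vis st then
        Sim (rcons (vis st) u) (upd (par st) u (cur st))
            (upd (dep st) u (dep st (cur st)).+1) u None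
      else if (par st u == cur st) || (par st (cur st) == u) then
        Sim (vis st) (par st) (dep st) u None
      else Sim (vis st) (par st) (dep st) (cur st) (Some u)
    else st
  else st.

Definition psteps st l := foldl pstep st [seq [:: x] | x <- l].
Definition pwalk s st l := psteps (restart s st) l.

Definition tree s st :=
  [/\ s \in vis st, uniq (vis st), par st s = s /\ dep st s = 0, cur st \in vis st &
      {in vis st, forall v, v != s ->
         [/\ par st v \in vis st, R v (par st v) & dep st v = (dep st (par st v)).+1]}] /\
  (forall u, stop st = Some u ->
     [/\ u \in vis st, R (cur st) u, par st u != cur st & par st (cur st) != u]).

Lemma tree0 s : tree s (sim0 s).
Proof.
by split=> //; split=> //=; rewrite ?mem_head // => v; rewrite inE => /eqP ->; rewrite eqxx.
Qed.

Lemma tree_restart s st : tree s st -> tree s (restart s st).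
Proof. by rewrite /restart; case E: (stop st) => [//|] [[? ? ? ? ?] ?]; split. Qed.

Lemma tree_pstep s st l : tree s st -> tree s (pstep st l).
Proof.
move=> ht; have := ht; rewrite /pstep; case E: (stop st) => [//|].
case: nbr => // u [[sv uv [ps ds] cv h] _]; case: ifP => // Ru.
case: ifP => [uN|/negbFE uV].
  have su : (s == u) = false by apply: contraNF uN => /eqP <-.
  split=> //; split=> /=; rewrite ?mem_rcons ?inE ?sv ?orbT ?eqxx ?rcons_uniq ?uN //.
    by rewrite /upd su.
  move=> v; rewrite mem_rcons inE /upd; case: (eqVneq v u) => [-> _|vu /= vV] vs.
    rewrite mem_rcons inE cv orbT R_sym; split=> //.
    by case: eqVneq => // e; move: uN; rewrite -e cv.
  have [pV Rp dp] := h _ vV vs; rewrite mem_rcons inE pV orbT; split=> //.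
  by case: eqVneq => // e; move: uN; rewrite -e pV.
case: ifP => [_|/negbT/norP[p1 p2]]; first by split=> //; split.
by split=> [|w [<-]]; split.
Qed.

Lemma stop_pstep st l : stop st != None -> pstep st l = st.
Proof. by rewrite /pstep; case: stop. Qed.

Lemma stop_psteps st l : stop st != None -> psteps st l = st.
Proof.
by move=> h; elim: l => //= x l IH; rewrite /psteps /= stop_pstep.
Qed.

Lemma stop_restart s st : stop st != None -> restart s st = st.
Proof. by rewrite /restart; case: stop. Qed.

Lemma stop_pwalks s st ls : stop st != None -> foldl (pwalk s) st ls = st.
Proof.
move=> h; elim: ls => //= l ls IH.
by rewrite /pwalk stop_restart // stop_psteps.
Qed.

Definition depth_le L j st :=
  (stop st = None -> dep st (cur st) <= j) /\ {in vis st, forall v, dep st v <= L}.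

(** A move along the tree increases the depth by at most one and every walk restarts at the root, so
    depths are bounded by the length of a walk, however many walks share the tree. *)
Lemma depth_pstep s L j st l : tree s st -> j < L -> depth_le L j st ->
  depth_le L j.+1 (pstep st l).
Proof.
move=> [[sv uv [ps ds] cv h] _] jL; rewrite /pstep /depth_le; case E: (stop st) => [w|].
  by rewrite E => -[].
move=> [] /(_ erefl) dj dL; have dj' : dep st (cur st) <= j.+1 by apply: ltnW.
case: nbr => [u|]; last by [].
case: ifP => // Ru; case: ifP => [uN|/negbFE uV] /=.
  split; first by rewrite /upd eqxx.
  move=> v; rewrite mem_rcons inE /upd; case: eqVneq => [_ _|_ /= /dL //].
  exact: leq_trans jL.
case: ifP => //= /orP[/eqP pu|/eqP pc]; split=> // _.
  have [us|us] := eqVneq u s; first by rewrite us ds.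
  by have [_ _ ->] := h _ uV us; rewrite pu.
have [cs|cs] := eqVneq (cur st) s; first by rewrite -pc cs ps ds.
by have [_ _ e] := h _ cv cs; rewrite -pc -ltnS -e; apply: ltnW.
Qed.

Lemma tree_psteps s st l : tree s st -> tree s (psteps st l).
Proof.
by elim: l st => //= x l IH st ht; apply: IH; apply: tree_pstep.
Qed.

Section Signs.
Variable sg : V -> V -> bool.
Hypothesis sg_sym : symmetric sg.
Hypothesis sg_irr : irreflexive sg.
Local Notation lstep := (lift psi sg).

Definition consistent s (chi : V -> bool) st :=
  {in vis st, forall v, v != s -> chi v (+) chi (par st v) = sg v (par st v)}.

(** Until the search stops, the walk moves only along tree edges, and signs on a tree always come
    from a coloring. Extended at each new vertex, this coloring gives the sign of the walk at every
    position. *)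
Lemma consistent_psteps s st l chi : tree s st -> consistent s chi st ->
  stop (psteps st l) = None -> exists chi', [/\ {in vis st, chi' =1 chi},
    consistent s chi' (psteps st l), {subset vis st <= vis (psteps st l)} &
    forall i, let p := foldl lstep (cur st, chi (cur st)) (take i l) in
      (p.1 \in vis (psteps st l)) && (p.2 == chi' p.1)].
Proof.
elim: l st chi => [|x l IH] st chi ht hc hs.
  by exists chi; split=> // i /=; rewrite eqxx; have [[_ _ _ -> _] _] := ht.
have hs1 : stop (pstep st [:: x]) = None.
  apply/eqP; apply/negPn/negP => h; move: hs; rewrite /psteps /=.
  by rewrite -/(psteps _ _) stop_psteps // => h'; rewrite h' in h.
have hs0 : stop st = None.
  apply/eqP; apply/negPn/negP => h; move: hs1; rewrite stop_pstep // => h'.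
  by rewrite h' in h.
have ht1 := @tree_pstep s st [:: x] ht.
have [[sv uv [ps ds] cv h] _] := ht.
have [chi1 [e1 c1 sub1 cur1]] : exists chi1, [/\ {in vis st, chi1 =1 chi},
    consistent s chi1 (pstep st [:: x]), {subset vis st <= vis (pstep st [:: x])} &
    lstep (cur st, chi (cur st)) x = (cur (pstep st [:: x]), chi1 (cur (pstep st [:: x])))].
  move: hs1; rewrite /lift /psi /pstep hs0 /=.
  case: nbr => [u|] /=; last by exists chi; rewrite sg_irr addbF; split.
  case: ifP => Ru /=; last by exists chi; rewrite sg_irr addbF; split.
  case: ifP => [uN|/negbFE uV] /=.
    move=> _; exists (upd chi u (chi (cur st) (+) sg (cur st) u)).
    have old v : v \in vis st -> upd chi u (chi (cur st) (+) sg (cur st) u) v = chi v.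
      by move=> vV; rewrite /upd; case: eqVneq => // e; move: uN; rewrite -e vV.
    split=> //=; last by rewrite /upd eqxx.
      have pu v : upd (par st) u (cur st) v = if v == u then cur st else par st v by [].
      move=> v; rewrite mem_rcons inE [par _]/= !pu; case: (eqVneq v u) => [-> _|vu /= vV] vs.
        by rewrite (old _ cv) {1}/upd eqxx sg_sym addbAC addbb addFb.
      have [pV _ _] := h _ vV vs; rewrite !old //; exact: hc.
    by move=> v vV; rewrite mem_rcons inE vV orbT.
  case: ifP => //= hp _; exists chi; split=> //; congr (_, _).
  case/orP: hp => /eqP hp.
    have us : u != s by apply: contraTneq Ru => us; rewrite -hp us ps R_irr.
    by have := hc _ uV us; rewrite hp sg_sym => <-; rewrite addbCA addbb addbF.
  have cs : cur st != s by apply: contraTneq Ru => cs; rewrite -hp cs ps R_irr.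
  by have := hc _ cv cs; rewrite hp => <-; rewrite addbA addbb addFb.
have [chi2 [e2 c2 sub2 pos2]] := IH _ chi1 ht1 c1 hs.
exists chi2; split=> //.
- by move=> v vV; rewrite e2 ?e1 // sub1.
- by move=> v vV; apply: sub2; exact: sub1.
case=> [|i]; last by rewrite /= cur1; exact: pos2.
have cV : cur st \in vis (pstep st [:: x]) by exact: sub1.
by rewrite /= e2 // e1 // eqxx andbT; apply: sub2.
Qed.

Lemma cens_take U ell t j x l y : cens lstep U ell t j x l = Some y ->
  exists i, y = foldl lstep x (take i l).
Proof.
elim: l t j x => [|c l IH] [|t] [|j] x //=; try (by case=> <-; exists 0).
by case: ifP => _ /IH[i ->]; exists i.+1.
Qed.

(** All walks of an unfinished search agree with one coloring, so the sign at the end is a function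
    of the end vertex. *)
Lemma no_opposite_pair s U ell t ls :
  stop (foldl (pwalk s) (sim0 s) ls) = None ->
  ~~ opposite_pair (cens lstep U ell t ell (s, false)) ls.
Proof.
move=> hs.
suff [chi hchi] : exists chi : V -> bool, forall l i, l \in ls ->
    let p := foldl lstep (s, false) (take i l) in p.2 = chi p.1.
  apply/negP => /existsP[v /andP[/hasP[l ll /eqP/cens_take[i hi]]]].
  move=> /hasP[l' ll' /eqP/cens_take[i' hi']].
  have := hchi l i ll; have := hchi l' i' ll'; rewrite -hi -hi' /= => <-.
  by [].
suff H st chi : tree s st -> consistent s chi st -> chi s = false ->
    stop (foldl (pwalk s) st ls) = None -> exists chi' : V -> bool, {in vis st, chi' =1 chi} /\
    forall l i, l \in ls -> let p := foldl lstep (s, false) (take i l) in p.2 = chi' p.1.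
  have [||//|//|chi' [_ h]] := H (sim0 s) (fun=> false); last by exists chi'.
    exact: tree0.
  by move=> v; rewrite inE => /eqP ->; rewrite eqxx.
elim: ls st chi {hs} => [|l ls IH] st chi ht hc cs hs; first by exists chi.
have hs1 : stop (pwalk s st l) = None.
  apply/eqP; apply/negPn/negP => h; move: hs; rewrite /= stop_pwalks // => h'.
  by rewrite h' in h.
have hs0 : stop st = None.
  apply/eqP; apply/negPn/negP => h; move: hs1.
  by rewrite /pwalk stop_restart // stop_psteps // => h'; rewrite h' in h.
have sv : s \in vis st by have [[]] := ht.
have er : restart s st = Sim (vis st) (par st) (dep st) s None by rewrite /restart hs0.
have [|chi1 [e1 c1 sub1 p1]] := consistent_psteps (tree_restart ht) _ hs1 (chi := chi).
  by rewrite er.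
rewrite -/(pwalk s st l) er /= in e1 c1 sub1 p1.
have [||chi2 [e2 h2]] := IH (pwalk s st l) chi1 _ c1 _ hs.
- by apply: tree_psteps; exact: tree_restart.
- by rewrite e1.
exists chi2; split.
  by move=> v vV; rewrite e2 ?e1 //; exact: sub1.
move=> l' i; rewrite inE => /orP[/eqP -> {l'}|]; last exact: h2.
by have := p1 i; rewrite cs => /andP[pV /eqP e]; rewrite /= e e2.
Qed.

End Signs.

Lemma psteps_rcons st l x : psteps st (rcons l x) = pstep (psteps st l) [:: x].
Proof. by rewrite /psteps map_rcons foldl_rcons. Qed.

Lemma psteps_path s q xs : path R s q -> uniq (s :: q) -> size xs = size q ->
  (forall i, i < size q -> nbr (nth s (s :: q) i) (nth 0 xs i) = Some (nth s q i)) ->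
  let st := psteps (sim0 s) xs in
  [/\ vis st = s :: q, cur st = last s q, stop st = None, dep st (last s q) = size q &
      par st s = s /\ dep st s = 0] /\
  (forall q' z, q = rcons q' z -> par st z = last s q').
Proof.
elim/last_ind: q xs => [|q z IH] xs; first by case: xs => // _ _ _ _; split=> // -[].
case/lastP: xs => [|xs x]; first by rewrite size_rcons.
rewrite rcons_path !size_rcons -rcons_cons rcons_uniq => /andP[pq Rz] /andP[zq uq] [sx] hx.
have {IH} := IH xs pq uq sx; rewrite psteps_rcons.
case=> [i iq|[ev ec es ed [ep ed0]] _].
  by have := hx i (ltnW iq); rewrite !nth_rcons sx iq [i < size (s :: q)](ltnW iq).
set st := psteps _ _ in ev ec es ed ep ed0 *.
have := hx (size q) (ltnSn _); rewrite !nth_rcons sx !ltnn !eqxx [_ < size (s :: q)]ltnSn.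
rewrite -last_nth => nx.
have sz : (s == z) = false by apply: contraNF zq => /eqP ->; exact: mem_head.
rewrite /pstep es ec /= nx Rz ev zq /=; split.
  by rewrite !last_rcons {1}/upd eqxx ed /upd sz.
by move=> q' z' /rcons_inj[<- <-]; rewrite /upd eqxx.
Qed.

(** Followed from [s], the cycle enters the tree as a path and its last edge is the first to close a
    cycle. As that edge ends at the root, the length can be read off the depth. *)
Lemma psteps_cycle s q xs : scycle R (s :: q) -> size xs = (size q).+1 ->
  (forall i, i <= size q -> nbr (nth s (s :: q) i) (nth 0 xs i) = Some (nth s (rcons q s) i)) ->
  let st := psteps (sim0 s) xs in
  [/\ stop st = Some s, dep st (cur st) = size q & dep st s = 0].
Proof.
move=> /and3P[s3 uq]; rewrite /= rcons_path => /andP[pq Rs] sx hx.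
case/lastP: xs sx hx => // xs x; rewrite size_rcons => -[sx] hx.
have := psteps_path pq uq sx; case=> [i iq|[ev ec es ed [ep ed0]] hp].
  have := hx i (ltnW iq); rewrite !nth_rcons sx iq; apply.
have := hx _ (leqnn _); rewrite !nth_rcons sx !ltnn !eqxx -last_nth => nx.
rewrite psteps_rcons; set st := psteps _ _ in ev ec es ed ep ed0 hp *.
rewrite /pstep es ec /= nx Rs ev mem_head /= ep.
case/lastP: q s3 uq pq Rs hx {nx ev ec es sx} ed hp => // q z s3 uq pq Rs hx ed hp.
rewrite last_rcons (hp q z) // in ed *.
have sz : (s == z) = false.
  by apply: contraTF uq => /eqP ->; rewrite /= mem_rcons mem_head.
have sl : (last s q == s) = false.
  case/lastP: q s3 uq {pq Rs hx ed hp} => // q y _; rewrite last_rcons => uq.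
  by apply: contraTF uq => /eqP ->; rewrite /= mem_rcons inE mem_rcons mem_head orbT.
by rewrite sz sl /= ed ed0.
Qed.

End Simulation.

Ltac fit := rewrite /=; do ?[split]; try lia.

(** * The algorithm *)

Section Program.
Variable k : nat.

Definition var a := Read a (Const 0).
Definition set a e := Store a (Const 0) e.
Definition skip := set 30 (Const 0).
Definition incr a := set a (Op Add (var a) (Const 1)).
Fixpoint block cs := match cs with [::] => skip | [:: c] => c | c :: cs' => Then c (block cs') end.

Fixpoint pow_expr e n := if n is n'.+1 then Op Mul e (pow_expr e n') else Const 1.

Definition in_N := Read 0 (Const 0).
Definition in_d := Read 0 (Const 1).
Definition in_num := Read 0 (Const 2).
Definition in_den := Read 0 (Const 3).

Definition key_expr u v :=
  Op Add (Op Mul (Op Lt u v) (Op Add (Op Mul u (Op Add in_N (Const 1))) v))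
         (Op Mul (Op Defs.Sub (Const 1) (Op Lt u v)) (Op Add (Op Mul v (Op Add in_N (Const 1))) u)).

(* Scalars: 6 length of a walk, 7 number of walks, 8 mode, 9 starting vertex,
   10 current vertex, 11 candidate neighbor, 12 and 13 loop counters, 14 number
   of visited vertices, 15 stop flag, 16 endpoint of the closing edge, 17 result
   of the test, 24 number of codes, 26 found flag.
   Arrays: 2 parent, 3 depth, 4 visited vertices, 5 scratch. *)
Definition hop := block [::
  Query 22 (Const 0) (var 20) (Op Add (Op Mod (var 19) in_d) (Const 1));
  set 19 (Op Div (var 19) in_d);
  Cond (Op Mul (Op Lt (Const 0) (var 22)) (Op Lt (var 21) (key_expr (var 20) (var 22))))
    (set 20 (var 22)) skip;
  Cond (Op Eq (var 20) (var 11)) (set 17 (Const 0)) skip].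

(** The digits of the code in base [d] select the successive neighbors. A hop to a missing neighbor
    or along an edge of small key is skipped, so every code denotes a walk of at most [k - 2]
    edges. *)
Definition try_code := Then (set 19 (var 18)) (Then (set 20 (var 10))
  (iter (k - 2) (Then hop) (incr 18))).

Definition test := Then (set 21 (key_expr (var 10) (var 11))) (Then (set 18 (Const 0))
  (While (Op Lt (var 18) (var 24)) try_code)).

(** Parent 0 means unvisited, since 0 is not a vertex; the root is its own parent. *)
Definition move :=
  Cond (Op Eq (Read 2 (var 11)) (Const 0))
    (block [:: Store 2 (var 11) (var 10);
               Store 3 (var 11) (Op Add (Read 3 (var 10)) (Const 1));
               Store 4 (var 14) (var 11); incr 14; set 10 (var 11)])
    (Cond (Op Add (Op Eq (Read 2 (var 11)) (var 10)) (Op Eq (Read 2 (var 10)) (var 11)))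
       (set 10 (var 11))
       (block [:: set 15 (Const 1); set 16 (var 11)])).

Definition try_move :=
  Then (set 17 (Const 1)) (Then (Cond (Op Eq (var 8) (Const 2)) test skip)
    (Cond (var 17) move skip)).

Definition advance :=
  Cond (Op Eq (var 15) (Const 0))
    (Then (Query 11 (Const 0) (var 10) (var 23))
          (Cond (Op Lt (Const 0) (var 11)) try_move skip)) skip.

(** The random choice is made even after the search has stopped, so that the sequence of bounds does
    not depend on the run. *)
Definition step := Then (Rand 23 (Const 0) (Op Add in_d (Const 1))) (Then advance (incr 13)).

Definition walk := Then (Cond (Op Eq (var 15) (Const 0)) (set 10 (var 9)) skip)
  (Then (set 13 (Const 0)) (Then (While (Op Lt (var 13) (var 6)) step) (incr 12))).

(** The deeper end climbs, and its vertex is added at the corresponding end of a segment of array 5.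
    The left pointer starts at one plus the depth of the left end, so it never reaches 0. *)
Definition climb := While (Op Defs.Sub (Const 1) (Op Eq (var 10) (var 16)))
  (Cond (Op Lt (Read 3 (var 10)) (Read 3 (var 16)))
    (block [:: set 27 (Op Defs.Sub (var 27) (Const 1)); Store 5 (var 27) (var 16);
               set 16 (Read 2 (var 16))])
    (block [:: Store 5 (var 28) (var 10); incr 28; set 10 (Read 2 (var 10))])).

Definition copy := Then (set 12 (Const 0)) (Then
  (While (Op Lt (var 12) (Op Defs.Sub (var 28) (var 27)))
     (block [:: Store 1 (Op Add (var 12) (Const 1)) (Read 5 (Op Add (var 27) (var 12)));
                incr 12]))
  (block [:: set 1 (Op Defs.Sub (var 28) (var 27)); set 26 (Const 1)])).

Definition extract := Then
  (block [:: set 27 (Op Add (Read 3 (var 16)) (Const 1)); set 28 (var 27)]) (Then climb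
  (Then (block [:: Store 5 (var 28) (var 10); incr 28])
    (Cond (Op Lt (Op Defs.Sub (var 28) (var 27)) (Const k)) skip copy))).

(** Only the cells of visited vertices are reset: clearing the whole array would take time linear in
    [N]. *)
Definition clear := Then (set 12 (Const 0)) (While (Op Lt (var 12) (var 14))
  (block [:: Store 2 (Read 4 (var 12)) (Const 0); incr 12])).

Definition start := block [:: Store 2 (var 9) (var 9); Store 3 (var 9) (Const 0);
  Store 4 (Const 0) (var 9); set 10 (var 9); set 14 (Const 1); set 15 (Const 0); set 12 (Const 0)].

Definition body := Then (Then (Rand 8 (Const 0) (Const 2)) (Rand 9 (Const 0) in_N))
  (Then start (Then (While (Op Lt (var 12) (var 7)) walk)
    (Then (Cond (var 15) extract skip) clear))).

Definition main_loop := While (Op Defs.Sub (Const 1) (var 26)) body.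

(* Also: 23 the binary length of N, 25 the scale Y, 29 half the number of walks,
   31 an integer exceeding 1 / eps. *)
Definition setup := block [::
  set 31 (Op Add (Op Div in_den in_num) (Const 1));
  set 25 (Const 1);
  While (Op Lt (var 25) (Op Add in_N (Const 1)))
    (block [:: set 25 (Op Mul (var 25) (Const 2)); incr 23]);
  set 25 (Op Mul (pow_expr in_d k) (Op Mul (var 31) (var 23)));
  set 6 (pow_expr (var 25) 55);
  While (Op Lt (Op Mul (var 29) (var 29)) (Op Mul (Const 32) in_N)) (incr 29);
  set 7 (Op Add (var 29) (var 29));
  set 24 (pow_expr in_d (k - 2))].

(** * Correctness of the tests and moves *)

Section Semantics.
Variables (w N d L MM : nat) (eps : rat) (G : sgraph N) (nb : 'I_N -> seq 'I_N).
Local Notation V := 'I_N.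
Hypothesis nb_lists : neighbor_lists G nb.
Hypothesis G_deg : max_degree_le G d.
Local Notation B := (2 ^ w).
Local Notation E := (d ^ (k - 2)).
Hypothesis k_gt3 : 3 < k.
Hypothesis d_gt0 : 0 < d.
Hypothesis N_big : 4 * (N.+2 * N.+2) < B.
Hypothesis d_big : d.+1 < B.
Hypothesis k_big : k < B.
Hypothesis E_big : E < B.
Hypothesis L_big : 2 * L + 4 < B.
Hypothesis MM_big : MM < B.

Local Notation ev m e := (Defs.eval w m e).
Local Notation wp := (wp w nb).
Local Notation W v := (nat_of_ord v).+1.

Definition frame (S : seq nat) (m m' : memory) := forall a, a \notin S -> m' a = m a.

Lemma frame_trans S m1 m2 m3 : frame S m1 m2 -> frame S m2 m3 -> frame S m1 m3.
Proof. by move=> h1 h2 a aS; rewrite h2 // h1. Qed.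

Lemma frame_sub S S' m m' : {subset S <= S'} -> frame S m m' -> frame S' m m'.
Proof. by move=> h h1 a aS; apply: h1; apply: contra aS; exact: h. Qed.

Lemma answerE u x : answer nb (W u) x = oapp (fun z : V => W z) 0 (nbr nb u x).
Proof.
case: x => //= x; case: insubP => [u' _ /val_inj ->|]; last by rewrite ltn_ord.
by elim: (nb u) x => [|z s IH] [|x] //=.
Qed.

Lemma W_lt (v : V) : W v < B.
Proof. by apply: leq_ltn_trans (ltn_ord v) _; apply: leq_ltn_trans N_big; nia. Qed.

Lemma key_exprE m e1 e2 : m 0 = input N d eps 0 -> fits w m e1 -> fits w m e2 ->
  nev m e1 <= N -> nev m e2 <= N -> fits w m (key_expr e1 e2) /\
  forall u v : V, nev m e1 = W u -> nev m e2 = W v -> nev m (key_expr e1 e2) = edge_key u v.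
Proof.
move=> m0 f1 f2 h1 h2.
have mN : m 0 0 = N by rewrite m0.
have B1 : 1 < B by apply: leq_ltn_trans N_big; nia.
have hm (x y : nat) : x <= N -> y <= N -> x * (N + 1) + y < B.
  by move=> hx hy; apply: leq_ltn_trans N_big; nia.
have lt1 (b : bool) : b < B by apply: leq_ltn_trans B1; case: b.
split.
  rewrite /key_expr /= mN; set x := nev m e1 in h1 *; set y := nev m e2 in h2 *.
  have := hm x y h1 h2; have := hm y x h2 h1 => hyx hxy.
  have hx : x * (N + 1) < B by apply: leq_ltn_trans hxy; exact: leq_addr.
  have hy : y * (N + 1) < B by apply: leq_ltn_trans hyx; exact: leq_addr.
  have hN : N + 1 < B by apply: leq_ltn_trans N_big; nia.
  have h0 : 0 < B by apply: leq_ltn_trans B1.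
  by case: (x < y); rewrite ?mul0n ?mul1n ?addn0 ?subn0 ?subnn ?mul0n; do !split.
move=> u v e1u e2v; rewrite /key_expr /= mN e1u e2v /edge_key.
case: ltngtP => h; rewrite ?mul1n ?mul0n ?subnn ?subn0 ?addn0 ?add0n ?mul1n ?mul0n ?addn0 ?addn1.
- by [].
- by [].
- by rewrite h.
Qed.

Arguments key_expr : simpl never.

Definition hopf m (u : V) x : V :=
  if nbr nb u (x %% d).+1 is Some z then (if m < edge_key u z then z else u) else u.

Fixpoint thit m (v : V) n x u : bool :=
  if n is n'.+1 then (hopf m u x == v) || thit m v n' (x %/ d) (hopf m u x) else false.

Lemma B_gt : 15 < B.
Proof. by apply: leq_ltn_trans N_big; nia. Qed.

Lemma bool_lt (b : bool) : b < B.
Proof. by apply: leq_ltn_trans B_gt; case: b. Qed.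

Lemma hop_spec m (u v : V) : m 0 = input N d eps 0 -> m 20 0 = W u -> m 11 0 = W v ->
  m 21 0 < B -> m 19 0 < B ->
  wp hop m [::] [::] 9 (fun m' => [/\ m' 19 0 = m 19 0 %/ d,
    m' 20 0 = W (hopf (m 21 0) u (m 19 0)),
    m' 17 0 = (if hopf (m 21 0) u (m 19 0) == v then 0 else m 17 0) &
    frame [:: 17; 19; 20; 22; 30] m m']).
Proof.
move=> m0 m20 m11 h21 h19; have B15 := B_gt.
have md : m 0 1 = d by rewrite m0.
have wu := W_lt u; have wv := W_lt v.
set x := m 19 0; set ka := m 21 0; set z := nbr nb u (x %% d).+1.
have hx : x %% d < d by rewrite ltn_mod.
apply: (@wp_query_then _ _ _ _ _ _ _ _ _ _ _ 7 _ 0 (oapp (fun z : V => W z) 0 z)); [fit|fit| |by []| |].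
- by rewrite /= md -/x; fit.
- by rewrite /= m20 md answerE addn1.
set m1 := write m 22 0 _.
apply: (@wp_store_then _ _ _ _ _ _ _ _ _ _ 5 _ 0 (x %/ d)); [fit| |by []| |].
- rewrite /m1 /write /= md -/x; fit; exact: leq_ltn_trans (leq_div _ _) h19.
- by rewrite /m1 /write /= md.
set m2 := write m1 19 0 _.
apply: (@wp_seq _ _ _ _ _ _ _ _ 2 2 (fun m3 => [/\ m3 19 0 = x %/ d, m3 20 0 = W (hopf ka u x),
   m3 11 0 = W v, m3 17 0 = m 17 0 & frame [:: 19; 20; 22; 30] m m3])).
  have zN : oapp (fun z : V => W z) 0 z <= N by case: (z) => [y|] //=; exact: ltn_ord.
  have uN : W u <= N by exact: ltn_ord.
  have [fk ek] := @key_exprE m2 (var 20) (var 22) m0 (ltn_trans (ltn0Sn _) B15) (ltn_trans (ltn0Sn _) B15)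
     (eq_ind_r (fun t => t <= N) uN m20) zN.
  apply: (@wp_if _ _ _ _ _ _ _ _ _ 1 _ (if z is Some y then ka < edge_key u y else false)) => //.
  - split; [split; [fit|fit|exact: bool_lt]|split; [fit|exact: fk|exact: bool_lt]|].
    by rewrite /= mulnb; exact: bool_lt.
  - rewrite [nev _ _](_ : _ = (0 < oapp (fun z : V => W z) 0 z) *
      (ka < nev m2 (key_expr (var 20) (var 22)))) //.
    case ez: z => [y|]; last by [].
    rewrite (ek u y); [|by rewrite -m20|by rewrite -[RHS]/(oapp (fun z : V => W z) 0 (Some y)) -ez].
    by rewrite /= mul1n; case: (_ < _).
  have hE : hopf ka u x = if z is Some y then (if ka < edge_key u y then y else u) else u by [].
  case ez: z => [y|].
    case: ifP => h.
      apply: (@wp_store _ _ _ _ _ _ _ _ _ 0 (W y)) => //=; [lia|lia|by rewrite /m2 /m1 /write /= ez|].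
      rewrite hE ez h; split=> // a; rewrite !inE !negb_or => /and4P[a1 a2 a3 a4].
      by rewrite /m2 /m1 /write (negPf a1) (negPf a2) (negPf a3).
    apply: (@wp_store _ _ _ _ _ _ _ _ _ 0 0) => //=; [lia|lia|].
    rewrite hE ez h; split=> // a; rewrite !inE !negb_or => /and4P[a1 a2 a3 a4].
    by rewrite /m2 /m1 /write (negPf a1) (negPf a3) (negPf a4).
  apply: (@wp_store _ _ _ _ _ _ _ _ _ 0 0) => //=; [lia|lia|].
  rewrite hE ez; split=> // a; rewrite !inE !negb_or => /and4P[a1 a2 a3 a4].
  by rewrite /m2 /m1 /write (negPf a1) (negPf a3) (negPf a4).
move=> m3 [e19 e20 e11 e17 fr].
apply: (@wp_if _ _ _ _ _ _ _ _ _ 1 _ (hopf ka u x == v)) => //.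
- by split; [fit|fit|exact: bool_lt].
- by rewrite /= e20 e11 eqSS -[RHS]val_eqE /= eqb0 negbK.
case: ifP => h.
  apply: (@wp_store _ _ _ _ _ _ _ _ _ 0 0) => //=; [lia|lia|].
  split=> // a; rewrite !inE !negb_or => /and5P[a1 a2 a3 a4 a5].
  by rewrite /write (negPf a1); apply: fr; rewrite !inE !negb_or a2 a3 a4.
apply: (@wp_store _ _ _ _ _ _ _ _ _ 0 0) => //=; [lia|lia|].
split=> // a; rewrite !inE !negb_or => /and5P[a1 a2 a3 a4 a5].
by rewrite /write (negPf a5); apply: fr; rewrite !inE !negb_or a2 a3 a4.
Qed.

Lemma hops_spec n c T (Q : memory -> Prop) m (u v : V) :
  m 0 = input N d eps 0 -> m 20 0 = W u -> m 11 0 = W v -> m 21 0 < B -> m 19 0 < B ->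
  (forall m', m' 17 0 = (if thit (m 21 0) v n (m 19 0) u then 0 else m 17 0) ->
     frame [:: 17; 19; 20; 22; 30] m m' -> wp c m' [::] [::] T Q) ->
  wp (iter n (Then hop) c) m [::] [::] (n * 10 + T) Q.
Proof.
elim: n m u => [|n IH] m u m0 m20 m11 h21 h19 hc; first by apply: hc.
apply: (wp_weaken (T := (9 + (n * 10 + T)).+1) (Q := Q)) => //.
apply: (wp_seq (hop_spec m0 m20 m11 h21 h19)) => m1 [e19 e20 e17 fr].
apply: (IH _ (hopf (m 21 0) u (m 19 0))); rewrite ?(fr 0) ?(fr 11) ?(fr 21) //.
  by rewrite e19; apply: leq_ltn_trans (leq_div _ _) h19.
move=> m' e' fr'; apply: hc; last exact: frame_trans fr fr'.
by rewrite e' e19 /= e17; case: (_ == v); case: thit.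
Qed.

Lemma nb_size (u : V) : size (nb u) <= d.
Proof.
have [un mem] := nb_lists u; rewrite -(card_uniqP un); apply: leq_trans (G_deg u).
by apply: subset_leq_card; apply/subsetP => v; rewrite inE mem.
Qed.

Local Notation reach := (wreach (@edge_key N) (adj G)).

Lemma wreachS ka n (u v : V) : reach ka n u v -> reach ka n.+1 u v.
Proof.
elim: n u => [|n IH] u /=; first by rewrite orbF => ->.
case/orP => [->//|/existsP[x /andP[h /IH h2]]]; apply/orP; right.
by apply/existsP; exists x; rewrite h.
Qed.

Lemma nbr_adj (u z : V) x : nbr nb u x = Some z -> adj G u z.
Proof. by case: x => // x /onth_mem; have [_ ->] := nb_lists u. Qed.

Lemma thit_reach ka (v : V) n x u : thit ka v n x u -> reach ka n u v.
Proof.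
elim: n x u => //= n IH x u.
have hE : hopf ka u x = if nbr nb u (x %% d).+1 is Some z then
  (if ka < edge_key u z then z else u) else u by [].
case ez: (nbr nb u (x %% d).+1) hE => [z|] ->; last first.
  by case/orP=> [->//|/IH/wreachS].
case: ifP => hk; last by case/orP=> [->//|/IH/wreachS].
have auz : above (@edge_key N) (adj G) ka u z by rewrite /above hk (nbr_adj ez).
move=> h; apply/orP; right; apply/existsP; exists z; rewrite auz /=.
by case/orP: h => [/eqP ->|/IH //]; case: (n) => [|?] /=; rewrite eqxx.
Qed.

(** The position of the next vertex in the neighbor list is the least significant digit of the code.
    The condition [u != v] matters because [thit] looks only at positions after a hop. *)
Lemma reach_thit ka (v : V) n u : u != v -> reach ka n u v ->
  exists2 x, x < d ^ n & thit ka v n x u.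
Proof.
elim: n u => [|n IH] u uv /=; first by rewrite orbF (negPf uv).
rewrite (negPf uv) /= => /existsP[z /andP[/andP[guz kz] rz]].
have zu : z \in nb u by have [_ ->] := nb_lists u.
have c_lt : index z (nb u) < d by apply: leq_trans (nb_size u); rewrite index_mem.
set c := index z (nb u) in c_lt.
have hz x' : hopf ka u (c + d * x') = z.
  rewrite /hopf addnC mulnC modnMDl modn_small // /nbr (onthE) (nth_map z) ?index_mem //.
  by rewrite nth_index // kz.
have [zv|zv] := eqVneq z v.
  exists c; last by have := hz 0; rewrite muln0 addn0 => ->; rewrite zv eqxx.
  by rewrite expnS; apply: leq_trans c_lt _; rewrite leq_pmulr // expn_gt0 d_gt0.
have [x' x'lt hx'] := IH z zv rz; exists (c + d * x').
  rewrite expnS; apply: leq_trans (_ : d * x'.+1 <= _); last by rewrite leq_pmul2l.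
  by rewrite mulnS ltn_add2r.
rewrite hz (negPf zv) /= addnC mulnC divnMDl // divn_small // addn0 //.
Qed.

Lemma thitP ka (v u : V) n : u != v ->
  has (fun x => thit ka v n x u) (iota 0 (d ^ n)) = reach ka n u v.
Proof.
move=> uv; apply/hasP/idP => [[x _]|]; first exact: thit_reach.
by move=> /(reach_thit uv)[x xlt h]; exists x; rewrite // mem_iota.
Qed.

Definition T_test := E * (k * 10 + 20) + 20.

Lemma key_lt (u v : V) : edge_key u v < B.
Proof.
apply: leq_ltn_trans N_big; rewrite /edge_key.
have h1 : minn u.+1 v.+1 <= N by rewrite geq_min ltn_ord.
have h2 : maxn u.+1 v.+1 <= N by rewrite geq_max !ltn_ord.
by move: h1 h2; move: (minn _ _) (maxn _ _) => a b; nia.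
Qed.

Lemma test_spec m (u v : V) : m 0 = input N d eps 0 -> m 10 0 = W u -> m 11 0 = W v ->
  m 24 0 = E -> m 17 0 = 1 -> u != v ->
  wp test m [::] [::] T_test (fun m' =>
    (m' 17 0 = nat_of_bool (~~ reach (edge_key u v) (k - 2) u v)) /\
    (frame [:: 17; 18; 19; 20; 21; 22; 30] m m')).
Proof.
move=> m0 m10 m11 m24 m17 uv; have B15 := B_gt.
have uN : W u <= N by exact: ltn_ord.
have vN : W v <= N by exact: ltn_ord.
have f0 a : fits w m (var a) by fit.
have [fk ek] := @key_exprE m (var 10) (var 11) m0 (f0 10) (f0 11)
  (eq_ind_r (fun t => t <= N) uN m10) (eq_ind_r (fun t => t <= N) vN m11).
set ka := edge_key u v; have kaB : ka < B := key_lt u v.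
apply: (wp_weaken (T := (E * (k * 10 + 19).+1).+1.+4)) => [|m' h|].
- by rewrite /T_test -addnS; move: (k * 10 + 19).+1 => q; lia.
- exact: h.
apply: (wp_store_then (j := 0) (x := ka)); [fit|exact: fk|by []|exact: ek|].
apply: (wp_store_then (j := 0) (x := 0)); [fit|fit|by []|by []|].
set m1 := write _ 18 0 0.
pose Inv i m' := [/\ m' 18 0 = i, m' 21 0 = ka,
  m' 17 0 = nat_of_bool (~~ has (fun x => thit ka v (k - 2) x u) (iota 0 i)) &
  frame [:: 17; 18; 19; 20; 21; 22; 30] m m'].
apply: (wp_weaken (T := (E * (k * 10 + 19).+1).+1) (Q := Inv E)) => [//|m' [_ _ -> fr]|].
  by rewrite thitP.
apply: wp_for.
- move=> i m' iE [e18 e21 e17 fr].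
  have iB : i < B by apply: leq_trans iE _; exact: ltnW.
  split.
    rewrite eval_fits; last by split; [fit|fit|exact: bool_lt].
    by rewrite /= e18 (fr 24) // m24 iE.
  apply: (wp_weaken (T := ((k - 2) * 10 + 3).+4)) => [|m2 h2|]; [by move: (k_gt3); lia|exact: h2|].
  apply: (wp_store_then (j := 0) (x := i)); [fit|fit|by []|by rewrite /= e18|].
  apply: (wp_store_then (j := 0) (x := W u)); [fit|fit|by []|by rewrite /= /write /= (fr 10)|].
  apply: (@hops_spec _ _ _ _ _ u v); rewrite /write /= ?(fr 0) ?(fr 11) ?e21 // => m2 e17' fr2.
  apply: (@wp_store _ _ _ _ _ _ _ _ _ 0 i.+1) => //; [fit|split; [fit|fit|]| |].
  + by rewrite /= fr2 //= e18 addn1; apply: leq_ltn_trans iE _.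
  + by rewrite /= fr2 //= e18 addn1.
  split=> //; first by rewrite /write /= fr2.
    rewrite -[in iota _ _](addn1 i) iotaD has_cat negb_or /write /= orbF add0n e17' e17.
    by case: (has _ _) => //=; case: thit.
  move=> a; rewrite !inE !negb_or => /and5P[a1 a2 a3 a4 /and3P[a5 a6 a7]].
  rewrite {1}/write (negPf a2) /= fr2; last by rewrite !inE !negb_or a1 a3 a4 a6 a7.
  rewrite /write (negPf a4) (negPf a3) /=; apply: fr.
  by rewrite !inE !negb_or a1 a2 a3 a4 a5 a6 a7.
- move=> m' [e18 e21 _ fr]; rewrite eval_fits; last by split; [fit|fit|exact: bool_lt].
  by rewrite /= e18 (fr 24) // m24 ltnn.
- split=> // a; rewrite !inE !negb_or => /and5P[a1 a2 a3 a4 /and3P[a5 a6 a7]].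
  by rewrite /m1 /write (negPf a2) (negPf a5).
Qed.

(* In mode 1, the walks look for cycles of length between k and 2k; in mode 2,
   any cycle will do. *)
Definition mode_rel (mode : nat) : rel V :=
  if mode == 1 then adj G else shortcut_free k G.

Definition static m :=
  [/\ m 0 = input N d eps 0, m 6 0 = L, m 7 0 = MM, m 24 0 = E & m 26 0 = 0].

(** Parents are constrained at all vertices, depths and the list of visited vertices only where
    defined. Hence resetting the parents suffices before a new search. *)
Definition rep mode s (st : sim N) m :=
  [/\ static m,
      [/\ m 8 0 = mode, m 9 0 = W s, m 10 0 = W (cur st), m 14 0 = size (vis st) &
          m 15 0 = nat_of_bool (stop st != None)] &
      [/\ forall u, stop st = Some u -> m 16 0 = W u,
          forall v, m 2 (W v) = (if v \in vis st then W (par st v) else 0),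
          {in vis st, forall v, m 3 (W v) = dep st v} &
          forall i, i < size (vis st) -> m 4 i = W (nth s (vis st) i)]].

Lemma rep_frame S mode s st m m' : frame S m m' ->
  all (fun a => a \notin S) [:: 0; 2; 3; 4; 6; 7; 8; 9; 10; 14; 15; 16; 24; 26] ->
  rep mode s st m -> rep mode s st m'.
Proof.
move=> fr /= /and5P[a0 a2 a3 a4 /and5P[a6 a7 a8 a9 /and5P[a10 a14 a15 a16 /and3P[a24 a26 _]]]].
case=> [[h0 h6 h7 h24 h26] [h8 h9 h10 h14 h15] [h16 h2 h3 h4]].
split; split; rewrite ?(fr 0) ?(fr 2) ?(fr 3) ?(fr 4) ?(fr 6) ?(fr 7) ?(fr 8) ?(fr 9)
  ?(fr 10) ?(fr 14) ?(fr 15) ?(fr 16) ?(fr 24) ?(fr 26) //.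
Qed.

Definition pmove (st : sim N) u :=
  if u \notin vis st then
    Sim (rcons (vis st) u) (upd (par st) u (cur st)) (upd (dep st) u (dep st (cur st)).+1) u None
  else if (par st u == cur st) || (par st (cur st) == u) then
    Sim (vis st) (par st) (dep st) u None
  else Sim (vis st) (par st) (dep st) (cur st) (Some u).

Lemma size_vis (vs : seq V) : uniq vs -> size vs <= N.
Proof. by move=> /card_uniqP <-; rewrite -[X in _ <= X]card_ord max_card. Qed.

Lemma W_eq (u v : V) : (W u == W v) = (u == v).
Proof. by []. Qed.

Lemma move_spec mode s R st m (u : V) : rep mode s st m -> tree R s st -> stop st = None ->
  m 11 0 = W u -> dep st (cur st) < L ->
  wp move m [::] [::] 14 (fun m' => rep mode s (pmove st u) m' /\
     frame [:: 2; 3; 4; 10; 14; 15; 16] m m').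
Proof.
case=> [[h0 h6 h7 h24 h26] [h8 h9 h10 h14 h15] [h16 h2 h3 h4]] [[sv uv _ cv _] _] hs h11 hL.
have B15 := B_gt; have sN := size_vis uv; have wu := W_lt u; have wc := W_lt (cur st).
have sB : (size (vis st)).+1 < B by apply: leq_ltn_trans N_big; nia.
have st15 : m 15 0 = 0 by rewrite h15 hs.
apply: (@wp_if _ _ _ _ _ _ _ _ _ 13 _ (u \notin vis st)).
- by split; [fit|fit|exact: bool_lt].
- by rewrite /= h11 h2; case: (u \in vis st); rewrite /= ?eqb0.
rewrite /pmove; case: ifP => uN.
  apply: (wp_weaken (T := 9)) => [//|m' h|]; first exact: h.
  apply: (wp_store_then (j := W u) (x := W (cur st))); [fit|fit|by rewrite /= h11|by rewrite /= h10|].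
  apply: (wp_store_then (j := W u) (x := (dep st (cur st)).+1)); [fit| |by []| |].
  - by fit; rewrite /write /= h10 h3 // addn1; lia.
  - by rewrite /= /write /= h10 h3 // addn1.
  apply: (wp_store_then (j := size (vis st)) (x := W u)); [fit|fit|by []|by []|].
  apply: (wp_store_then (j := 0) (x := (size (vis st)).+1)); [fit| |by []| |].
  - by fit; rewrite /write /= h14 addn1.
  - by rewrite /= /write /= h14 addn1.
  apply: (@wp_store _ _ _ _ _ _ _ _ _ 0 (W u)) => //; [fit|fit|].
  split; last first.
    move=> a; rewrite !inE !negb_or => /and5P[a1 a2 a3 a4 /and3P[a5 a6 a7]].
    by rewrite /write (negPf a1) (negPf a2) (negPf a3) (negPf a4) (negPf a5).
  split; split=> //=.
  - by rewrite size_rcons.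
  - move=> v; rewrite /write /= mem_rcons inE W_eq /upd.
    by case: eqVneq => //= _; rewrite h2.
  - move=> v; rewrite mem_rcons inE /write /= W_eq /upd.
    by case: eqVneq => //= _ vV; rewrite h3.
  - move=> i; rewrite size_rcons ltnS leq_eqVlt /write /= nth_rcons => /orP[/eqP ->|li].
      by rewrite eqxx ltnn ?eqxx.
    by rewrite (ltn_eqF li) li h4.
move/negbFE: uN => uV.
apply: (@wp_if _ _ _ _ _ _ _ _ _ 12 _ ((par st u == cur st) || (par st (cur st) == u))).
- split; [by split; [fit|fit|exact: bool_lt]|by split; [fit|fit|exact: bool_lt]|].
  by rewrite /=; case: (_ == _); case: (_ == _); lia.
- rewrite /= h11 h10 !h2 uV cv !W_eq.
  by case: (_ == cur st); case: (_ == u).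
case: ifP => hp.
  apply: (@wp_store _ _ _ _ _ _ _ _ _ 0 (W u)) => //; [fit|fit|].
  split; last first.
    move=> a; rewrite !inE !negb_or => /and5P[a1 a2 a3 a4 /and3P[a5 a6 a7]].
    by rewrite /write (negPf a4).
  by split; split=> //=; rewrite /write /=.
apply: (wp_weaken (T := 3)) => [//|m' h|]; first exact: h.
apply: (wp_store_then (j := 0) (x := 1)); [fit|fit|by []|by []|].
apply: (@wp_store _ _ _ _ _ _ _ _ _ 0 (W u)) => //; [fit|fit|].
split; last first.
  move=> a; rewrite !inE !negb_or => /and5P[a1 a2 a3 a4 /and3P[a5 a6 a7]].
  by rewrite /write (negPf a6) (negPf a7).
by split; split=> //= w' [<-].
Qed.

Definition T_advance := T_test + 40.

Lemma mode_relP mode (u v : V) x : mode = 1 \/ mode = 2 -> nbr nb u x = Some v ->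
  mode_rel mode u v = (mode == 1) || ~~ reach (edge_key u v) (k - 2) u v.
Proof.
by move=> hm /nbr_adj guv; rewrite /mode_rel; case: hm => ->; rewrite //= /shortcut_free /hadj guv.
Qed.

Definition scratch_cells := [:: 2; 3; 4; 10; 11; 14; 15; 16; 17; 18; 19; 20; 21; 22; 30].

Lemma advance_spec mode s st m x : mode = 1 \/ mode = 2 -> rep mode s st m ->
  tree (mode_rel mode) s st -> (stop st = None -> dep st (cur st) < L) -> m 23 0 = x ->
  wp advance m [::] [::] T_advance (fun m' =>
    rep mode s (pstep nb (mode_rel mode) st [:: x]) m' /\ frame scratch_cells m m').
Proof.
move=> hmode hrep htree hL h23; have B15 := B_gt.
have [[h0 h6 h7 h24 h26] [h8 h9 h10 h14 h15] [h16 h2 h3 h4]] := hrep.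
have skipP (m1 : memory) T Q : frame scratch_cells m m1 -> 0 < T ->
    (forall m', frame scratch_cells m m' -> frame [:: 30] m1 m' -> Q m') -> wp skip m1 [::] [::] T Q.
  move=> fr T0 hQ; apply: (@wp_store _ _ _ _ _ _ _ _ _ 0 0) => //; [fit|fit|].
  apply: hQ => a; rewrite !inE ?negb_or => ha; rewrite /write.
    by rewrite (_ : (a == 30) = false) ?fr ?inE ?negb_or //; do ![case/andP: ha => _ ha]; exact: negPf.
  by rewrite (negPf ha).
apply: (wp_weaken (T := (T_test + 39).+1)) => [|m' h|]; [by rewrite -addnS|exact: h|].
apply: (@wp_if _ _ _ _ _ _ _ _ _ (T_test + 39) _ (stop st == None)).
- by split; [fit|fit|exact: bool_lt].
- by rewrite /= h15; case: (stop st).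
rewrite /pstep; case es: (stop st) => [y|] /=.
  apply: skipP => //; first by lia.
  by move=> m' fr fr30; split=> //; exact: rep_frame fr30 _ hrep.
have hL' := hL es.
apply: (wp_weaken (T := (T_test + 37).+2)) => [|m' h|]; [by rewrite -!addnS|exact: h|].
apply: (wp_query_then (i0 := 0) (x := oapp (fun z : V => W z) 0 (nbr nb (cur st) x)));
  [fit|fit|fit|by []|by rewrite /= h10 h23 answerE|].
set m1 := write m 11 0 _.
have fr1 : frame scratch_cells m m1.
  by move=> a; rewrite /m1 /write; case: eqVneq => // ->.
have rep1 : rep mode s st m1.
  apply: (@rep_frame [:: 11]) hrep => // a; rewrite inE /m1 /write => ha.
  by rewrite (negPf ha).
apply: (wp_weaken (T := (T_test + 36).+1)) => [|m' h|]; [by rewrite -!addnS|exact: h|].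
apply: (@wp_if _ _ _ _ _ _ _ _ _ (T_test + 36) _ (nbr nb (cur st) x != None)).
- by split; [fit|fit|exact: bool_lt].
- by rewrite /= /m1 /write /=; case: nbr.
case en: (nbr nb (cur st) x) => [u|] /=; last first.
  apply: skipP => //; first by lia.
  by move=> m' fr fr30; split=> //; exact: rep_frame fr30 _ rep1.
have m11 : m1 11 0 = W u by rewrite /m1 /write /= en.
have cu : cur st != u.
  by apply/eqP => e; have := nbr_adj en; rewrite -e adj_irr.
apply: (wp_weaken (T := (T_test + 34).+2)) => [|m' h|]; [by rewrite -!addnS|exact: h|].
apply: (wp_store_then (j := 0) (x := 1)); [fit|fit|by []|by []|].
set m2 := write m1 17 0 1.
have fr2 : frame scratch_cells m m2.
  by move=> a ha; rewrite -fr1 // /m2 /write; case: eqVneq ha => // ->.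
have rep2 : rep mode s st m2.
  apply: (@rep_frame [:: 17]) rep1 => // a; rewrite inE /m2 /write => ha.
  by rewrite (negPf ha).
apply: (wp_weaken (T := (T_test.+1 + 32).+1)) => [|m' h|]; [by rewrite addSn -!addnS|exact: h|].
apply: (@wp_seq _ _ _ _ _ _ _ _ T_test.+1 32 (fun m' =>
  [/\ rep mode s st m', m' 11 0 = W u, m' 17 0 = nat_of_bool (mode_rel mode (cur st) u) &
      frame scratch_cells m m'])).
  apply: (@wp_if _ _ _ _ _ _ _ _ _ T_test _ (mode == 2)).
  - by split; [fit|fit|exact: bool_lt].
  - by rewrite /= /m2 /m1 /write /= h8 eqb0 negbK.
  case: ifP => m_2.
    have tsp := @test_spec m2 (cur st) u h0 h10 m11 h24 erefl cu.
    apply: wp_weaken tsp => //.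
    move=> m' [e17 fr]; split.
    + by apply: rep_frame fr _ rep2.
    + by rewrite fr.
    + by rewrite e17 (mode_relP hmode en) (eqP m_2).
    + apply: frame_trans fr2 _; apply: frame_sub fr => a.
      by rewrite !inE => /or4P[->|->|->|/or4P[->|->|->|->]]; rewrite ?orbT.
  apply: skipP => //; [by rewrite /T_test addnS|move=> m' fr fr30; split=> //].
  - exact: rep_frame fr30 _ rep2.
  - by rewrite fr30.
  - rewrite fr30 // (mode_relP hmode en) /m2 /write /=.
    by case: hmode m_2 => ->.
move=> m3 [rep3 e11 e17 fr3].
apply: (@wp_if _ _ _ _ _ _ _ _ _ 31 _ (mode_rel mode (cur st) u)).
- by fit.
- by rewrite /= e17 eqb0 negbK.
case: ifP => hR; last first.
  apply: skipP => // m' fr fr30; split=> //.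
  exact: rep_frame fr30 _ rep3.
apply: wp_weaken (move_spec rep3 htree es e11 hL') => // m' [repm frm]; split=> //.
apply: frame_trans fr3 _; apply: frame_sub frm => a.
by rewrite !inE => /or4P[->|->|->|/or4P[->|->|->|->]]; rewrite ?orbT.
Qed.

End Semantics.
End Program.

(* In the presence of large powers in irrelevant hypotheses, [lia] may not
   terminate. *)
Ltac alia :=
  repeat match goal with H := _ |- _ => clearbody H end;
  repeat match goal with
  | H : ?P |- _ =>
      lazymatch P with
      | is_true (leq (muln 4 _).+1 _) => clear H
      | is_true (leq (expn _ _).+1 _) => clear H
      | is_true (leq _ _) => fail
      | is_true (eq_op _ _) => fail
      | @eq nat _ _ => fail
      | nat => fail
      | _ => clear H
      end
  end; lia.
Ltac fit ::= rewrite /=; do ?[split]; try alia.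

Lemma flatten_singles (T : Type) (l : seq T) : flatten [seq [:: x] | x <- l] = l.
Proof. by elim: l => //= x l ->. Qed.

Lemma all_is_tape_singles b l : is_tape (nseq (size l) b) l ->
  all (is_tape [:: b]) [seq [:: x] | x <- l].
Proof. by elim: l => //= x l IH /andP[xb /IH ->]; rewrite andbT xb. Qed.

Lemma mem_outcomes b x : 0 < x <= b -> x \in outcomes b.
Proof. by case: b => [|b]; [case: x|rewrite mem_iota add1n ltnS]. Qed.

(** * Correctness of one search *)

Section Search.
Variables (k w N d L MM : nat) (eps : rat) (G : sgraph N) (nb : 'I_N -> seq 'I_N).
Local Notation V := 'I_N.
Hypothesis nb_lists : neighbor_lists G nb.
Hypothesis G_deg : max_degree_le G d.
Local Notation B := (2 ^ w).
Local Notation E := (d ^ (k - 2)).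
Hypothesis k_gt3 : 3 < k.
Hypothesis d_gt0 : 0 < d.
Hypothesis N_big : 4 * (N.+2 * N.+2) < B.
Hypothesis d_big : d.+1 < B.
Hypothesis k_big : k < B.
Hypothesis E_big : E < B.
Hypothesis L_big : 2 * L + 4 < B.
Hypothesis MM_big : MM < B.

Local Notation ev m e := (Defs.eval w m e).
Local Notation wp := (wp w nb).
Local Notation W v := (nat_of_ord v).+1.
Local Notation mode_rel := (mode_rel k G).
Local Notation rep := (rep k d L MM eps).
Local Notation static := (static k N d L MM eps).
Local Notation T_test := (T_test k d).
Local Notation T_advance := (T_advance k d).
Let B15 : 15 < B := B_gt k_gt3 d_gt0 N_big d_big k_big E_big L_big MM_big.
Let Wlt := W_lt k_gt3 d_gt0 N_big d_big k_big E_big L_big MM_big.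
Let boollt := bool_lt k_gt3 d_gt0 N_big d_big k_big E_big L_big MM_big.

Lemma rep_write a i x mode (s : V) st m :
  a \notin [:: 0; 2; 3; 4; 6; 7; 8; 9; 10; 14; 15; 16; 24; 26] ->
  rep mode s st m -> rep mode s st (write m a i x).
Proof.
move=> ha; apply: (@rep_frame _ _ _ _ _ _ [:: a]).
  by move=> b; rewrite inE /write => /negPf ->.
by apply/allP => b hb; rewrite inE; apply: contraNneq ha => <-.
Qed.

Lemma mode_sub mode : subrel (mode_rel mode) (adj G).
Proof.
by move=> u v; rewrite /mode_rel; case: ifP => // _ /andP[].
Qed.

Lemma mode_sym mode : symmetric (mode_rel mode).
Proof.
rewrite /mode_rel; case: ifP => _; first exact: adj_sym.
move=> u v; apply: hadj_sym; [exact: edge_key_sym|exact: adj_sym].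
Qed.

Lemma mode_irr mode : irreflexive (mode_rel mode).
Proof.
move=> v; apply/negP => /mode_sub; by rewrite adj_irr.
Qed.

Lemma step_spec mode s st m x i j : mode = 1 \/ mode = 2 -> rep mode s st m ->
  tree (mode_rel mode) s st -> depth_le L j st -> j < L -> m 13 0 = j -> m 12 0 = i ->
  x \in outcomes d.+1 ->
  wp (step k) m [:: d.+1] [:: x] (T_advance + 6) (fun m' =>
    [/\ rep mode s (pstep nb (mode_rel mode) st [:: x]) m', m' 13 0 = j.+1 & m' 12 0 = i]).
Proof.
move=> hmode hrep ht [hj _] jL m13 m12 hx.
have [[h0 h6 h7 h24 h26] [h8 h9 h10 h14 h15] _] := hrep.
have eb : ev m (Op Add in_d (Const 1)) = d.+1.
  by rewrite eval_fits /= ?h0 /= ?addn1 //; split; rewrite ?h0 /= ?addn1 //; alia.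
apply: (wp_weaken (T := (1 + (T_advance + 2).+1).+1)) => [|m' h|]; [by alia|exact: h|].
apply: (@wp_then _ _ _ _ _ _ [:: d.+1] [::] [:: x] [::]).
rewrite -eb; apply: wp_rand => //; first by rewrite eb.
set m1 := write m 23 _ x.
have rep1 : rep mode s st m1.
  exact: rep_write hrep.
apply: (@wp_seq _ _ _ _ _ _ _ _ T_advance 2).
  apply: (advance_spec nb_lists G_deg k_gt3 d_gt0 N_big d_big k_big E_big L_big MM_big
    (x := x) hmode rep1 ht) => //.
  - by move=> hs; apply: leq_ltn_trans (hj hs) _.
  - by rewrite /m1 (_ : ev m (Const 0) = 0) //; exact: mod0n.
move=> m2 [rep2 fr2].
apply: (@wp_store _ _ _ _ _ _ _ _ _ 0 j.+1) => //; [fit| |by rewrite /= fr2 // -[m1 _]/(m 13) m13 addn1|].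
  by fit; rewrite fr2 // -[m1 _]/(m 13) m13 addn1; alia.
split=> //; last by rewrite /write /= fr2.
Qed.

Definition T_walk := L * (T_advance + 7) + 20.

Lemma walk_spec mode s st m l i : mode = 1 \/ mode = 2 -> rep mode s st m ->
  tree (mode_rel mode) s st -> {in vis st, forall v, dep st v <= L} ->
  i < MM -> m 12 0 = i -> is_tape (nseq L d.+1) l ->
  wp (walk k) m (nseq L d.+1) l T_walk (fun m' =>
    [/\ rep mode s (pwalk nb (mode_rel mode) s st l) m', m' 12 0 = i.+1,
        tree (mode_rel mode) s (pwalk nb (mode_rel mode) s st l) &
        {in vis (pwalk nb (mode_rel mode) s st l), forall v,
          dep (pwalk nb (mode_rel mode) s st l) v <= L}]).
Proof.
move=> hmode hrep ht hd iM m12 hl.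
have sl : size l = L by rewrite (is_tape_size hl) size_nseq.
have ht1 := tree_restart ht; have hm := mode_sym mode; have hi := mode_irr mode.
have hd1 : depth_le L 0 (restart s st).
  have [[_ _ [_ ds] _ _] _] := ht.
  by rewrite /restart /depth_le; case es: (stop st) => [v|] /=; rewrite ?es ?ds.
apply: (wp_weaken (T := (3 + (2 + ((L * (T_advance + 6).+1).+1 + 3).+1).+1).+1)) => [|m' h|].
- rewrite /T_walk (_ : T_advance + 7 = (T_advance + 6).+1); last by rewrite addnS.
  by move: (T_advance + 6).+1 => q; clear; lia.
- exact: h.
have [[h0 h6 h7 h24 h26] [h8 h9 h10 h14 h15] [h16 h2 h3 h4]] := hrep.
apply: (@wp_seq _ _ _ _ _ _ _ _ 3 _ (fun m1 => rep mode s (restart s st) m1 /\ m1 12 0 = i)).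
  apply: (@wp_if _ _ _ _ _ _ _ _ _ 2 _ (stop st == None)).
  - by split; [fit|fit|exact: boollt].
  - by rewrite /= h15; case: (stop st).
  rewrite /restart; case es: (stop st) => [v|] /=.
    apply: (@wp_store _ _ _ _ _ _ _ _ _ 0 0) => //; try by fit.
  apply: (@wp_store _ _ _ _ _ _ _ _ _ 0 (W s)) => //; [fit|fit|].
  split; last by rewrite /write.
  split; split=> //.
  by rewrite /write /= h15 es.
move=> m1 [rep1 m112].
apply: (@wp_seq _ _ _ _ _ _ _ _ 2 _ (fun m1 =>
    [/\ rep mode s (restart s st) m1, m1 12 0 = i & m1 13 0 = 0])).
  by apply: (@wp_store _ _ _ _ _ _ _ _ _ 0 0) => //; fit.
move=> m2 [rep2 m212 m213].
pose Inv j st' m' := [/\ rep mode s st' m', m' 13 0 = j, m' 12 0 = i,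
  tree (mode_rel mode) s st' & depth_le L j st'].
apply: (@wp_seq' _ _ _ _ _ _ _ _ _ _ (Inv L (pwalk nb (mode_rel mode) s st l))).
  have := @wp_fold w N nb _ (pstep nb (mode_rel mode)) Inv
    (Op Lt (var 13) (var 6)) (step k) [:: d.+1] (T_advance + 6) L _ _
    [seq [:: x] | x <- l] 0 (restart s st) m2.
  rewrite size_map sl flatten_singles.
  have -> : flatten (nseq L [:: d.+1]) = nseq L d.+1 by elim: (L) => //= n ->.
  apply.
  - move=> j st' m' l' jL; case: l' => [|x [|? ?]] // hx; last by move: hx; rewrite /= andbF.
    move=> [rep' m'13 m'12 ht' hd']; have [[? e6 ? ? ?] _ _] := rep'.
    split.
      rewrite eval_fits; last by split; [fit|fit|exact: boollt].
      by rewrite /= m'13 e6 jL.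
    have hx' : x \in outcomes d.+1 by case/andP: hx.
    apply: wp_weaken (step_spec hmode rep' ht' hd' jL m'13 m'12 hx') => // m'' [r1 r2 r3].
    split=> //; first exact: (tree_pstep _ hm).
    exact: (depth_pstep _ _ ht').
  - move=> st' m' [rep' m'13 _ _ _]; have [[? e6 ? ? ?] _ _] := rep'.
    rewrite eval_fits; last by split; [fit|fit|exact: boollt].
    by rewrite /= m'13 e6 ltnn.
  - by rewrite -{1}sl in hl; exact: all_is_tape_singles.
  - by [].
  - by split.
move=> m3 [rep3 m313 m312 ht3 [_ hd3]].
apply: (@wp_store _ _ _ _ _ _ _ _ _ 0 i.+1) => //; [fit| |by rewrite /= m312 addn1].
  by fit; rewrite m312 addn1; alia.
Qed.

Lemma walks_spec mode s m ls : mode = 1 \/ mode = 2 -> rep mode s (sim0 s) m ->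
  m 12 0 = 0 -> all (is_tape (nseq L d.+1)) ls -> size ls = MM ->
  let st := foldl (pwalk nb (mode_rel mode) s) (sim0 s) ls in
  wp (While (Op Lt (var 12) (var 7)) (walk k)) m (flatten (nseq MM (nseq L d.+1)))
    (flatten ls) (MM * T_walk.+1).+1 (fun m' =>
    [/\ rep mode s st m', tree (mode_rel mode) s st & {in vis st, forall v, dep st v <= L}]).
Proof.
move=> hmode hrep m12 hls sls st.
pose Inv i st' m' := [/\ rep mode s st' m', m' 12 0 = i, tree (mode_rel mode) s st' &
  {in vis st', forall v, dep st' v <= L}].
apply: (wp_weaken (T := (MM * T_walk.+1).+1) (Q := Inv MM st)) => // [m' [? ? ? ?]|]; first by split.
rewrite -{1 2}sls.
apply: (@wp_fold w N nb _ (pwalk nb (mode_rel mode) s) Inv _ _ _ _ MM _ _ ls 0 (sim0 s) m) => //.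
- move=> i st' m' l iM hl [rep' m'12 ht' hd']; have [[? ? e7 ? ?] _ _] := rep'.
  split.
    rewrite eval_fits; last by split; [fit|fit|exact: boollt].
    by rewrite /= m'12 e7 iM.
  exact: walk_spec.
- move=> st' m' [rep' m'12 _ _]; have [[? ? e7 ? ?] _ _] := rep'.
  rewrite eval_fits; last by split; [fit|fit|exact: boollt].
  by rewrite /= m'12 e7 ltnn.
- by split=> //; exact: tree0.
Qed.

Lemma start_spec mode (s : V) m : static m -> m 8 0 = mode -> m 9 0 = W s ->
  (forall v : V, m 2 (W v) = 0) ->
  wp start m [::] [::] 14 (fun m' => rep mode s (sim0 s) m' /\ m' 12 0 = 0).
Proof.
move=> [h0 h6 h7 h24 h26] h8 h9 h2; have Ws := Wlt s.
apply: (wp_weaken (T := 13)) => [//|m' h|]; first exact: h.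
apply: (wp_store_then (j := W s) (x := W s)) => //; [fit|fit|].
apply: (wp_store_then (j := W s) (x := 0)) => //; [fit|fit|].
apply: (wp_store_then (j := 0) (x := W s)) => //; [fit|fit|].
apply: (wp_store_then (j := 0) (x := W s)) => //; [fit|fit|].
apply: (wp_store_then (j := 0) (x := 1)) => //; [fit|fit|].
apply: (wp_store_then (j := 0) (x := 0)) => //; [fit|fit|].
apply: (@wp_store _ _ _ _ _ _ _ _ _ 0 0) => //; [fit|fit|].
split=> //; split; split=> //=.
- by move=> v; rewrite inE /write /= W_eq; case: eqVneq.
- by move=> v; rewrite inE => /eqP ->; rewrite /write /= eqxx.
- by case.
Qed.

Section Extract.
Variables (R : rel V) (s u0 : V) (st : sim N).
Hypothesis R_sym : symmetric R.
Hypothesis R_irr : irreflexive R.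
Hypothesis st_tree : tree R s st.
Hypothesis st_stop : stop st = Some u0.
Hypothesis st_dep : {in vis st, forall v, dep st v <= L}.
Local Notation x0 := (cur st).

(* The current ascending endpoints are [y] and [x], and [p] is the part of the
   cycle between them. *)
Definition climb_inv y p x :=
  [/\ [/\ x \in vis st, y \in vis st & path R y (rcons p x)], uniq p,
      {in p, forall a, [/\ dep st x <= dep st a, dep st y <= dep st a, a != x & a != y]},
      size p + dep st x + dep st y = dep st x0 + dep st u0 /\ dep st y <= dep st u0 &
      match size p with
      | 0 => x = x0 /\ y = u0
      | 1 => (x = par st x0 /\ y = u0) \/ (x = x0 /\ y = par st u0)
      | _ => True
      end].

Lemma climb_inv0 : climb_inv u0 [::] x0.
Proof.
have [[sv uv _ xv _] /(_ _ st_stop) [uV Rxu _ _]] := st_tree.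
by split=> //; split=> //=; rewrite R_sym Rxu.
Qed.

Lemma not_root v x : v \in vis st -> dep st x < dep st v -> v != s.
Proof. by have [[_ _ [_ ds] _ _] _] := st_tree; case: eqVneq => // ->; rewrite ds. Qed.

Lemma climb_left y p x : climb_inv y p x -> dep st x < dep st y ->
  climb_inv (par st y) (y :: p) x /\ dep st y = (dep st (par st y)).+1.
Proof.
move=> [[xv yv pth] up hp [hs hu] hsz] xy; have ys := not_root yv xy.
have [[_ _ _ _ /(_ _ yv ys) [pv Ry dy]] _] := st_tree.
split=> //; split=> //.
- by split=> //=; rewrite R_sym Ry.
- rewrite /= up andbT; apply/negP => /hp[_ _ _]; by rewrite eqxx.
- move=> a; rewrite inE => /orP[/eqP ->|/hp[h1 h2 h3 h4]].
    split; [alia|alia| |]; apply: contraTneq xy => e; first by rewrite -e ltnn.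
    by move: dy; rewrite -e; alia.
  split=> //; [alia|]; apply: contraTneq h2 => ->; alia.
- by split; [rewrite -hs dy /= !addSn addnS|rewrite dy in hu; exact: ltnW].
- by case: (p) hsz => [|? []] //= [-> ->]; right.
Qed.

Lemma climb_right y p x : climb_inv y p x -> x != y -> dep st y <= dep st x ->
  climb_inv y (rcons p x) (par st x) /\ dep st x = (dep st (par st x)).+1.
Proof.
move=> [[xv yv pth] up hp [hs hu] hsz] xny yx.
have [[_ _ [_ ds] _ htree] _] := st_tree.
have xs : x != s.
  apply: contra xny => /eqP e; move: yx; rewrite e ds leqn0 => /eqP dy0.
  case: (eqVneq y s) => // ys.
  by have [_ _ h] := htree _ yv ys; rewrite h in dy0.
have [pv Rx dx] := htree _ xv xs.
split=> //; split=> //.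
- by split=> //; rewrite rcons_path pth last_rcons.
- rewrite rcons_uniq up andbT; apply/negP => /hp[_ _]; by rewrite eqxx.
- move=> a; rewrite mem_rcons inE => /orP[/eqP ->|/hp[h1 h2 h3 h4]].
    split=> //; [alia|]; apply: contraTneq (leqnn (dep st x)) => e.
    by rewrite {2}e -ltnNge dx.
  split=> //; [alia|]; apply: contraTneq h1 => ->; alia.
- by rewrite size_rcons; alia.
- by rewrite size_rcons; case: (p) hsz => [|? []] //= [-> ->]; left.
Qed.

(** The last component of [climb_inv] rules out fewer than three vertices, because the closing edge
    is not a tree edge. If that edge ends at the root, the cycle consists of the whole branch of
    [x0]. *)
Lemma climb_end p x : climb_inv x p x -> scycle R (rcons p x) /\
  size (rcons p x) <= L + L + 1 /\
  (dep st u0 = 0 -> size (rcons p x) = (dep st x0).+1).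
Proof.
move=> [[xv _ pth] up hp [hs hu] hsz].
have [[sv uv _ xv0 _] /(_ _ st_stop) [uV Rxu pu px]] := st_tree.
rewrite size_rcons; split; last first.
  have := st_dep uV; have := st_dep xv0; split; first by alia.
  by move=> e; alia.
apply/and3P; split.
- rewrite size_rcons; case: p pth up hp hs hsz => [|a [|b p]] //= _ _ _ _.
    by case=> e1 e2; rewrite -e1 -e2 R_irr in Rxu.
  by case=> -[e1 e2]; [rewrite -e1 e2 eqxx in px|rewrite -e2 e1 eqxx in pu].
- rewrite rcons_uniq up andbT; apply/negP => /hp[_ _]; by rewrite eqxx.
- by rewrite -rot1_cons rot_cycle.
Qed.

Definition cells m lo (p : seq V) := forall i, i < size p -> m 5 (lo + i) = W (nth s p i).

Definition climb_cells := [:: 5; 10; 16; 27; 28].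

Lemma climb_spec n m y p x : climb_inv y p x -> dep st x + dep st y <= n ->
  m 10 0 = W x -> m 16 0 = W y -> m 27 0 = (dep st y).+1 ->
  m 28 0 = (dep st y).+1 + size p -> cells m (dep st y).+1 p ->
  (forall v, m 2 (W v) = (if v \in vis st then W (par st v) else 0)) ->
  {in vis st, forall v, m 3 (W v) = dep st v} ->
  wp climb m [::] [::] (n * 12).+1 (fun m' => exists p' z, [/\ climb_inv z p' z,
    m' 10 0 = W z, m' 27 0 = (dep st z).+1 /\ m' 28 0 = (dep st z).+1 + size p',
    cells m' (dep st z).+1 p' & frame climb_cells m m']).
Proof.
have small y' p' x' : climb_inv y' p' x' -> dep st y' + size p' + dep st x' <= L + L.
  move=> [_ _ _ [e _] _]; have [[_ _ _ xv0 _] /(_ _ st_stop) [uV _ _ _]] := st_tree.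
  by have := st_dep uV; have := st_dep xv0; alia.
have stopped T m1 y1 p1 : 0 < T -> climb_inv y1 p1 y1 -> m1 10 0 = W y1 -> m1 16 0 = W y1 ->
    m1 27 0 = (dep st y1).+1 -> m1 28 0 = (dep st y1).+1 + size p1 ->
    cells m1 (dep st y1).+1 p1 ->
    wp climb m1 [::] [::] T (fun m' => exists p' z, [/\ climb_inv z p' z,
    m' 10 0 = W z, m' 27 0 = (dep st z).+1 /\ m' 28 0 = (dep st z).+1 + size p',
    cells m' (dep st z).+1 p' & frame climb_cells m1 m']).
  move=> T0 hI e10 e16 e27 e28 hc; apply: wp_while0 => //; last by exists p1, y1.
  rewrite eval_fits /= ?e10 ?e16 ?eqxx //.
  by fit; rewrite /= ?e10 ?e16 ?eqxx; alia.
elim: n m y p x => [|n IH] m y p x hI hn m10 m16 m27 m28 hc m2 m3.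
  have [exy|nxy] := eqVneq x y; first by rewrite exy in hI m10 *; apply: (stopped _ _ y p).
  case: (ltnP (dep st x) (dep st y)) => h.
    by have [_ e] := climb_left hI h; alia.
  by have [_ e] := climb_right hI nxy h; alia.
have [exy|nxy] := eqVneq x y; first by rewrite exy in hI m10 *; apply: (stopped _ _ y p).
have hs := small _ _ _ hI; have Wx := Wlt x; have Wy := Wlt y; have b15 := B15.
have [[xv yv _] _ _ _ _] := hI.
apply: (wp_weaken (T := (10 + (n * 12).+1).+1)) => [|m' hm'|]; [by clear; lia|exact: hm'|].
apply: (@wp_while1 _ _ _ _ _ _ [::] [::] [::] [::] 10 (n * 12).+1).
  rewrite eval_fits /= ?m10 ?m16 ?W_eq ?(negPf nxy) //.
  by fit; rewrite /= ?m10 ?m16 ?W_eq ?(negPf nxy); alia.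
apply: (@wp_if _ _ _ _ _ _ _ _ _ 9 _ (dep st x < dep st y)).
- by split; [fit|fit|exact: boollt].
- by rewrite /= m10 m16 !m3 //; case: (_ < _).
case: (ltnP (dep st x) (dep st y)) => h.
  have [hI' dy] := climb_left hI h.
  apply: (wp_weaken (T := 5)) => [//|m' hm'|]; first exact: hm'.
  apply: (wp_store_then (j := 0) (x := dep st y)) => //.
  - by fit.
  - by fit; rewrite m27; alia.
  - by rewrite /= m27 subn1.
  apply: (wp_store_then (j := dep st y) (x := W y)) => //; [fit|fit|].
  apply: (@wp_store _ _ _ _ _ _ _ _ _ 0 (W (par st y))) => //; [fit|fit| |].
    by rewrite /= /write /= m16 m2 yv.
  set m' := write _ 16 0 _.
  have fr : frame climb_cells m m'.
    move=> a; rewrite !inE !negb_or => /and5P[a1 a2 a3 a4 a5].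
    by rewrite /m' /write (negPf a1) (negPf a3) (negPf a4).
  apply: wp_weaken (IH m' (par st y) (y :: p) x hI' _ _ _ _ _ _ _ _) => //.
  - by move=> m1 [p' [z [? ? ? ? fr']]]; exists p', z; split=> //; exact: frame_trans fr fr'.
  - by alia.
  - by rewrite /m' /write /= m28 dy addnS.
  - case=> [|i] /= hi; rewrite /m' /write /= -dy ?addn0 ?eqxx //.
    by rewrite -[X in _ == X]addn0 eqn_add2l /= addnS -addSn hc.
have [hI' dx] := climb_right hI nxy h.
apply: (wp_weaken (T := 5)) => [//|m' hm'|]; first exact: hm'.
apply: (wp_store_then (j := (dep st y).+1 + size p) (x := W x)) => //; [fit|fit|].
apply: (wp_store_then (j := 0) (x := (dep st y).+1 + (size p).+1)) => //.
- by fit.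
- by fit; rewrite /write /= m28; alia.
- by rewrite /= /write /= m28 addn1 addnS.
apply: (@wp_store _ _ _ _ _ _ _ _ _ 0 (W (par st x))) => //; [fit|fit| |].
  by rewrite /= /write /= m10 m2 xv.
set m' := write _ 10 0 _.
have fr : frame climb_cells m m'.
  move=> a; rewrite !inE !negb_or => /and5P[a1 a2 a3 a4 a5].
  by rewrite /m' /write (negPf a1) (negPf a2) (negPf a5).
apply: wp_weaken (IH m' y (rcons p x) (par st x) hI' _ _ _ _ _ _ _ _) => //.
- by move=> m1 [p' [z [? ? ? ? fr']]]; exists p', z; split=> //; exact: frame_trans fr fr'.
- by alia.
- by rewrite /m' /write /= size_rcons.
- move=> i; rewrite size_rcons ltnS leq_eqVlt nth_rcons /m' /write /= => /orP[/eqP ->|li].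
    by rewrite eqxx ltnn ?eqxx.
  by rewrite eqn_add2l (ltn_eqF li) li hc.
Qed.

Lemma copy_spec m lo (c : seq V) : m 27 0 = lo -> m 28 0 = lo + size c ->
  cells m lo c -> (lo + size c).+1 < B ->
  wp copy m [::] [::] (size c * 4 + 10) (fun m' =>
    [/\ m' 26 0 = 1, outputs m' c & frame [:: 1; 12; 26] m m']).
Proof.
move=> m27 m28 hc hB; have b15 := B15.
apply: (wp_weaken (T := ((size c * 4).+1 + 3).+1.+2)) => [|m' h|]; [by alia|exact: h|].
apply: (wp_store_then (j := 0) (x := 0)) => //; [fit|fit|].
set m1 := write m _ _ _.
pose Inv i m' := [/\ m' 12 0 = i, forall j, j < i -> m' 1 j.+1 = W (nth s c j) &
  frame [:: 1; 12] m m'].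
apply: (@wp_seq _ _ _ _ _ _ _ _ _ _ (Inv (size c))).
  apply: wp_for.
  - move=> i m' ic [e12 e1 fr]; split.
      rewrite eval_fits /= ?(fr 27) ?(fr 28) // ?e12 ?m27 ?m28 ?addKn ?ic //.
      by fit; rewrite /= ?(fr 27) ?(fr 28) // ?e12 ?m27 ?m28 ?addKn; do ?[exact: boollt]; alia.
    apply: (wp_store_then (j := i.+1) (x := W (nth s c i))).
    + by fit; rewrite e12; alia.
    + by fit; rewrite fr // e12 m27; alia.
    + by rewrite /= e12 addn1.
    + by rewrite /= !(fr 27) ?(fr 5) // e12 m27 hc.
    apply: (@wp_store _ _ _ _ _ _ _ _ _ 0 i.+1) => //; [fit| |by rewrite /= /write /= e12 addn1|].
      by fit; rewrite /write /= e12; alia.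
    split=> //.
      move=> j; rewrite ltnS leq_eqVlt /write /= eqSS => /orP[/eqP ->|li]; first by rewrite eqxx.
      by rewrite (ltn_eqF li) e1.
    move=> a; rewrite !inE negb_or => /andP[a1 a2].
    by rewrite /write (negPf a1) (negPf a2); apply: fr; rewrite !inE negb_or a1.
  - move=> m' [e12 _ fr].
    rewrite eval_fits /= ?(fr 27) ?(fr 28) // ?e12 ?m27 ?m28 ?addKn ?ltnn //.
    by fit; rewrite /= ?(fr 27) ?(fr 28) // ?e12 ?m27 ?m28 ?addKn; do ?[exact: boollt]; alia.
  split=> // a; rewrite !inE negb_or => /andP[a1 a2].
  by rewrite /m1 /write (negPf a2).
move=> m2 [e12 e1 fr].
apply: (wp_store_then (j := 0) (x := size c)) => //; [fit| | |].
- by fit; rewrite !fr // m27 m28; alia.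
- by rewrite /= !fr // m27 m28 addKn.
apply: (@wp_store _ _ _ _ _ _ _ _ _ 0 1) => //; [fit|fit|].
split=> //; last first.
  move=> a; rewrite !inE !negb_or => /and3P[a1 a2 a3].
  by rewrite /write (negPf a1) (negPf a3); apply: fr; rewrite !inE negb_or a1.
rewrite /outputs /write /=; apply: (@eq_from_nth _ 0); first by rewrite size_mkseq size_map.
move=> i; rewrite size_mkseq => hi; rewrite nth_mkseq // (nth_map s) //.
by rewrite e1.
Qed.

Definition extract_cells := [:: 1; 5; 10; 12; 16; 26; 27; 28; 30].

Lemma extract_spec m : m 10 0 = W x0 -> m 16 0 = W u0 -> m 26 0 = 0 ->
  (forall v, m 2 (W v) = (if v \in vis st then W (par st v) else 0)) ->
  {in vis st, forall v, m 3 (W v) = dep st v} ->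
  wp (extract k) m [::] [::] (40 * L + 60) (fun m' => frame extract_cells m m' /\
    exists c, [/\ scycle R c, size c <= L + L + 1,
      dep st u0 = 0 -> size c = (dep st x0).+1 &
      if k <= size c then m' 26 0 = 1 /\ outputs m' c else m' 26 0 = 0]).
Proof.
move=> m10 m16 m26 m2 m3; have b15 := B15.
have [[sv uv _ xv0 _] /(_ _ st_stop) [uV Rxu pu px]] := st_tree.
have dx := st_dep xv0; have du := st_dep uV.
apply: (wp_weaken (T := (3 + (((L + L) * 12).+1 + (3 + ((L + L + 1) * 4 + 10).+1).+1).+1).+1))
  => [|m' h|]; [by clear; lia|exact: h|].
apply: (@wp_seq _ _ _ _ _ _ _ _ 3 _ (fun m1 => [/\ m1 27 0 = (dep st u0).+1,
    m1 28 0 = (dep st u0).+1 & frame [:: 27; 28] m m1])).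
  apply: (wp_store_then (j := 0) (x := (dep st u0).+1)) => //.
  - by fit.
  - by fit; rewrite m16 m3 //; alia.
  - by rewrite /= m16 m3 // addn1.
  apply: (@wp_store _ _ _ _ _ _ _ _ _ 0 (dep st u0).+1) => //; [fit|fit|].
  split=> // a; rewrite !inE !negb_or => /andP[a1 a2].
  by rewrite /write (negPf a1) (negPf a2).
move=> m1 [e27 e28 fr1].
have hcl := @climb_spec (L + L) m1 u0 [::] x0 climb_inv0.
apply: (@wp_seq _ _ _ _ _ _ _ _ _ _ _ _ (hcl _ _ _ _ _ _ _ _)) => //.
- exact: leq_add.
- by rewrite fr1.
- by rewrite fr1.
- by rewrite e28 addn0.
- by move=> v; rewrite fr1.
- by move=> v hv; rewrite fr1 // m3.
move=> m4 [p [z [hI e10 [e27' e28'] hc fr4]]].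
have [sc [szc szc0]] := climb_end hI; set c := rcons p z in sc szc szc0.
have zs : dep st z + size p <= L + L.
  by have [_ _ _ [e _] _] := hI; alia.
apply: (@wp_seq _ _ _ _ _ _ _ _ 3 _ (fun m5 => [/\ m5 27 0 = (dep st z).+1,
    m5 28 0 = (dep st z).+1 + size c, cells m5 (dep st z).+1 c & frame climb_cells m m5])).
  apply: (wp_store_then (j := (dep st z).+1 + size p) (x := W z)) => //; [fit|fit|].
  apply: (@wp_store _ _ _ _ _ _ _ _ _ 0 ((dep st z).+1 + size c)) => //; [fit| | |].
  - by fit; rewrite /write /= e28'; alia.
  - by rewrite /= /write /= e28' size_rcons addn1 addnS.
  split=> //.
    move=> i; rewrite size_rcons ltnS leq_eqVlt nth_rcons /write /= => /orP[/eqP ->|li].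
      by rewrite eqxx ltnn ?eqxx.
    by rewrite eqn_add2l (ltn_eqF li) li hc.
  have fr14 : frame climb_cells m m4.
    by apply: frame_trans fr4; apply: frame_sub fr1 => a; rewrite !inE => /orP[->|->]; rewrite !orbT.
  move=> a ha; rewrite -fr14 //; move: ha; rewrite !inE !negb_or => /and5P[a1 a2 a3 a4 a5].
  by rewrite /write (negPf a1) (negPf a5).
move=> m5 [e27'' e28'' hc5 fr5].
have hB : ((dep st z).+1 + size c).+1 < B by rewrite size_rcons; alia.
have sub a : a \notin extract_cells -> (a \notin climb_cells) && (a \notin [:: 1; 12; 26]) && (a != 30).
  rewrite !inE !negb_or => /and5P[-> -> -> -> /and5P[-> -> -> -> ->]] //.
apply: (@wp_if _ _ _ _ _ _ _ _ _ ((L + L + 1) * 4 + 10) _ (size c < k)).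
- split; [split; [fit|fit|]|fit|]; rewrite ?/= ?e28'' ?e27'' ?addKn; try alia; exact: boollt.
- by rewrite /= e28'' e27'' addKn; case: (_ < k).
case: (ltnP (size c) k) => hk.
  apply: (@wp_store _ _ _ _ _ _ _ _ _ 0 0) => //; [alia|fit|fit|].
  split.
    by move=> a /sub/andP[/andP[h1 h2] h3]; rewrite /write (negPf h3) fr5.
  by exists c; split=> //; rewrite leqNgt hk /= /write /= fr5.
apply: (wp_weaken (T := size c * 4 + 10) (Q := fun m' =>
    [/\ m' 26 0 = 1, outputs m' c & frame [:: 1; 12; 26] m5 m'])) => [|m' [o1 o2 fr6]|].
- by rewrite leq_add2r leq_mul2r szc.
- split; last by exists c; rewrite hk.
  by move=> a /sub/andP[/andP[h1 h2] h3]; rewrite fr6 // fr5.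
exact: (copy_spec e27'' e28'' hc5 hB).
Qed.

End Extract.

Lemma clear_spec s (vs : seq V) m : m 14 0 = size vs ->
  (forall i, i < size vs -> m 4 i = W (nth s vs i)) ->
  (forall v, v \notin vs -> m 2 (W v) = 0) -> size vs < B ->
  wp clear m [::] [::] (size vs * 4 + 4) (fun m' =>
    (forall v : V, m' 2 (W v) = 0) /\ frame [:: 2; 12] m m').
Proof.
move=> m14 m4 m2 hB; have b15 := B15.
apply: (wp_weaken (T := (size vs * 4).+1.+2)) => [|m' h|]; [by alia|exact: h|].
apply: (wp_store_then (j := 0) (x := 0)) => //; [fit|fit|].
pose Inv i m' := [/\ m' 12 0 = i, forall v : V, v \notin drop i vs -> m' 2 (W v) = 0 &
  frame [:: 2; 12] m m'].
apply: (wp_weaken (T := (size vs * 4).+1) (Q := Inv (size vs))) => // [m' [_ h fr]|].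
  by split=> // v; apply: h; rewrite drop_size.
apply: wp_for.
- move=> i m' ic [e12 e2 fr]; split.
    rewrite eval_fits /= ?(fr 14) // ?e12 ?m14 ?ic //.
    by split; [fit|fit|exact: boollt].
  apply: (wp_store_then (j := W (nth s vs i)) (x := 0)) => //; [fit|fit| |].
    by rewrite /= e12 fr // m4.
  apply: (@wp_store _ _ _ _ _ _ _ _ _ 0 i.+1) => //; [fit| |by rewrite /= /write /= e12 addn1|].
    by fit; rewrite /write /= e12; alia.
  split=> //.
    move=> v hv; rewrite /write /= W_eq; case: eqVneq => // nv; apply: e2.
    by rewrite (drop_nth s) // inE negb_or nv.
  move=> a; rewrite !inE negb_or => /andP[a1 a2].
  by rewrite /write (negPf a1) (negPf a2); apply: fr; rewrite !inE negb_or a1.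
- move=> m' [e12 _ fr]; rewrite eval_fits /= ?(fr 14) // ?e12 ?m14 ?ltnn //.
  by split; [fit|fit|exact: boollt].
split=> //; first by move=> v; rewrite drop0 => /m2.
by move=> a; rewrite !inE negb_or => /andP[a1 a2]; rewrite /write (negPf a2).
Qed.

Lemma size_vis_psteps R (st : sim N) l :
  size (vis (psteps nb R st l)) <= size (vis st) + size l.
Proof.
elim: l st => [|x l IH] st; first by rewrite addn0.
apply: leq_trans (IH _) _; rewrite /= addnS -addSn leq_add2r /pstep.
case: (stop st) => [?|]; first exact: leqnSn.
case: nbr => [u|]; last exact: leqnSn.
by do ![case: ifP => _ /=]; rewrite ?size_rcons ?leqnSn.
Qed.

Lemma size_vis_pwalks R s (st : sim N) n ls : all (fun l => size l == n) ls ->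
  size (vis (foldl (pwalk nb R s) st ls)) <= size (vis st) + size ls * n.
Proof.
elim: ls st => [|l ls IH] st /=; first by rewrite addn0.
case/andP=> /eqP sl /IH h; apply: leq_trans (h _) _; rewrite mulSn addnA leq_add2r.
rewrite /pwalk; apply: leq_trans (size_vis_psteps _ _ _) _; rewrite sl leq_add2r.
by rewrite /restart; case: (stop st).
Qed.

Definition clean m := static m /\ forall v : V, m 2 (W v) = 0.

Definition body_tape := [:: 2; N] ++ flatten (nseq MM (nseq L d.+1)).

Definition T_body := MM * (T_walk + 5) + MM * L * 4 + 40 * L + 200.

Definition search mode s ls := foldl (pwalk nb (mode_rel mode) s) (sim0 s) ls.

(** In mode 1 the cycle found may be short, so a search counts only if the closing edge ends at the
    root, where the depth gives the length. In mode 2 the cycle lies in H and is long. *)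
Definition good mode s ls := exists u, stop (search mode s ls) = Some u /\
  (mode = 2 \/ dep (search mode s ls) u = 0 /\
    k <= (dep (search mode s ls) (cur (search mode s ls))).+1).

Definition success m := m 26 0 = 1 /\ exists c : seq V,
  [/\ outputs m c, simple_cycle G c, k <= size c & size c <= L + L + 1].

End Search.

(** * One round of the main loop *)

Section Body.
Variables (k w N d L MM : nat) (eps : rat) (G : sgraph N) (nb : 'I_N -> seq 'I_N).
Local Notation V := 'I_N.
Hypothesis nb_lists : neighbor_lists G nb.
Hypothesis G_deg : max_degree_le G d.
Local Notation B := (2 ^ w).
Local Notation E := (d ^ (k - 2)).
Hypothesis k_gt3 : 3 < k.
Hypothesis d_gt0 : 0 < d.
Hypothesis N_big : 4 * (N.+2 * N.+2) < B.
Hypothesis d_big : d.+1 < B.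
Hypothesis k_big : k < B.
Hypothesis E_big : E < B.
Hypothesis L_big : 2 * L + 4 < B.
Hypothesis MM_big : MM < B.

Local Notation ev m e := (Defs.eval w m e).
Local Notation wp := (wp w nb).
Local Notation W v := (nat_of_ord v).+1.
Local Notation mode_rel := (mode_rel k G).
Local Notation rep := (rep k d L MM eps).
Local Notation static := (static k N d L MM eps).
Local Notation T_test := (T_test k d).
Local Notation T_advance := (T_advance k d).
Let B15 : 15 < B := B_gt k_gt3 d_gt0 N_big d_big k_big E_big L_big MM_big.
Let Wlt := W_lt k_gt3 d_gt0 N_big d_big k_big E_big L_big MM_big.
Let boollt := bool_lt k_gt3 d_gt0 N_big d_big k_big E_big L_big MM_big.

Local Notation T_walk := (T_walk k d L).
Local Notation clean := (@clean k N d L MM eps).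
Local Notation T_body := (T_body k d L MM).
Local Notation body_tape := (body_tape N d L MM).
Local Notation search := (search k G nb).
Local Notation good := (good k G nb).
Local Notation success := (success k L G).

Lemma body_spec m mode (s : V) ls : clean m -> mode = 1 \/ mode = 2 ->
  all (is_tape (nseq L d.+1)) ls -> size ls = MM ->
  wp (body k) m body_tape ([:: mode; W s] ++ flatten ls) T_body (fun m' =>
    success m' \/ clean m' /\ ~ good mode s ls).
Proof.
move=> [hst h2] hmode hls sls; have b15 := B15; have [h0 h6 h7 h24 h26] := hst.
have hm := mode_sym k G mode; have hi := mode_irr k G mode; have Ws := Wlt s.
apply: (wp_weaken (T := (3 + (14 + ((MM * T_walk.+1).+1 + ((40 * L + 60).+1 +
  ((1 + MM * L) * 4 + 4)).+1).+1).+1).+1)) => [|m' h|].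
- by rewrite /T_body; clear; nia.
- exact: h.
apply: wp_then; apply: (wp_weaken (T := (1 + 1).+1)) => [//|m' h|]; first exact: h.
have ev2 : ev m (Const 2) = 2 by rewrite eval_fits //=; lia.
have ev0 m1 : ev m1 (Const 0) = 0 by exact: mod0n.
apply: (@wp_then _ _ _ _ _ _ [:: 2] [:: N] [:: mode] [:: W s]).
rewrite -[X in [:: X]]ev2; apply: wp_rand => //.
  by rewrite ev2; case: hmode => ->.
rewrite ev0; set m1 := write m 8 0 mode.
have evN : ev m1 in_N = N by rewrite eval_fits /= /m1 /write /= ?h0 //; lia.
rewrite -[X in [:: X]]evN; apply: wp_rand => //.
  by rewrite evN mem_outcomes // ltn_ord.
rewrite ev0; set m2 := write m1 9 0 (W s).
have st2 : static m2 by [].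
rewrite -[flatten (nseq _ _)]cat0s -[flatten ls]cat0s.
apply: wp_then; apply: wp_weaken (start_spec nb k_gt3 d_gt0 N_big d_big k_big E_big L_big MM_big (mode := mode) st2 _ _ _) => // m3 [rep3 m312].
apply: (@wp_seq' _ _ _ _ _ _ _ _ _ _ _ _ (walks_spec nb_lists G_deg k_gt3 d_gt0 N_big d_big k_big E_big L_big MM_big hmode rep3 m312 hls sls)) => m4 [rep4 ht hd].
set st := foldl _ _ _ in rep4 ht hd.
have [st4 [h8 h9 h10 h14 h15] [h16 h2' h3 h4]] := rep4.
have hsz : size (vis st) <= 1 + MM * L.
  have := @size_vis_pwalks _ nb (mode_rel mode) s (sim0 s) L ls; rewrite sls; apply.
  by apply/allP => l /(allP hls)/is_tape_size ->; rewrite size_nseq.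
have uV : uniq (vis st) by have [[]] := ht.
pose Q m' := [/\ m' 14 0 = size (vis st),
  (forall i, i < size (vis st) -> m' 4 i = W (nth s (vis st) i)),
  (forall v, v \notin vis st -> m' 2 (W v) = 0),
  (forall a, a \in [:: 0; 6; 7; 24] -> m' a = m4 a) &
  success m' \/ m' 26 0 = 0 /\ ~ good mode s ls].
apply: (@wp_seq _ _ _ _ _ _ _ _ _ _ Q).
  have frQ m' : frame extract_cells m4 m' -> success m' \/ m' 26 0 = 0 /\ ~ good mode s ls -> Q m'.
    move=> fr hs; split=> //.
    - by rewrite fr.
    - by move=> i hi'; rewrite fr // h4.
    - by move=> v hv; rewrite fr // h2' (negPf hv).
    - by move=> a; rewrite !inE => ha; apply: fr; case/or4P: ha => /eqP ->.
  apply: (@wp_if _ _ _ _ _ _ _ _ _ (40 * L + 60) _ (stop st != None)).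
  - by fit.
  - by rewrite /= h15; case: (stop st).
  case es: (stop st) => [u|] /=.
    have [_ _ _ _ h426] := st4.
    apply: wp_weaken (extract_spec nb k_gt3 d_gt0 N_big d_big k_big E_big L_big MM_big hm hi ht es hd h10 (h16 _ es) h426 h2' h3) => //.
    move=> m' [fr [c [sc szc szc0 hc]]]; apply: frQ => //.
    (* A rejected cycle is shorter than [k], so the search was not [good]: in mode 2 [cycle_long]
       forbids it, in mode 1 the depth would give a length of at least [k]. *)
    case: leqP hc => kc; last first.
      move=> e26; right; split=> // -[u' []]; rewrite /search -/st es => -[<-] [m_2|[e0]].
        move: sc; rewrite m_2 => /cycle_long[_]; lia.
      by rewrite -(szc0 e0); lia.
    case=> e26 hout; left; split=> //; exists c; split=> //.
    by apply: sub_scycle sc => x y _ _; exact: mode_sub.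
  apply: (@wp_store _ _ _ _ _ _ _ _ _ 0 0) => //; [lia|fit|fit|].
  apply: frQ.
    move=> a; rewrite !inE !negb_or => /and5P[_ _ _ _ /and5P[_ _ _ _ a30]].
    by rewrite /write (negPf a30).
  right; split; first by have [_ _ _ _] := st4.
  by case=> u' []; rewrite /search -/st es.
move=> m5 [q14 q4 q2 qs qq].
apply: (wp_weaken (T := size (vis st) * 4 + 4) (Q := fun m' =>
    (forall v : V, m' 2 (W v) = 0) /\ frame [:: 2; 12] m5 m')) => [|m' [c2 fr]|].
- by rewrite leq_add2r leq_mul2r hsz.
- case: qq => [[e26 [c [o1 o2 o3 o4]]]|[e26 ng]]; [left|right].
    split; first by rewrite fr.
    by exists c; split=> //; rewrite /outputs !fr.
  split=> //; split=> //; have [s0 s6 s7 s24 s26] := st4.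
  by split; rewrite ?(fr 0) ?(fr 6) ?(fr 7) ?(fr 24) ?(fr 26) ?(qs 0) ?(qs 6) ?(qs 7) ?(qs 24).
apply: (clear_spec nb k_gt3 d_gt0 N_big d_big k_big E_big L_big MM_big (s := s)) => //.
apply: leq_ltn_trans (size_vis uV) _; apply: leq_ltn_trans N_big; clear; nia.
Qed.

End Body.

Local Open Scope ring_scope.

(** Each factor satisfies [(1 - x) * (1 + (j + 1) * x) <= 1 + j * x]. This form bounds powers from
    above by [1 / (1 + j * x)] without exponentials. *)
Lemma bernoulli (R : realFieldType) (x : R) j : 0 <= x <= 1 ->
  (1 - x) ^+ j * (1 + j%:R * x) <= 1.
Proof.
case/andP=> x0 x1; elim: j => [|j IH]; first by rewrite expr0 mul0r addr0 mulr1.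
apply: le_trans IH; rewrite exprSr -mulrA ler_wpM2l ?exprn_ge0 ?subr_ge0 // -natr1.
have : 0 <= (j%:R + 1) * x ^+ 2 :> R by rewrite mulr_ge0 ?sqr_ge0 // addr_ge0.
lra.
Qed.

(** * Running time of Las Vegas loops *)

Section Halting.
Variables (w N : nat) (nb : 'I_N -> seq 'I_N) (R : realType) (P : memory -> Prop).
Local Notation next := (Defs.next w nb).
Local Notation ev m e := (Defs.eval w m e).

Definition mean (s : config) (f : config -> R) : R :=
  (\sum_(s' <- next s) f s') / (size (next s))%:R.

Fixpoint etime n (s : config) : R :=
  if n is n'.+1 then (if s.1 is _ :: _ then 1 + mean s (fun s' => etime n' s') else 0) else 0.

Fixpoint hsum n (s : config) : R :=
  if n is n'.+1 then
    (if s.1 is _ :: _ then mean s (fun s' => hsum n' s') else (`[< P s.2 >])%:R)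
  else 0.

Lemma size_next s : (0 < size (next s))%N.
Proof. by case: s => [[|[]] *] //=; rewrite size_map size_outcomes_gt0. Qed.

Lemma le_mean s f g : (forall s', f s' <= g s') -> mean s f <= mean s g.
Proof. by move=> h; rewrite /mean ler_wpM2r ?invr_ge0 ?ler0n // ler_sum. Qed.

Lemma mean_cst s c : mean s (fun=> c) = c.
Proof.
rewrite /mean big_const_seq iter_addr_0 count_predT -[c *+ _]mulr_natr.
by rewrite mulfK // pnatr_eq0 -lt0n size_next.
Qed.

Lemma meanD s f g : mean s (fun x => f x + g x) = mean s f + mean s g.
Proof. by rewrite /mean big_split mulrDl. Qed.

Lemma meanZ s c f : mean s (fun x => c * f x) = c * mean s f.
Proof. by rewrite /mean -mulr_sumr mulrA. Qed.

Lemma mean_sum s (I : Type) (r : seq I) (F : I -> config -> R) :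
  mean s (fun x => \sum_(i <- r) F i x) = \sum_(i <- r) mean s (F i).
Proof. by rewrite /mean exchange_big /= mulr_suml. Qed.

Lemma hsumE n s : \sum_(0 <= t < n) halt_prob w nb R P t s = hsum n s.
Proof.
elim: n s => [|n IH] s; first by rewrite big_geq.
rewrite big_nat_recl //; case: s => [[|c K] m].
  by rewrite /= big1 ?addr0.
rewrite [halt_prob _ _ _ _ _ _]/= add0r.
transitivity (\sum_(0 <= t < n) mean (c :: K, m) (halt_prob w nb R P t)); first exact: eq_bigr.
rewrite -mean_sum -[RHS]/(mean (c :: K, m) (hsum n)) /mean.
by congr (_ / _); apply: eq_bigr => s' _; exact: IH.
Qed.

Lemma halt_prob_ge0 t s : 0 <= halt_prob w nb R P t s.
Proof.
elim: t s => [|t IH] [[|c K] m] //.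
rewrite -[halt_prob _ _ _ _ _ _]/(mean (c :: K, m) (halt_prob w nb R P t)).
by rewrite -(mean_cst (c :: K, m) 0) le_mean.
Qed.

Lemma hsum_ge0 n s : 0 <= hsum n s.
Proof.
elim: n s => // n IH [[|c K] m] /=; first exact: ler0n.
by rewrite -(mean_cst (c :: K, m) 0) le_mean.
Qed.

Lemma hsum_le1 n s : hsum n s <= 1.
Proof.
elim: n s => [|n IH] [[|c K] m] /=; rewrite ?ler01 ?lern1 ?leq_b1 //.
by rewrite -[leRHS](mean_cst (c :: K, m)) le_mean.
Qed.

Lemma hsum_mono n n' s : (n <= n')%N -> hsum n s <= hsum n' s.
Proof.
elim: n n' s => [|n IH] [|n'] // s; first by rewrite hsum_ge0.
by rewrite ltnS => h; case: s => [[|c K] m] //=; apply: le_mean => s'; exact: IH.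
Qed.

Lemma etime_ge0 n s : 0 <= etime n s.
Proof.
elim: n s => // n IH [[|c K] m] //=.
by rewrite addr_ge0 // -(mean_cst (c :: K, m) 0) le_mean.
Qed.

Lemma etime_mono n s : etime n s <= etime n.+1 s.
Proof.
elim: n s => [|n IH] s; first exact: (etime_ge0 1).
by case: s => [[|c K] m] //=; rewrite lerD2l; apply: le_mean => s'; exact: IH.
Qed.

(** [etime] counts also the steps of runs that have not halted yet. It therefore dominates the
    partial sums of the expected time, and it obeys a one-step recursion. *)
Lemma etime_ge n s : \sum_(0 <= t < n) t%:R * halt_prob w nb R P t s <= etime n s.
Proof.
elim: n s => [|n IH] s; first by rewrite big_geq.
rewrite big_nat_recl // mul0r add0r; case: s => [[|c K] m].
  by rewrite /= big1 // => i _; rewrite mulr0.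
rewrite -[etime _ _]/(1 + mean (c :: K, m) (etime n)).
apply: (@le_trans _ _ (mean (c :: K, m) (fun s' =>
    \sum_(0 <= t < n) t%:R * halt_prob w nb R P t s' + hsum n s'))).
  under [X in _ <= mean _ X]eq_fun => s' do rewrite -hsumE -big_split /=.
  rewrite mean_sum; apply: ler_sum => t _.
  under [X in _ <= mean _ X]eq_fun => s' do rewrite -[X in _ + X]mul1r -mulrDl natr1.
  by rewrite meanZ.
rewrite meanD addrC lerD //; last exact: le_mean.
by rewrite -[leRHS](mean_cst (c :: K, m)) le_mean // => s'; exact: hsum_le1.
Qed.

Lemma exists_tape bs : exists l, is_tape bs l.
Proof.
elim: bs => [|b bs [l hl]]; first by exists [::].
have := size_outcomes_gt0 b; case E: (outcomes b) => [//|y o] _.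
by exists (y :: l); rewrite /= E mem_head.
Qed.

(** All tapes share their bounds, so averaging over the successors of a configuration is averaging
    over the next entry of the tape. The lengths of the runs may differ; monotonicity in [n] absorbs
    this. *)
Lemma reds_expect T n bs s (F : seq nat -> config) :
  (forall l, is_tape bs l -> exists2 n', (n' <= T)%N & reds w nb n' bs l s (F l)) ->
  etime n s <= T%:R + expect bs (fun l => etime n (F l)) /\
  expect bs (fun l => hsum n (F l)) <= hsum (n + T) s.
Proof.
have now bs1 s1 F1 T1 : bs1 = [::] -> s1 = F1 [::] ->
    etime n s1 <= T1%:R + expect bs1 (fun l => etime n (F1 l)) /\
    expect bs1 (fun l => hsum n (F1 l)) <= hsum (n + T1) s1.
  by move=> -> -> /=; rewrite lerDr ler0n hsum_mono ?leq_addr.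
have ge0 T1 bs1 F1 : 0 <= T1%:R + expect bs1 (fun l => etime n (F1 l)).
  by rewrite addr_ge0 ?ler0n // expect_ge0 // => l _; exact: etime_ge0.
elim: T bs s F => [|T IH] bs s F h; have [l0 hl0] := exists_tape bs; have [[|n0] n0T r0] := h l0 hl0 => //.
- by case: r0 => e1 e2 e; subst bs l0; exact: now.
- by case: r0 => e1 e2 e; subst bs l0; exact: now.
have det s1 : next s = [:: s1] -> (if s.1 is _ :: _ then True else False) ->
    (forall n1 l, reds w nb n1.+1 bs l s (F l) -> reds w nb n1 bs l s1 (F l)) ->
    etime n s <= T.+1%:R + expect bs (fun l => etime n (F l)) /\
    expect bs (fun l => hsum n (F l)) <= hsum (n + T.+1) s.
  move=> ns s1n hr; have mean1 f : mean s f = f s1 by rewrite /mean ns big_seq1 divr1.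
  have [|IH1 IH2] := IH bs s1 F.
    move=> l hl; have [[|n1] n1T r1] := h l hl; last by exists n1 => //; exact: hr.
    by case: r1 => e1 e2 e; subst bs l; case: l0 hl0 r0 => // _ r0; exists n0 => //; exact: hr.
  case: s s1n ns {h r0 hr} mean1 => [[|c K] m] // _ _ mean1; split.
    have := ge0 T.+1 bs F; case: (n) IH1 => [//|n1] /= IH1 _.
    rewrite mean1 -[T.+1%:R]natr1 [_ + 1]addrC -addrA lerD2l; apply: le_trans IH1.
    exact: etime_mono.
  by rewrite addnS /= mean1.
case: s h r0 det => [[|c K] m] // h r0 det.
case: c h r0 det => [a i e|a i v j|a i b|c1 c2|e c1 c2|e c1] h r0 det;
  try by apply: (det _ erefl I) => n1 l.
clear det; case: bs l0 hl0 h r0 => [|b' bs] [|x0 l0] // hl0 h [eb _ _].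
set sx := fun x => (K, write m a (ev m i) x).
have {}IH x : x \in outcomes b' ->
    etime n (sx x) <= T%:R + expect bs (fun l => etime n (F (x :: l))) /\
    expect bs (fun l => hsum n (F (x :: l))) <= hsum (n + T) (sx x).
  move=> xb; apply: (IH bs (sx x) (fun l => F (x :: l))) => l hl.
  have [|[|n1] n1T r1] := h (x :: l); first by rewrite /= xb.
    by case: r1.
  by case: r1 => _ _ r1; exists n1.
have meanE f : mean (Rand a i b :: K, m) f = avg b' (fun x => f (sx x)).
  by rewrite /mean /= big_map size_map eb.
split.
  have := ge0 T.+1 (b' :: bs) F; case: (n) IH => [//|n1] /= IH _.
  rewrite meanE -[T.+1%:R]natr1 [_ + 1]addrC -addrA lerD2l -[T%:R](avg_cst b') -avgD.
  apply: le_avg => x xb; have [IH1 _] := IH x xb; apply: le_trans IH1.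
  exact: etime_mono.
rewrite addnS /= meanE; apply: le_avg => x xb.
by have [] := IH x xb.
Qed.

Section Loop.
Variables (e : expr) (c : cmd) (bs : seq nat) (T : nat) (rho : R).
Variables (Inv Succ : memory -> Prop) (Good : seq nat -> Prop).
Hypothesis e_Inv : forall m, Inv m -> ev m e != 0%N.
Hypothesis e_Succ : forall m, Succ m -> ev m e = 0%N.
Hypothesis c_spec : forall m l, Inv m -> is_tape bs l ->
  wp w nb c m bs l T (fun m' => Succ m' \/ Inv m' /\ ~ Good l).
Hypothesis rho_gt0 : 0 < rho.
Hypothesis Good_rho : rho <= expect bs (fun l => (`[< Good l >])%:R).
Hypothesis Succ_P : forall m, Succ m -> P m.

Local Notation loop m := ([:: While e c], m).

Let next_m m : Inv m -> exists M : seq nat -> memory, forall l, is_tape bs l ->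
  (Succ (M l) \/ Inv (M l) /\ ~ Good l) /\
  exists2 n', (n' <= T)%N & reds w nb n' bs l ([:: c; While e c], m) (loop (M l)).
Proof.
move=> Im.
have H l : exists m', is_tape bs l -> (Succ m' \/ Inv m' /\ ~ Good l) /\
    exists2 n', (n' <= T)%N & reds w nb n' bs l ([:: c; While e c], m) (loop m').
  have [hl|_] := boolP (is_tape bs l); last by exists m.
  by have [n1 [m' [n1T Q r]]] := c_spec Im hl; exists m' => _; split=> //; exists n1.
by have [M hM] := choice H; exists M.
Qed.

Let mean_loop m f : Inv m -> mean (loop m) f = f ([:: c; While e c], m).
Proof. by move=> Im; rewrite /mean /= e_Inv // big_seq1 divr1. Qed.

Let rho_le1 : rho <= 1.
Proof.
apply: le_trans Good_rho _; rewrite -[leRHS](expect_cst bs).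
by apply: le_expect => l _; rewrite lern1 leq_b1.
Qed.

(** The bound is a fixed point of one round: entering and leaving the loop cost one step each, the
    body [T], and with probability at least [rho] no further round follows. *)
Lemma etime_loop n m : Inv m -> etime n (loop m) <= (T.+2)%:R / rho.
Proof.
have B0 : 0 <= (T.+2)%:R / rho :> R by rewrite divr_ge0 ?ler0n // ltW.
elim: n m => [|n IH] m Im //; have [M hM] := next_m Im; set B := _ / _ in B0 IH *.
rewrite [etime _ _]/= (mean_loop (etime n)) //.
have [|h _] := @reds_expect T n bs ([:: c; While e c], m) (fun l => loop (M l)).
  by move=> l /hM[].
apply: (@le_trans _ _ (1 + (T%:R + expect bs (fun l => (1 + B) + - B * (`[< Good l >])%:R)))).
  rewrite lerD2l; apply: le_trans h _; rewrite lerD2l; apply: le_expect => l hl.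
  have [[Sl|[Il nG]] _] := hM l hl.
    apply: (@le_trans _ _ 1).
      case: (n) => [|[|n1]] //=; rewrite ?ler01 // /mean /= e_Succ // big_seq1 ?mulr0 ?divr1 ?addr0 //.
    by case: asboolP => _; rewrite ?mulr1 ?mulr0 ?addr0 ?lerDl // addrK.
  by rewrite asboolF // mulr0 addr0; apply: le_trans (IH _ Il) _; rewrite lerDr ler01.
rewrite expectD expectZ expect_cst.
have : B * rho <= B * expect bs (fun l => (`[< Good l >])%:R) by rewrite ler_wpM2l.
rewrite [B * rho]divfK ?gt_eqF // -addn2 natrD; lra.
Qed.

Lemma hsum_loop j m : Inv m -> 1 - (1 - rho) ^+ j <= hsum (j * T.+1 + 2) (loop m).
Proof.
have r0 : 0 <= 1 - rho by rewrite subr_ge0.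
elim: j m => [|j IH] m Im; first by rewrite expr0 subrr hsum_ge0.
have [M hM] := next_m Im; set n := (j * T.+1 + 2)%N in IH *.
have -> : (j.+1 * T.+1 + 2 = (n + T).+1)%N by rewrite /n; lia.
rewrite [hsum _ _]/= (mean_loop (hsum (n + T))) //.
have [|_] := @reds_expect T n bs ([:: c; While e c], m) (fun l => loop (M l)).
  by move=> l /hM[].
apply: le_trans; set z := (1 - rho) ^+ j in IH.
have z0 : 0 <= z by rewrite exprn_ge0.
apply: (@le_trans _ _ (expect bs (fun l => (1 - z) + z * (`[< Good l >])%:R))).
  rewrite expectD expectZ expect_cst exprS -/z.
  have : z * rho <= z * expect bs (fun l => (`[< Good l >])%:R) by rewrite ler_wpM2l.
  lra.
apply: le_expect => l hl; have [[Sl|[Il nG]] _] := hM l hl.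
  have -> : hsum n (loop (M l)) = 1.
    rewrite /n addn2 /= /mean /= e_Succ // big_seq1 divr1 /=.
    by rewrite asboolT //; exact: Succ_P.
  by case: asboolP => _; rewrite ?mulr1 ?mulr0 ?addr0 ?subrK // lerBlDr lerDl.
by rewrite asboolF // mulr0 addr0; exact: IH.
Qed.

Lemma loop_halts s T0 n0 m0 : (n0 <= T0)%N -> reds w nb n0 [::] [::] s (loop m0) -> Inv m0 ->
  success_prob w nb R P s = 1%E /\
  forall n, etime n s <= T0%:R + (T.+2)%:R / rho.
Proof.
move=> nT r Im.
have hr n := @reds_expect T0 n [::] s (fun=> loop m0).
have h l : is_tape [::] l -> exists2 n', (n' <= T0)%N & reds w nb n' [::] l s (loop m0).
  by case: l => // _; exists n0.
split; last first.
  move=> n; have [h1 _] := hr n h; apply: le_trans h1 _.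
  by rewrite lerD2l; exact: etime_loop.
apply/eqP; rewrite eq_le; apply/andP.
have ge0 n : (0 <= n)%N -> true -> (0 <= (halt_prob w nb R P n s)%:E)%E.
  by move=> _ _; rewrite lee_fin halt_prob_ge0.
have le1 : (success_prob w nb R P s <= 1)%E.
  apply: ereal_normedtype.lime_le; first exact: is_cvg_nneseries.
  by apply: filter.nearW => n; rewrite sumEFin hsumE lee_fin hsum_le1.
split=> //; rewrite leNgt; apply/negP => lt1.
have pos : (0 <= success_prob w nb R P s)%E by exact: nneseries_ge0.
have := @nneseries_lim_ge R (fun t => (halt_prob w nb R P t s)%:E) xpredT 0.
rewrite -/(success_prob w nb R P s).
case E: (success_prob w nb R P s) pos lt1 => [x| |] // _; rewrite lte_fin => x1 H.
have {}H j : 1 - (1 - rho) ^+ j <= x.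
  have := H (j * T.+1 + 2 + T0)%N ge0; rewrite sumEFin hsumE lee_fin; apply: le_trans.
  by have [_ h2] := hr (j * T.+1 + 2)%N h; apply: le_trans h2; exact: hsum_loop.
have y0 : 0 < (1 - x) * rho by rewrite mulr_gt0 ?subr_gt0.
(* Large enough that [(1 - rho) ^+ j.+1], at most [1 / (1 + j.+1 * rho)] by [bernoulli], falls below
   [1 - x]. *)
pose j := Num.truncn (((1 - x) * rho)^-1).
have hj : 1 < (j.+1)%:R * ((1 - x) * rho).
  rewrite -ltr_pdivrMr // div1r; exact: Num.Theory.truncnS_gt.
have r01 : 0 <= rho <= 1 by rewrite rho_le1 ltW.
have := bernoulli j.+1 r01; have := H j.+1; set z := (1 - rho) ^+ j.+1 => hz.
have hzx : 1 - x <= z by lra.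
have jr : 0 <= (j.+1)%:R * rho by rewrite mulr_ge0 ?ler0n // ltW.
have : (1 - x) * ((j.+1)%:R * rho) <= z * ((j.+1)%:R * rho) by rewrite ler_wpM2r.
have : 0 <= z by apply: le_trans hzx; lra.
by move: hj; rewrite mulrCA; lra.
Qed.

End Loop.

End Halting.

Lemma expected_time_le w N (nb : 'I_N -> seq 'I_N) (R : realType) s (b : R) :
  (forall n, etime w nb R n s <= b) -> (expected_time w nb R s <= b%:E)%E.
Proof.
move=> h; apply: ereal_normedtype.lime_le.
  apply: is_cvg_nneseries => n _ _; rewrite lee_fin mulr_ge0 ?ler0n //.
  exact: halt_prob_ge0.
apply: filter.nearW => n; rewrite sumEFin lee_fin; apply: le_trans (h n).
exact: etime_ge.
Qed.

(** The tape begins with [xs] with probability the inverse of the product, and [F] is nonnegative on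
    all other tapes. *)
Lemma expect_prefix (R : realFieldType) (bs1 bs2 xs : seq nat) (F : seq nat -> R) :
  is_tape bs1 xs -> (forall l, is_tape (bs1 ++ bs2) l -> 0 <= F l) ->
  expect bs2 (fun l => F (xs ++ l)) <=
  (\prod_(b <- bs1) size (outcomes b))%:R * expect (bs1 ++ bs2) F.
Proof.
elim: bs1 xs F => [|b bs1 IH] [|x xs] F //; first by rewrite big_nil mul1r.
case/andP=> xb hxs F0; apply: le_trans (IH xs (fun l => F (x :: l)) hxs _) _.
  by move=> l hl; apply: F0; rewrite /= xb.
rewrite big_cons natrM [_%:R * _%:R]mulrC -mulrA ler_wpM2l ?ler0n //.
rewrite mulrC -ler_pdivrMr ?ltr0n ?size_outcomes_gt0 //.
apply: (@avg_ge1 _ b (fun x => expect (bs1 ++ bs2) (fun l => F (x :: l)))) => // y yb.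
by apply: expect_ge0 => l hl; apply: F0; rewrite /= yb.
Qed.

Lemma avg_ord (R : realFieldType) N (F : nat -> R) : (0 < N)%N ->
  avg N F = (\sum_(s < N) F s.+1) / N%:R.
Proof.
move=> N0; rewrite /avg (_ : outcomes N = iota 1 N); last by case: (N) N0.
rewrite size_iota; congr (_ / _).
by rewrite -[LHS]/(\sum_(x <- iota (1 + 0) N) F x) iotaDl big_map -{1}(subn0 N) -/(index_iota 0 N) big_mkord.
Qed.

Lemma expect_start (R : realFieldType) N (S : {set 'I_N}) mode rest (p : R)
    (F : seq nat -> R) : (mode \in outcomes 2) ->
  (forall l, is_tape (2 :: N :: rest) l -> 0 <= F l) ->
  {in S, forall s, p <= expect rest (fun l => F (mode :: (nat_of_ord s).+1 :: l))} ->
  #|S|%:R * p <= (2 * N)%:R * expect (2 :: N :: rest) F.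
Proof.
move=> hm F0 hp; have [->|[s0 s0S]] := set_0Vmem S.
  by rewrite cards0 mul0r mulr_ge0 ?ler0n // expect_ge0.
have N0 : (0 < N)%N by apply: leq_ltn_trans (ltn_ord s0).
have inN (s : 'I_N) : (nat_of_ord s).+1 \in outcomes N by rewrite mem_outcomes // ltn_ord.
have := @avg_ge1 _ 2 (fun x => avg N (fun y => expect rest (fun l => F (x :: y :: l)))) mode _ hm.
rewrite [size _]/= ler_pdivrMr ?ltr0n // => /(_ _) h.
rewrite natrM -mulrA [N%:R * _]mulrC mulrA [2%:R * _]mulrC -ler_pdivrMr ?ltr0n //.
apply: le_trans (h _) => [|x xb]; last first.
  apply: avg_ge0 => y yb; apply: expect_ge0 => l hl; apply: F0.
  by rewrite [is_tape _ _]/= -/(outcomes 2) -/(outcomes N) xb yb.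
rewrite avg_ord // ler_pM2r ?invr_gt0 ?ltr0n // [leRHS](bigID (mem S)) /=.
rewrite -[leLHS]addr0 lerD //; last first.
  apply: sumr_ge0 => s _; apply: expect_ge0 => l hl; apply: F0.
  by rewrite [is_tape _ _]/= -/(outcomes 2) -/(outcomes N) hm inN.
by rewrite mulr_natl -sumr_const; apply: ler_sum => s /hp.
Qed.

Lemma is_tape_all (l : seq nat) b : all (fun x => x \in outcomes b) l -> is_tape (nseq (size l) b) l.
Proof. by elim: l => //= x l IH /andP[-> /IH]. Qed.

Lemma prod_outcomes_nseq n b : (0 < b)%N ->
  (\prod_(c <- nseq n b) size (outcomes c) = b ^ n)%N.
Proof.
case: b => // b _; elim: n => [|n IH]; first by rewrite big_nil.
by rewrite big_cons IH expnS /outcomes size_iota.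
Qed.

(** * Detection probability *)

Section Detection.
Variables (R : realFieldType) (N d k Z lg Y M : nat) (G : sgraph N) (nb : 'I_N -> seq 'I_N).
Local Notation V := 'I_N.
Hypothesis nb_lists : neighbor_lists G nb.
Hypothesis G_deg : max_degree_le G d.
Hypothesis k_gt3 : (3 < k)%N.
Hypothesis d_gt1 : (1 < d)%N.
Hypothesis N_gt0 : (0 < N)%N.
Hypothesis Y_ge : (32 <= Y)%N.
Hypothesis Z_le : (Z <= Y)%N.
Hypothesis dk_le : (d ^ k <= Y)%N.
Hypothesis lg_le : (lg + 3 <= Y)%N.
Hypothesis lg_gt0 : (0 < lg)%N.
Hypothesis N_lt : (N < 2 ^ lg)%N.
Hypothesis M_ge : (32 * N <= M ^ 2)%N.
Hypothesis M_gt0 : (0 < M)%N.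
Hypothesis G_far : forall G', no_long_cycle G' k -> (d * N < Z * edge_dist G G')%N.

Local Notation L := (Y ^ 55)%N.
Local Notation h := (shortcut_free k G).
Local Notation mid := (mid_vertices k G).
Local Notation good := (good k G nb).
Local Notation tape := (nseq L d.+1).
Local Notation W v := (nat_of_ord v).+1.

Lemma d_le : (d <= Y)%N.
Proof. by apply: leq_trans dk_le; rewrite -{1}(expn1 d) leq_pexp2l //; lia. Qed.

Lemma succ_d_le : (d.+1 ^ k <= Y ^ 2)%N.
Proof.
apply: (@leq_trans ((d ^ 2) ^ k)); first by rewrite leq_exp2r; [nia|lia].
by rewrite expnAC leq_exp2r.
Qed.

Lemma h_sym : symmetric h.
Proof. exact: (mode_sym k G 2). Qed.

Lemma h_irr : irreflexive h.
Proof. exact: (mode_irr k G 2). Qed.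

Lemma adjacent_h u v : adjacent d.+1 (psi nb h) u v = h u v.
Proof.
apply: (adjacent_psi (g := adj G)) => [w|w z|w|w z|].
- by have [] := nb_lists w.
- by have [_ ->] := nb_lists w.
- exact: (nb_size nb_lists G_deg).
- by case/andP.
- exact: h_irr.
Qed.

(** The factor 2 passes from increasing pairs to ordered pairs. *)
Lemma card_nonforest (T0 : {set V * V}) : T0 \subset arcs h ->
  (#|[set p : V * V | h p.1 p.2 && (p \notin [set p | sym_closure T0 p.1 p.2])]| <=
   2 * (#|arcs h| - #|T0|))%N.
Proof.
move=> T0h; rewrite -cardsDS //; set D := arcs h :\: T0.
have sw : injective (fun p : V * V => (p.2, p.1)) by case=> a b [a' b'] [-> ->].
have eD : #|[set (p.2, p.1) | p in D]| = #|D| := card_imset _ sw.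
rewrite mul2n -addnn -{2}eD; apply: leq_trans (leq_card_setU _ _).
apply: subset_leq_card; apply/subsetP => -[u v]; rewrite !inE /= /sym_closure negb_or.
case/and3P=> huv n1 n2; rewrite n1 huv /=; case: ltngtP => //= [vu|/val_inj uv].
  by apply/imsetP; exists (v, u) => //; rewrite !inE n2 h_sym huv vu.
by rewrite uv h_irr in huv.
Qed.

(** Bound [Z], [d] and 2 by [Y] and [P] by [Y ^ 3] in [reduction_bound]. Multiplied by [Y], its
    right-hand side becomes [m * Y ^ 4 + Y ^ 6 * f + Y ^ 8 * m], whence the exponents 8 and 6. *)
Lemma far_cases : (N <= Y ^ 8 * #|mid|)%N \/ exists T0 : {set V * V},
  [/\ T0 \subset arcs h, acyclic_rel (sym_closure T0),
    (forall e, e \in arcs h -> e \notin T0 -> ~ acyclic_rel (sym_closure (e |: T0))) &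
    (N <= Y ^ 6 * (#|arcs h| - #|T0|))%N].
Proof.
have [T0 [T0h T0a T0m]] := exists_spanning_forest h.
case: (leqP N (Y ^ 8 * #|mid|)) => [|hm]; first by left.
right; exists T0; split=> //; rewrite leqNgt; apply/negP => hf.
have Ta : acyclic_rel (fun u v => (u, v) \in [set p : V * V | sym_closure T0 p.1 p.2]).
  by rewrite (_ : (fun u v => _) = sym_closure T0) //; apply: funext => u; apply: funext => v; rewrite inE.
have := reduction_bound k_gt3 G_deg G_far Ta.
have := card_nonforest T0h; set F := #|_|; set f := (_ - _)%N in hf * => hF.
have P_le : (d.+1 ^ k * d <= Y ^ 3)%N by rewrite expnSr leq_mul ?succ_d_le ?d_le.
set P := (d.+1 ^ k * d)%N in P_le *; set m := #|mid| in hm *.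
apply/negP; rewrite -leqNgt.
apply: (@leq_trans (Y * (Y * (m * Y) + (Y * f + m * Y ^ 3) * Y ^ 3))).
  apply: leq_mul => //; apply: leq_add.
    apply: leq_mul; [by lia|rewrite leq_mul2l d_le orbT //].
  apply: leq_mul => //; apply: leq_add; last by rewrite leq_mul2l P_le orbT.
  by apply: leq_trans hF _; rewrite leq_mul2r (leq_trans _ Y_ge) ?orbT.
have m4 : (m * Y ^ 4 <= m * Y ^ 8)%N by rewrite leq_mul2l leq_pexp2l ?orbT //; lia.
rewrite -(@leq_pmul2l Y); last by lia.
apply: (@leq_trans (3 * N)).
  have -> : (Y * (Y * (Y * (m * Y) + (Y * f + m * Y ^ 3) * Y ^ 3)) =
    m * Y ^ 4 + Y ^ 6 * f + Y ^ 8 * m)%N by ring.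
  by move: m4 hm hf; rewrite [(m * Y ^ 8)%N]mulnC; lia.
by rewrite mulnA leq_mul2r; apply/orP; right; nia.
Qed.

Lemma exists_expanding : (#|mid| * Y ^ 8 < N)%N -> exists sg : V -> V -> bool,
  [/\ symmetric sg, irreflexive sg & forall chi : {ffun V -> bool},
     (N <= Y ^ 8 * #|violated d.+1 (psi nb h) sg chi|)%N].
Proof.
move=> hm; case: far_cases => [|[T0 [T0h T0a T0m hf]]]; first by rewrite mulnC leqNgt hm.
set f := (_ - _)%N in hf; have f0 : (0 < f)%N by case: (f) hf => //; rewrite muln0; lia.
(* Chosen so that [2 * lg * r < f], since [(N ^ 2).+1 <= 2 ^ (2 * lg)]. The loss [2 * lg <= Y ^ 2]
   is the difference between the exponents 6 and 8. *)
pose r := (f.-1 %/ (2 * lg))%N.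
have r1 : (2 * lg * r < f)%N.
  by rewrite mulnC; apply: leq_ltn_trans (leq_divM _ _) _; rewrite prednK.
have r2 : (f <= r.+1 * (2 * lg))%N.
  by have := ltn_ceil f.-1 (_ : 0 < 2 * lg)%N; rewrite prednK //; apply; rewrite muln_gt0.
have hr : ((N ^ 2).+1 ^ r < 2 ^ f)%N.
  apply: (@leq_ltn_trans ((2 ^ (2 * lg)) ^ r)); last by rewrite -expnM ltn_exp2l.
  case: (r) => // r'; rewrite leq_exp2r // mulnC expnM.
  by apply: leq_ltn_trans (_ : (N ^ 2 < _)%N) => //; rewrite ltn_exp2r.
have [sg sgh hsg] := exists_signing h_sym h_irr T0h T0a T0m hr.
exists (sym_closure sg); split.
- by move=> u v; rewrite /sym_closure orbC.
- move=> u; rewrite /sym_closure orbb; apply/negP => /(subsetP sgh).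
  by rewrite inE h_irr.
move=> chi; have hc := hsg chi.
apply: (@leq_trans (Y ^ 8 * #|symdiff (delta h chi) sg|)).
  apply: leq_trans hf _; rewrite (_ : 8 = 6 + 2)%N // expnD -mulnA leq_mul2l; apply/orP; right.
  apply: leq_trans r2 _; rewrite mulnC; apply: leq_mul hc.
  by rewrite -mulnn; apply: leq_mul; lia.
rewrite leq_mul2l; apply/orP; right; apply: subset_leq_card; apply/subsetP => -[u v].
rewrite !inE /= => hd.
have /andP[huv uv] : h u v && (u < v)%N.
  move: hd; case: (boolP ((u, v) \in sg)) => [/(subsetP sgh)|_]; first by rewrite inE.
  by rewrite addbF; case/andP.
rewrite adjacent_h huv /=; move: hd; rewrite huv uv /= /sym_closure.
have -> : ((v, u) \in sg) = false.
  by apply/negP => /(subsetP sgh); rewrite inE /= ltnNge (ltnW uv) andbF.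
by rewrite orbF; case: (chi u); case: (chi v); case: (_ \in _).
Qed.

(** Only the first walk is used: its labels [xs] along the cycle form a prefix of the tape, and once
    the search has stopped the rest of the tape changes nothing. The factor is
    [d.+1 ^ (2 * k) <= Y ^ 4]. *)
Lemma mid_detected s : s \in mid ->
  1 <= (Y ^ 4)%:R * expect (flatten (nseq (M + M) tape))
    (fun l => (`[< good 1 s (chunks tape (M + M) l) >])%:R) :> R.
Proof.
rewrite inE => /asboolP[c0 [sc0 /andP[kc0 c2k] sc]].
have [i q ec] := rot_to sc; have sq : scycle (adj G) (s :: q) by rewrite -ec scycle_rot.
have szq : size c0 = (size q).+1 by rewrite -(size_rot i) ec.
have /and3P[_ _ cq] := sq.
pose a j := nth s (s :: q) j; pose b j := nth s (rcons q s) j.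
have hab j : (j <= size q)%N -> adj G (a j) (b j).
  move=> jq; have := pathP s cq j; rewrite size_rcons ltnS => /(_ jq).
  by rewrite -rcons_cons nth_rcons /= ltnS jq.
pose xs := mkseq (fun j => (index (b j) (nb (a j))).+1) (size q).+1.
have idx j : (j <= size q)%N -> (index (b j) (nb (a j)) < size (nb (a j)))%N.
  by move=> jq; rewrite index_mem; have [_ ->] := nb_lists (a j); exact: hab.
have hxs : is_tape (nseq (size q).+1 d.+1) xs.
  rewrite -[X in nseq X _](size_mkseq (fun j => (index (b j) (nb (a j))).+1)).
  apply: is_tape_all; apply/allP => x /mapP[j]; rewrite mem_iota add0n ltnS => /andP[_ jq] ->.
  by apply: mem_outcomes; rewrite /= ltnS (leq_trans (ltnW (idx j jq))) // (nb_size nb_lists G_deg).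
have nL : ((size q).+1 <= L)%N.
  rewrite -szq; apply: leq_trans c2k _; apply: (@leq_trans (Y * Y)); last first.
    by rewrite mulnn leq_pexp2l //; lia.
  apply: leq_mul; [by lia|apply: leq_trans dk_le; apply: ltnW; exact: ltn_expl].
have hx j : (j <= size q)%N -> nbr nb (nth s (s :: q) j) (nth 0%N xs j) = Some (nth s (rcons q s) j).
  move=> jq; rewrite nth_mkseq ?ltnS //= onthE (nth_map s) ?idx //.
  by rewrite nth_index // -index_mem idx.
have [st1 st2 st3] := psteps_cycle sq (size_mkseq _ _) hx.
have eM : (M + M = (M + M).-1.+1)%N by rewrite prednK // addn_gt0 M_gt0.
rewrite eM; set m := (M + M).-1.
have eL : (L = (size q).+1 + (L - (size q).+1))%N by rewrite subnKC.
rewrite [nseq m.+1 _]/= [flatten _]/= {1}eL nseqD -catA.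
apply: (@le_trans _ _ ((\prod_(b <- nseq (size q).+1 d.+1) size (outcomes b))%:R *
  expect (nseq (size q).+1 d.+1 ++ (nseq (L - (size q).+1) d.+1 ++ flatten (nseq m tape)))
   (fun l => (`[< good 1 s (chunks tape m.+1 l) >])%:R))); last first.
  rewrite ler_wpM2r ?expect_ge0 ?ler_nat // prod_outcomes_nseq //.
  apply: (@leq_trans (d.+1 ^ (2 * k))); first by rewrite leq_pexp2l // -szq.
  by rewrite mulnC expnM (_ : 4 = 2 * 2)%N // expnM leq_exp2r // succ_d_le.
pose bs2 := nseq (L - (size q).+1)%N d.+1 ++ flatten (nseq m tape).
have := @expect_prefix R _ bs2 xs (fun l => (`[< good 1 s (chunks tape m.+1 l) >])%:R) hxs (fun _ _ => ler0n _ _).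
apply: le_trans; rewrite -[leLHS](expect_cst bs2); apply: le_expect => l _.
rewrite asboolT //; exists s.
have e1 ys : pwalk nb (mode_rel k G 1) s (sim0 s) (xs ++ ys) = psteps nb (adj G) (sim0 s) xs.
  rewrite -[LHS]/(psteps nb (adj G) (sim0 s) (xs ++ ys)) {1}/psteps map_cat foldl_cat.
  by rewrite -[LHS]/(psteps nb (adj G) (psteps nb (adj G) (sim0 s) xs) ys) stop_psteps ?st1.
have e2 ls : foldl (pwalk nb (mode_rel k G 1) s) (sim0 s) ((xs ++ take (L - (size q).+1) l) :: ls) =
    psteps nb (adj G) (sim0 s) xs.
  by rewrite -cat1s foldl_cat [foldl _ _ [:: _]]e1 stop_pwalks // st1.
have -> : chunks tape m.+1 (xs ++ l) = take L (xs ++ l) :: chunks tape m (drop L (xs ++ l)).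
  by rewrite /chunks size_nseq.
rewrite take_cat size_mkseq ltnNge nL /search e2 st1; split=> //; right.
by rewrite st2 st3 -szq.
Qed.

Lemma opposite_detected sg U ell t s (ls : seq (seq nat)) : symmetric sg -> irreflexive sg ->
  opposite_pair (walk_end (psi nb h) sg U ell t s) ls -> good 2 s ls.
Proof.
move=> sgs sgi hop; case E: (stop (search k G nb 2 s ls)) => [u|].
  by exists u; split=> //; left.
by have := no_opposite_pair h_sym h_irr sgs sgi (cover U) ell t E; rewrite hop.
Qed.

Definition detected l := exists s : V, nth 0%N l 1 = W s /\
  good (nth 0%N l 0) s (chunks tape (M + M) (drop 2 l)).

Let y : R := Y%:R.
Let z : R := y^-1.

Let zy n : z ^+ n * y ^+ n = 1.
Proof. by rewrite -exprMn mulVf ?expr1n // pnatr_eq0; lia. Qed.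

Let z_gt0 : 0 < z.
Proof. by rewrite invr_gt0 ltr0n; lia. Qed.

Let z_small : 32 * z <= 1.
Proof. by rewrite -ler_pdivlMr // div1r invrK ler_nat. Qed.

Let z_le1 : z <= 1.
Proof. by move: z_small z_gt0; lra. Qed.

(* With z = 1 / Y, the set U has expansion z^9 and density z^10; walks of Y^22
   visits to U, with excursions of length at most Y^33, take L = Y^55 steps and
   equidistribute signs because the spectral gap is at least z^21. *)
Lemma expanding_detected sg : symmetric sg -> irreflexive sg ->
  (forall chi : {ffun V -> bool}, (N <= Y ^ 8 * #|violated d.+1 (psi nb h) sg chi|)%N) ->
  exists S0 : {set V}, z ^+ 10 * N%:R <= 2 * #|S0|%:R /\ {in S0, forall s,
    8^-1 <= expect (flatten (nseq (M + M) tape))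
      (fun l => (`[< good 2 s (chunks tape (M + M) l) >])%:R) :> R}.
Proof.
move=> sgs sgi hv; have zn n : 0 < z ^+ n by rewrite exprn_gt0.
have Y0 n : (0 < Y ^ n)%N by rewrite expn_gt0; lia.
have nb1 w0 : uniq (nb w0) by have [] := nb_lists w0.
have nb2 w0 z0 : (z0 \in nb w0) = adj G w0 z0 by have [_ ->] := nb_lists w0.
have nb3 := nb_size nb_lists G_deg; have hg : subrel h (adj G) by move=> ? ? /andP[].
have psy := psi_sym (d := d) nb1 nb2 nb3 hg h_sym.
have plz := psi_lazy (d := d) h nb3.
have pdg x : (#|[set y | adjacent d.+1 (psi nb h) x y]| <= d)%N.
  exact: (psi_deg nb1 nb2 nb3 hg h_irr).
have N0 : 0 < N%:R :> R by rewrite ltr0n.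
have dy : d%:R <= y by rewrite ler_nat d_le.
have [||U [hU hexp]] := @expanding_core R _ d.+1 d (psi nb h) sg sgi pdg (z ^+ 9) (z ^+ 10).
- exact: ltW.
- move=> chi; rewrite card_ord.
  have h8 : z ^+ 8 * N%:R <= #|violated d.+1 (psi nb h) sg chi|%:R.
    rewrite (_ : #|_|%:R = z ^+ 8 * (y ^+ 8 * #|violated d.+1 (psi nb h) sg chi|%:R)); last by rewrite mulrA zy mul1r.
    rewrite ler_pM2l //.
    by rewrite -natrX -natrM ler_nat.
  (* This amounts to [z ^+ 9 + z ^+ 10 * d < z ^+ 8], true because [z * d <= 1] and [2 * z < 1]. *)
  apply: lt_le_trans h8; rewrite ltr_pM2r //.
  have : z ^+ 10 * d%:R <= z ^+ 9 * 1.
    rewrite exprSr -mulrA ler_pM2l // mulrC ler_pdivrMr ?mul1r // ltr0n; lia.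
  have := zn 8; rewrite exprSr; move: z_small; nra.
rewrite card_ord in hU.
have NU : (N <= Y ^ 10 * #|U|)%N.
  rewrite -(ler_nat R) natrM natrX -/y -[leLHS]mul1r -[X in X * _ <= _](zy 10) mulrAC.
  by rewrite [leRHS]mulrC ler_pM2r // exprn_gt0 // ltr0n; lia.
(* The exponent 33 is 22 for the visits, 10 for the density of [U] and 1 for the factor 4. *)
have hell : (4 * #|V| * Y ^ 22 <= Y ^ 33 * #|U|)%N.
  rewrite card_ord mulnAC; apply: (@leq_trans (Y * Y ^ 22 * (Y ^ 10 * #|U|))).
    by apply: leq_mul NU; rewrite leq_mul2r (leq_trans _ Y_ge) ?orbT.
  by rewrite mulnA -expnS -expnD.
have [S0 [S0U cU hS0]] := mass_ge R psy sgs (Y0 33) hell.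
exists S0; split.
  by apply: le_trans hU _; rewrite -natrM ler_nat.
move=> s sS; have sU := subsetP S0U _ sS.
have tL : (Y ^ 22 * Y ^ 33 <= L)%N by rewrite -expnD.
(* After division by [z ^+ 21] this is [16 * d * d.+1 ^ 2 < Y ^ 3], which follows from
   [d.+1 ^ 4 <= Y ^ 2] and [16 < Y]. *)
have hab : 16 * d%:R * (size (outcomes d.+1))%:R ^+ 2 * z ^+ 21 < (z ^+ 9) ^+ 2.
  rewrite size_iota -exprM (_ : 9 * 2 = 18)%N // (_ : z ^+ 18 = z ^+ 21 * y ^+ 3); last first.
    by rewrite (_ : 21 = 18 + 3)%N // exprD -mulrA zy mulr1.
  rewrite mulrC ltr_pM2l // -natrX -!natrM /y -natrX ltr_nat.
  have h1 := succ_d_le; have h2 : (d.+1 ^ 4 <= d.+1 ^ k)%N by rewrite leq_pexp2l.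
  have h3 : (d * d.+1 ^ 2 <= d.+1 ^ 4)%N.
    apply: (@leq_trans (d.+1 * d.+1 ^ 2)); first by rewrite leq_mul2r leqnSn orbT.
    by rewrite -expnS leq_pexp2l.
  apply: (@leq_ltn_trans (16 * Y ^ 2)); first by rewrite -mulnA leq_mul2l (leq_trans h3 (leq_trans h2 h1)).
  by rewrite [(Y ^ 3)%N]expnS ltn_pmul2r ?Y0 //; exact: leq_trans Y_ge.
have b01 : 0 <= z ^+ 21 <= 1.
  by rewrite ltW // exprn_ile1 // ltW.
(* By [bernoulli], [Y ^ 21] visits halve the factor. Repeating this [Y] times gives [2 ^ (- Y)],
   which [lg + 3 <= Y] makes smaller than [1 / (8 * N)]. *)
have hdecay : (1 - z ^+ 21) ^+ (Y ^ 22) * (8 * #|V|)%:R <= 1.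
  rewrite expnSr exprM card_ord.
  have hq : (1 - z ^+ 21) ^+ (Y ^ 21) <= 2^-1.
    have := bernoulli (Y ^ 21) b01; rewrite natrX -/y [y ^+ _ * _]mulrC zy.
    by rewrite -ler_pdivlMr ?addr_gt0 // div1r.
  apply: (@le_trans _ _ (2^-1 ^+ Y * (2 ^ Y)%:R)); last by rewrite natrX -exprMn mulVf ?expr1n.
  apply: ler_pM; rewrite ?exprn_ge0 ?ler0n ?subr_ge0 //; first by case/andP: b01.
    apply: lerXn2r hq; rewrite nnegrE ?invr_ge0 // exprn_ge0 // subr_ge0.
    by case/andP: b01.
  rewrite ler_nat; apply: (@leq_trans (2 ^ (lg + 3))); last by rewrite leq_exp2l.
  by rewrite expnD mulnC leq_mul2r ltnW.
have H1 := sum_end_prob R psy sgs (Y0 22) tL sU.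
have dp : (0 < d)%N by exact: ltnW.
have bl1 : z ^+ 21 <= 1 by case/andP: b01.
have H2 := end_prob_diff psy plz sgs sgi pdg (Y0 33) (Y0 22) dp (zn 9) (zn 21) bl1 hab hexp hdecay tL sU.
have mS := hS0 s sS; rewrite -H1 in mS.
have := @birthday R _ tape (walk_end (psi nb h) sg U (Y ^ 33) (Y ^ 22) s) M mS H2.
rewrite card_ord => /(_ M_ge M_gt0) hb; apply: le_trans hb _.
apply: le_expect => l _; case: (boolP (opposite_pair _ _)) => [hop|_]; last exact: ler0n.
by rewrite asboolT //; exact: opposite_detected hop.
Qed.

(** Half of the rounds use the useful mode. In mode 1 the start lies in [mid] with probability at
    least [z ^+ 8] and the cycle is followed with probability at least [z ^+ 4]; in mode 2 a good
    start has probability at least [z ^+ 10 / 2], and the search then succeeds with probability at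
    least 1/8. *)
Lemma detection_prob : z ^+ 13 <= expect (2 :: N :: flatten (nseq (M + M) tape))
  (fun l => (`[< detected l >])%:R).
Proof.
set E := expect _ _; have N0 : 0 < N%:R :> R by rewrite ltr0n.
have zn n : 0 < z ^+ n by rewrite exprn_gt0.
have z1 n : z ^+ n.+1 * 32 <= z ^+ n.
  by rewrite exprSr -mulrA [z * _]mulrC ler_piMr // ltW.
have hdet mode (s : V) l : good mode s (chunks tape (M + M) l) -> detected (mode :: W s :: l).
  by exists s; rewrite /= drop0.
have [hm|hm] := leqP N (#|mid| * Y ^ 8).
  have h1 : #|mid|%:R * z ^+ 4 <= (2 * N)%:R * E.
    apply: (@expect_start R N mid 1) => // s sm.
    rewrite -[leLHS]mulr1; apply: le_trans (_ : z ^+ 4 * ((Y ^ 4)%:R * expect (flatten (nseq (M + M) tape))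
      (fun l => (`[< good 1 s (chunks tape (M + M) l) >])%:R)) <= _).
      by rewrite ler_pM2l // mid_detected.
    rewrite mulrA natrX zy mul1r; apply: le_expect => l _.
    by case: asboolP => // hg; rewrite ?ler0n // asboolT //; exact: hdet.
  have h2 : z ^+ 8 * N%:R <= #|mid|%:R.
    rewrite (_ : #|mid|%:R = z ^+ 8 * (#|mid|%:R * y ^+ 8)); last by rewrite mulrCA zy mulr1.
    by rewrite ler_pM2l // -natrX -natrM ler_nat.
  have h3 : N%:R * z ^+ 12 <= N%:R * (2 * E).
    rewrite mulrA [N%:R * 2]mulrC -natrM; apply: le_trans h1.
    by rewrite (_ : 12 = 8 + 4)%N // exprD mulrA ler_pM2r // mulrC.
  rewrite ler_pM2l // in h3; have := z1 12; have := zn 13; lra.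
have [sg [sgs sgi hv]] := exists_expanding hm.
have [S0 [hS hp]] := expanding_detected sgs sgi hv.
have h1 : #|S0|%:R * 8^-1 <= (2 * N)%:R * E.
  apply: (@expect_start R N S0 2) => // s sS.
  apply: le_trans (hp s sS) _; apply: le_expect => l _.
  by case: asboolP => // hg; rewrite ?ler0n // asboolT //; exact: hdet.
have h3 : N%:R * z ^+ 10 <= N%:R * (32 * E).
  rewrite natrM in h1; rewrite [leLHS]mulrC; lra.
rewrite ler_pM2l // in h3; have := z1 10; have := z1 11; have := z1 12.
have := zn 11; have := zn 12; have := zn 13; lra.
Qed.

End Detection.

Local Open Scope nat_scope.

(** * Parameters *)

Section Setup.
Variables (k w N d : nat) (eps : rat) (nb : 'I_N -> seq 'I_N).
Local Notation B := (2 ^ w).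
Local Notation num := `|numq eps|%N.
Local Notation den := `|denq eps|%N.
Variables (lg M : nat).
Local Notation Z := (den %/ num).+1.
Local Notation Y := (d ^ k * (Z * lg)).
Hypothesis k_gt3 : 3 < k.
Hypothesis d_gt0 : 0 < d.
Hypothesis lg_min : forall i, i < lg -> 2 ^ i <= N.
Hypothesis N_lt : N < 2 ^ lg.
Hypothesis lg_gt0 : 0 < lg.
Hypothesis M_ge : 32 * N <= M ^ 2.
Hypothesis M_min : forall i, i < M -> i ^ 2 < 32 * N.
Hypothesis B_ge : 32 < B.
Hypothesis N_big : 32 * N.+2 < B.
Hypothesis Z_big : Z < B.
Hypothesis Y_big : Y ^ 55 < B.
Hypothesis M_big : M ^ 2 + M + M < B.

Lemma pow_exprE m e n : nev m (pow_expr e n) = nev m e ^ n.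
Proof. by elim: n => //= n ->; rewrite expnS. Qed.

Lemma fits_pow_expr m e n : fits w m e -> 0 < nev m e -> nev m e ^ n < B ->
  fits w m (pow_expr e n).
Proof.
move=> fe e0; elim: n => [|n IH] h /=; first by alia.
split=> //; last by rewrite pow_exprE -expnS.
by apply: IH; apply: leq_ltn_trans h; rewrite leq_pexp2l.
Qed.

Let Y_gt0 : 0 < Y.
Proof. by rewrite !muln_gt0 expn_gt0 d_gt0 lg_gt0. Qed.

Let Y_lt : Y < B.
Proof. by apply: leq_ltn_trans Y_big; rewrite -[X in X <= _]expn1 leq_pexp2l. Qed.

Let dk_lt : d ^ k < B.
Proof. by apply: leq_ltn_trans Y_lt; rewrite leq_pmulr // muln_gt0 lg_gt0. Qed.

Let Zlg_lt : Z * lg < B.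
Proof. by apply: leq_ltn_trans Y_lt; rewrite leq_pmull // expn_gt0 d_gt0. Qed.

Let lg_lt : lg < B.
Proof. by apply: leq_ltn_trans Zlg_lt; rewrite leq_pmull. Qed.

Let E_lt : d ^ (k - 2) < B.
Proof. by apply: leq_ltn_trans dk_lt; rewrite leq_pexp2l // leq_subr. Qed.

Lemma setup_spec : wp w nb (setup k) (input N d eps) [::] [::] (lg * 10 + M * 5 + 40)
  (clean k N d (Y ^ 55) (M + M) eps).
Proof.
pose S1 := [:: 23; 25; 31]; pose S := [:: 6, 7, 24, 29 & S1].
have pw T (Q : memory -> Prop) c m0 bs l T' : T' <= T -> wp w nb c m0 bs l T' Q ->
    wp w nb c m0 bs l T Q by move=> h; apply: wp_weaken h _.
apply: (pw _ _ _ _ _ _ ((((lg * 6).+1 + ((M * 3).+1 + 5).+1.+2.+2).+1).+2.+2)); first by alia.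
apply: (wp_store_then (j := 0) (x := Z)) => //.
- fit.
- by fit; move: Z_big; rewrite ?addn1 // => /ltnW.
- by rewrite /= addn1.
apply: (wp_store_then (j := 0) (x := 1)) => //; [fit|fit|].
set m1 := write _ 25 0 1.
pose Inv1 i m := [/\ m 25 0 = 2 ^ i, m 23 0 = i, m 31 0 = Z & frame S1 (input N d eps) m].
apply: (@wp_seq _ _ _ _ _ _ _ _ _ _ (Inv1 lg)).
  apply: wp_for.
  - move=> i m il [e25 e23 e31 fr]; have h2 := lg_min il.
    split.
      rewrite eval_fits /= ?e25 ?(fr 0) //= ?addn1 ?ltnS ?h2 //.
      by do ?[split]; rewrite ?addn1 /input /=; alia.
    apply: (wp_store_then (j := 0) (x := 2 ^ i.+1)) => //.
    + by fit.
    + by fit; rewrite e25; alia.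
    + by rewrite /= e25 expnS mulnC.
    apply: (@wp_store _ _ _ _ _ _ _ _ _ 0 i.+1) => //; [fit| |by rewrite /= /write /= e23 addn1|].
      by fit; rewrite /write /= e23 addn1; apply: leq_ltn_trans lg_lt.
    split=> //; last first.
      move=> a; rewrite !inE !negb_or => /and3P[a1 a2 a3].
      by rewrite /write (negPf a1) (negPf a2) fr // !inE !negb_or a1 a2.
  - move=> m [e25 e23 e31 fr].
    rewrite eval_fits /= ?e25 ?(fr 0) //= ?addn1 ?ltnS ?[2 ^ lg <= N]leqNgt ?N_lt //.
    (* The loop overshoots [N] by a factor of at most 2, so its last value still fits in a word. *)
    have h : 2 ^ lg <= 2 * N.
      by rewrite -(prednK lg_gt0) expnS leq_mul2l lg_min // prednK.
    by do ?[split]; rewrite ?addn1 /input /=; alia.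
  split=> // a; rewrite !inE !negb_or => /and3P[a1 a2 a3].
  by rewrite /m1 /write (negPf a2) (negPf a3).
move=> m2 [e25 e23 e31 fr2].
have e2d : m2 0 1 = d by rewrite fr2.
apply: (wp_store_then (j := 0) (x := Y)) => //; [fit| | |].
- split; last by rewrite /= pow_exprE /= e2d e31 e23.
    by apply: fits_pow_expr; rewrite /= ?e2d //; alia.
  by split; [fit|fit|rewrite /= e31 e23].
- by rewrite /= pow_exprE /= e2d e31 e23.
set m3 := write m2 25 0 Y.
apply: (wp_store_then (j := 0) (x := Y ^ 55)); [fit|by apply: fits_pow_expr; [fit|exact: Y_gt0|exact: Y_big]|by []|exact: pow_exprE|].
set m4 := write m3 6 0 _.
have fr4 : frame S (input N d eps) m4.
  move=> a; rewrite !inE !negb_or => /and5P[a1 a2 a3 a4 /and3P[a5 a6 a7]].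
  by rewrite /m4 /m3 /write (negPf a1) (negPf a6) fr2 // !inE !negb_or a5 a6 a7.
have e46 : m4 6 0 = Y ^ 55 by [].
have e29 : m4 29 0 = 0 by rewrite -[m4 29]/(m2 29) fr2.
move: m4 e46 e29 fr4 => m4; move: (Y ^ 55) => L0 e46 e429 fr4.
pose Inv2 i m := [/\ m 29 0 = i, m 6 0 = L0 & frame S (input N d eps) m].
apply: (@wp_seq _ _ _ _ _ _ _ _ _ _ (Inv2 M)).
  apply: wp_for.
  - move=> i m iM [e29 e6 fr]; have h2 := M_min iM; rewrite -mulnn in h2.
    split.
      rewrite eval_fits /= ?e29 ?(fr 0) //= ?h2 //.
      by do ?[split]; rewrite ?mulnn /input /=; alia.
    apply: (@wp_store _ _ _ _ _ _ _ _ _ 0 i.+1) => //; [fit| |by rewrite /= e29 addn1|].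
      by fit; rewrite e29 addn1; alia.
    split=> // a; rewrite !inE !negb_or => /and5P[a1 a2 a3 a4 /and3P[a5 a6 a7]].
    by rewrite /write (negPf a4) fr // !inE !negb_or a1 a2 a3 a4 a5 a6 a7.
  - move=> m [e29 e6 fr]; have h2 := M_ge; rewrite -mulnn in h2.
    rewrite eval_fits /= ?e29 ?(fr 0) //= ?[M * M < _]ltnNge ?h2 //.
    by do ?[split]; rewrite ?mulnn /input /=; alia.
  by split.
move=> m5 [e29 e6 fr5]; have e5d : m5 0 1 = d by rewrite fr5.
apply: (wp_store_then (j := 0) (x := M + M)) => //; [fit| | |].
- by fit; rewrite e29; alia.
- by rewrite /= e29.
apply: (@wp_store _ _ _ _ _ _ _ _ _ 0 (d ^ (k - 2))) => //; [fit| | |].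
- by apply: fits_pow_expr; rewrite /= /write /= ?e5d //; alia.
- by rewrite pow_exprE /= /write /= e5d.
split; last by move=> v; rewrite /write /= fr5.
by split=> //; [exact: fr5|rewrite /write /= fr5].
Qed.

End Setup.

Local Open Scope ring_scope.

Lemma is_tape_split bs1 bs2 l : is_tape (bs1 ++ bs2) l ->
  is_tape bs1 (take (size bs1) l) && is_tape bs2 (drop (size bs1) l).
Proof.
elim: bs1 l => [|b bs1 IH] l /=; first by rewrite take0 drop0.
by case: l => // x l /= /andP[-> /IH].
Qed.

Lemma chunksP bs n l : is_tape (flatten (nseq n bs)) l ->
  [/\ flatten (chunks bs n l) = l, all (is_tape bs) (chunks bs n l) & size (chunks bs n l) = n].
Proof.
elim: n l => [|n IH] l; first by case: l.
rewrite [flatten _]/= => /is_tape_split/andP[h1 /IH[e1 e2 e3]].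
rewrite /chunks [reshape _ _]/= -/(chunks bs n (drop (size bs) l)); split.
- by rewrite /= e1 cat_take_drop.
- by rewrite /= h1.
- by rewrite /= e3.
Qed.

Lemma outcomes_ord n x : (0 < n)%N -> x \in outcomes n -> exists s : 'I_n, (nat_of_ord s).+1 = x.
Proof.
case: n => // n _; rewrite mem_iota add1n ltnS; case: x => //= x xn.
by exists (Ordinal xn).
Qed.

(** * Consequences of farness *)

Section Far.
Variables (N d k : nat) (eps : rat) (G : sgraph N).
Hypothesis k_gt3 : (3 < k)%N.
Hypothesis eps_gt0 : 0 < eps.
Hypothesis G_deg : max_degree_le G d.
Hypothesis G_far : far d eps (fun G' => no_long_cycle G' k) G.
Local Notation num := `|numq eps|%N.
Local Notation den := `|denq eps|%N.

Lemma num_gt0 : (0 < num)%N.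
Proof. by rewrite absz_gt0 gt_eqF // numq_gt0. Qed.

Lemma eps_frac : eps = num%:R / den%:R.
Proof.
rewrite -[LHS]divq_num_den !natr_absz !ger0_norm ?denq_ge0 //.
by rewrite ltW // numq_gt0.
Qed.

(** The integer [(den %/ num).+1] exceeds [1 / eps], and the program obtains it by one division. *)
Lemma far_dist G' : no_long_cycle G' k -> (d * N < (den %/ num).+1 * edge_dist G G')%N.
Proof.
move=> /G_far; have n0 := num_gt0; have d0 : (0 < den)%N by rewrite absz_gt0 gt_eqF ?denq_gt0.
rewrite {1}eps_frac mulrAC ltr_pdivrMr ?ltr0n // -!natrM ltr_nat => h.
rewrite -(@ltn_pmul2l num) //; apply: leq_trans h _.
by rewrite mulnC mulnA leq_mul2r mulnC ltnW ?orbT // ltn_ceil.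
Qed.

Lemma far_has_cycle : exists2 c : seq 'I_N, simple_cycle G c & (k <= size c)%N.
Proof.
apply/not_exists2P => h.
have : no_long_cycle G k.
  by move=> c sc; rewrite ltnNge; apply/negP => kc; case: (h c).
move=> /far_dist; by rewrite /edge_dist setDv setU0 cards0 muln0.
Qed.

Lemma far_N : (3 < N)%N.
Proof.
have [c /and3P[_ uc _] kc] := far_has_cycle; apply: leq_trans k_gt3 (leq_trans kc _).
by rewrite -(card_uniqP uc) -[X in (_ <= X)%N]card_ord max_card.
Qed.

Lemma far_d : (1 < d)%N.
Proof.
have [[|v [|u c]] /and3P[s3 uc cc] kc] // := far_has_cycle.
apply: leq_trans (G_deg v); have lu : u != last u c.
  case/lastP: c s3 uc {cc kc} => // c z _; rewrite last_rcons /= !inE => /and3P[_ + _].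
  by rewrite mem_rcons inE; apply: contra => /eqP ->; rewrite eqxx.
apply: (@leq_trans #|[set u; last u c]|); first by rewrite cards2 lu.
apply: subset_leq_card; apply/subsetP => x; rewrite !inE.
move: cc; rewrite /= rcons_path => /and3P[vu _ lv].
by case/orP => /eqP -> //; rewrite adj_sym.
Qed.

(** Deleting all edges costs at most [d * N], so the empty graph bounds [eps]. This makes
    [d ^ k / eps] at least 1, on which the final estimates rely. *)
Lemma far_eps : eps < 1.
Proof.
have irr : irreflexive (fun _ _ : 'I_N => false) by [].
pose G0 := @SGraph N (fun _ _ => false) (fun _ _ => erefl) irr.
have h0 : no_long_cycle G0 k.
  by move=> [|v c] /and3P[//= _ _]; case: c => //= u c.
have dN : (0 < (d * N)%:R :> rat).
  by rewrite ltr0n muln_gt0 (ltnW far_d) (leq_trans _ far_N).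
rewrite -(ltr_pM2r dN) mul1r; apply: lt_le_trans (G_far h0) _; rewrite ler_nat.
rewrite /edge_dist (_ : edges G0 = set0) ?setD0 ?set0D ?setU0; last first.
  by apply/setP => p; rewrite !inE andbF.
rewrite -sum1_card big_mkcond /=.
rewrite (eq_bigr (fun p : 'I_N * 'I_N =>
  (fun u v => nat_of_bool ((u, v) \in edges G)) p.1 p.2)); last by case=> u v _ /=; case: ifP.
rewrite -(pair_bigA _ (fun u v => nat_of_bool ((u, v) \in edges G))) /=.
rewrite mulnC -[X in (_ <= X * _)%N]card_ord -sum_nat_const; apply: leq_sum => u _.
apply: leq_trans (G_deg u); rewrite -sum1_card [leqRHS]big_mkcond /=; apply: leq_sum => v _.
by rewrite !inE /=; case: (u < v)%N; case: (adj G u v).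
Qed.

End Far.

(** * The complete run *)

Section Run.
Variables (R : realType) (N d k w lg M : nat) (eps : rat) (G : sgraph N) (nb : 'I_N -> seq 'I_N).
Local Notation num := `|numq eps|%N.
Local Notation den := `|denq eps|%N.
Local Notation Z := (den %/ num).+1.
Local Notation Y := (d ^ k * (Z * lg))%N.
Local Notation L := (Y ^ 55)%N.
Local Notation B := (2 ^ w)%N.
Hypothesis k_gt3 : (3 < k)%N.
Hypothesis eps_gt0 : 0 < eps.
Hypothesis G_deg : max_degree_le G d.
Hypothesis nb_lists : neighbor_lists G nb.
Hypothesis G_far : far d eps (fun G' => no_long_cycle G' k) G.
Hypothesis lg_min : forall i, (i < lg)%N -> (2 ^ i <= N)%N.
Hypothesis N_lt : (N < 2 ^ lg)%N.
Hypothesis M_ge : (32 * N <= M ^ 2)%N.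
Hypothesis M_min : forall i, (i < M)%N -> (i ^ 2 < 32 * N)%N.
Hypothesis N_big : (32 * (N.+2 * N.+2) < B)%N.
Hypothesis d_big : (d.+1 < B)%N.
Hypothesis k_big : (k < B)%N.
Hypothesis Z_big : (Z < B)%N.
Hypothesis L_big : (2 * L + 4 < B)%N.
Hypothesis M_big : (M ^ 2 + M + M < B)%N.

Definition algorithm := Then (setup k) (main_loop k).

Definition T_run := (lg * 10 + M * 5 + 41)%N.

Lemma lg_gt0 : (0 < lg)%N.
Proof. by case: (lg) N_lt => //; rewrite ltnS leqn0 => /eqP N0; have := far_N k_gt3 eps_gt0 G_far; rewrite N0. Qed.

Lemma Y_ge : (16 * lg <= Y)%N.
Proof.
have d2 := far_d eps_gt0 G_deg G_far; apply: leq_mul; last by rewrite leq_pmull.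
by apply: (@leq_trans (2 ^ k)); [exact: (leq_pexp2l (m := 2) _ k_gt3)|rewrite leq_exp2r // (leq_trans _ k_gt3)].
Qed.

Lemma run_spec (P : memory -> Prop) : (forall m, success k L G m -> P m) ->
  success_prob w nb R P ([:: algorithm], input N d eps) = 1%E /\
  (expected_time w nb R ([:: algorithm], input N d eps) <=
   ((T_run)%:R + (T_body k d L (M + M)).+2%:R / (Y%:R^-1 ^+ 13))%:E)%E.
Proof.
move=> hP; have N3 := far_N k_gt3 eps_gt0 G_far; have d2 := far_d eps_gt0 G_deg G_far.
have lg2 : (2 < lg)%N.
  rewrite ltnNge; apply/negP => h2; have := leq_trans N_lt (leq_pexp2l (m := 2) isT h2).
  by rewrite ltnS leqNgt N3.
have Yg := Y_ge; have lg0 := lg_gt0; have d0 : (0 < d)%N by exact: ltnW.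
have N0 : (0 < N)%N by exact: leq_trans N3.
have Y48 : (48 <= Y)%N by apply: leq_trans Yg; rewrite (leq_mul (leqnn 16) lg2).
have Y0 : (0 < Y)%N by exact: leq_trans Y48.
have dkY : (d ^ k <= Y)%N by rewrite leq_pmulr // muln_gt0 lg0.
have ZY : (Z <= Y)%N.
  by apply: leq_trans (leq_pmulr _ lg0) _; rewrite leq_pmull // expn_gt0 d0.
have lgY : (lg + 3 <= Y)%N.
  apply: leq_trans Yg; move: lg2; clear; lia.
have YL : (Y <= L)%N by rewrite -[X in (X <= _)%N]expn1 leq_pexp2l.
have LB : (L < B)%N by apply: leq_ltn_trans L_big; move: (L) => x; clear; lia.
have M0 : (0 < M)%N by case: (M) M_ge N0 => // h N0; move: h; rewrite exp0n // leqn0 muln_eq0 /= => /eqP h; rewrite h in N0.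
have NB4 : (4 * (N.+2 * N.+2) < B)%N by apply: leq_ltn_trans N_big; rewrite leq_mul2r orbT.
have NB32 : (32 * N.+2 < B)%N by apply: leq_ltn_trans N_big; rewrite leq_mul2l leq_pmulr ?orbT.
have B32 : (32 < B)%N by apply: leq_ltn_trans NB32; rewrite leq_pmulr.
have EB : (d ^ (k - 2) < B)%N.
  by apply: leq_ltn_trans LB; apply: leq_trans YL; apply: leq_trans dkY; rewrite leq_pexp2l // leq_subr.
have MB : (M + M < B)%N by apply: leq_ltn_trans M_big; rewrite -addnA leq_addl.
have [n0 [m0 [n0T cm0 r0]]] :=
  setup_spec nb k_gt3 d0 lg_min N_lt lg0 M_ge M_min B32 NB32 Z_big LB M_big.
have cl0 m : clean k N d L (M + M) eps m -> Defs.eval w m (Op Defs.Sub (Const 1) (var 26)) != 0%N.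
  case=> -[_ _ _ _ e26] _; rewrite eval_fits /= e26 //.
  by split; rewrite /= ?e26 ?subn0; [exact: leq_ltn_trans B32|exact: leq_ltn_trans B32|exact: leq_ltn_trans B32].
have su0 m : success k L G m -> Defs.eval w m (Op Defs.Sub (Const 1) (var 26)) = 0%N.
  case=> e26 _; rewrite eval_fits /= e26 //.
  by split; rewrite /= ?e26 ?subn0; [exact: leq_ltn_trans B32|exact: leq_ltn_trans B32|exact: leq_ltn_trans B32].
have spec m l : clean k N d L (M + M) eps m -> is_tape (body_tape N d L (M + M)) l ->
    wp w nb (body k) m (body_tape N d L (M + M)) l (T_body k d L (M + M))
      (fun m' => success k L G m' \/ clean k N d L (M + M) eps m' /\ ~ detected d k Y M G nb l).
  case: l => [|mode [|x l]] // cm; first by rewrite /= andbF.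
  rewrite [is_tape _ _]/= -/(outcomes 2) -/(outcomes N) => /and3P[hmode hx hl].
  have hm : mode = 1%N \/ mode = 2%N by move: hmode; rewrite !inE => /orP[]/eqP; [left|right].
  have [s hs] := outcomes_ord N0 hx.
  have [e1 e2 e3] := chunksP hl.
  have hb := body_spec nb_lists G_deg k_gt3 d0 NB4 d_big k_big EB L_big MB s cm hm e2 e3.
  rewrite e1 hs in hb.
  apply: wp_weaken hb => //.
  move=> m' [|[cm' ng]]; [by left|right]; split=> // -[s' [/= e]]; rewrite drop0.
  by have -> : s' = s by apply/val_inj/succn_inj; rewrite hs e.
have dp : Y%:R^-1 ^+ 13 <= expect (2 :: N :: flatten (nseq (M + M) (nseq L d.+1)))
    (fun l => (`[< detected d k Y M G nb l >])%:R) :> R.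
  apply: (@detection_prob R N d k Z lg Y M) => //; first exact: leq_trans Y48.
  by move=> G'; exact: (far_dist eps_gt0 G_far).
have rho0 : 0 < Y%:R^-1 ^+ 13 :> R by rewrite exprn_gt0 // invr_gt0 ltr0n.
have := @loop_halts w N nb R P _ _ _ _ _ _ _ _ cl0 su0 spec rho0 dp hP
  ([:: algorithm], input N d eps) T_run n0.+1 m0.
case; [by rewrite /T_run addnS ltnS|exact: (r0 [:: main_loop k])|exact: cm0|].
by move=> h1 h2; split=> //; exact: expected_time_le.
Qed.

End Run.

(** There are [M + M] walks of [Y ^ 55] steps, and one step may test [d ^ (k - 2) <= Y] codes; the
    other costs are absorbed in the constant. *)
Lemma run_time k d lg M Y : (0 < M)%N -> (0 < Y)%N -> (lg <= Y)%N -> (d ^ (k - 2) <= Y)%N ->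
  (T_run lg M + (T_body k d (Y ^ 55) (M + M)).+2 <= (20 * k + 600) * (M * Y ^ 56))%N.
Proof.
move=> M0 Y0 lgY EY; rewrite (expnSr Y 55); have : (0 < Y ^ 55)%N by rewrite expn_gt0 Y0.
move: (Y ^ 55)%N => L L0; rewrite /T_run /T_body /T_walk /T_advance /T_test.
move: (d ^ (k - 2))%N EY => E EY.
have hE : (M * L * (E * (k * 10 + 20)) <= M * L * (Y * (k * 10 + 20)))%N.
  by rewrite leq_mul2l leq_mul2r EY !orbT.
have hW : (M * (L * Y) = M * L * Y)%N by rewrite mulnA.
have h1 : (M * L <= M * (L * Y))%N by rewrite hW leq_pmulr.
have h2 : (M <= M * L)%N by rewrite leq_pmulr.
have h3 : (L <= M * L)%N by rewrite leq_pmull.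
have h4 : (Y <= M * (L * Y))%N by rewrite mulnA leq_pmull // muln_gt0 M0.
have -> : ((M + M) * (L * (E * (k * 10 + 20) + 20 + 40 + 7) + 20 + 5) =
  2 * (M * L * (E * (k * 10 + 20))) + 134 * (M * L) + 50 * M)%N by ring.
have e2 : (M * L * (Y * (k * 10 + 20)) = (k * 10 + 20) * (M * (L * Y)))%N by ring.
rewrite e2 in hE; move: hE h1 h2 h3 h4 lgY M0.
rewrite (_ : (M + M) * L * 4 = 8 * (M * L))%N; last by ring.
rewrite (_ : (20 * k + 600) * (M * (L * Y)) = 2 * ((k * 10 + 20) * (M * (L * Y))) + 560 * (M * (L * Y)))%N; last by ring.
clear; lia.
Qed.

(** * Numerical bounds *)

Section Words.
Variables (N d k num den : nat).
Hypothesis k_gt3 : (3 < k)%N.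
Hypothesis N_ge : (3 < N)%N.
Hypothesis d_ge : (1 < d)%N.
Hypothesis num_gt0 : (0 < num)%N.
Hypothesis den_gt0 : (0 < den)%N.
Local Notation S := (N + d + num + den)%N.
Local Notation c := (55 * (k + 2) + 10)%N.
Local Notation A := (2 ^ (trunc_log 2 S).+1)%N.
Local Notation B := (2 ^ (c * (trunc_log 2 S).+1))%N.
Local Notation lg := (trunc_log 2 N).+1.
Local Notation Z := (den %/ num).+1.
Local Notation Y := (d ^ k * (Z * lg))%N.

Let S_lt : (S < A)%N.
Proof. by rewrite trunc_log_ltn. Qed.

Let A_ge : (8 < A)%N.
Proof. by apply: leq_ltn_trans S_lt; lia. Qed.

Let B_eq : B = (A ^ c)%N.
Proof. by rewrite -expnM mulnC. Qed.

Lemma lg_le : (lg <= N)%N.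
Proof.
have N0 : (0 < N)%N by exact: leq_trans N_ge.
by apply: leq_trans (trunc_logP (isT : 1 < 2)%N N0); exact: ltn_expl.
Qed.

(** The power of two [A] exceeds all input parameters. The largest quantity stored is of order
    [Y ^ 55], where [Y <= A ^ (k + 2)]; the remaining 10 in the exponent absorbs numerical
    factors. *)
Lemma word_pow x m n : (x <= n * A ^ m)%N -> (n < A ^ 5)%N -> (m + 5 <= c)%N -> (x < B)%N.
Proof.
move=> hx hn hm; rewrite B_eq; apply: leq_ltn_trans hx _.
apply: (@leq_trans (A ^ 5 * A ^ m)); last by rewrite -expnD leq_pexp2l ?expn_gt0 // addnC.
by rewrite ltn_pmul2r ?expn_gt0.
Qed.

Let A5 n : (n <= 8 ^ 5)%N -> (n < A ^ 5)%N.
Proof. by move=> h; apply: leq_ltn_trans h _; rewrite ltn_exp2r. Qed.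

Lemma Y_word : (2 * Y ^ 55 + 4 < B)%N.
Proof.
have hY : (Y <= A ^ (k + 2))%N.
  rewrite expnD; apply: leq_mul.
    by rewrite leq_exp2r; [apply: leq_trans (ltnW S_lt); lia|exact: leq_trans k_gt3].
  rewrite -mulnn; apply: leq_mul.
    apply: leq_trans S_lt; rewrite ltnS; apply: leq_trans (leq_div _ _) _; lia.
  by apply: leq_trans lg_le _; apply: leq_trans (ltnW S_lt); lia.
apply: (@word_pow _ (55 * (k + 2)) 6); [|exact: A5|by rewrite leq_add2l].
have : (Y ^ 55 <= A ^ (55 * (k + 2)))%N by rewrite [(55 * _)%N]mulnC expnM leq_exp2r.
have : (0 < A ^ (55 * (k + 2)))%N by rewrite !expn_gt0.
move: (Y ^ 55)%N (A ^ (55 * _))%N; clear; lia.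
Qed.

Lemma N_word : (32 * (N.+2 * N.+2) < B)%N.
Proof.
apply: (@word_pow _ 2 32); [|exact: A5|lia].
have h : (N.+2 <= A)%N by apply: leq_trans (ltnW S_lt); lia.
by rewrite leq_mul2l -mulnn leq_mul.
Qed.

Lemma M_word M : (M <= 32 * N)%N -> (M ^ 2 + M + M < B)%N.
Proof.
move=> hM; apply: (@word_pow _ 2 3072); [|exact: A5|lia].
have h : (M <= 32 * A)%N by apply: leq_trans hM _; rewrite leq_mul2l /=; apply: leq_trans (ltnW S_lt); lia.
apply: (@leq_trans (3 * M ^ 2)); first by rewrite -mulnn; clear; nia.
have : (M ^ 2 <= 1024 * A ^ 2)%N by rewrite (_ : 1024 = 32 ^ 2)%N // -expnMn leq_exp2r.
move: (M ^ 2)%N (A ^ 2)%N; clear; lia.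
Qed.

Lemma d_word : (d.+1 < B)%N.
Proof.
apply: (@word_pow _ 1 1); [|exact: A5|lia].
by rewrite mul1n expn1; apply: leq_trans (ltnW S_lt); lia.
Qed.

Lemma Z_word : (Z < B)%N.
Proof.
apply: (@word_pow _ 1 1); [|exact: A5|lia].
rewrite mul1n expn1; apply: leq_trans S_lt; rewrite ltnS.
by apply: leq_trans (leq_div _ _) _; lia.
Qed.

Lemma k_word : (k < B)%N.
Proof.
rewrite B_eq; apply: (@leq_trans (2 ^ k)); first exact: ltn_expl.
apply: (@leq_trans (A ^ k)); first by rewrite leq_exp2r ?(leq_trans _ A_ge) // (leq_trans _ k_gt3).
by rewrite leq_pexp2l ?expn_gt0 //; lia.
Qed.

End Words.

Section Numerics.
Variable R : realType.

Lemma le_scale (a b y : R) : 0 <= a -> 1 <= y -> a + b * y <= (a + b) * y.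
Proof. by move=> a0 y1; rewrite mulrDl lerD2r ler_peMr. Qed.

Lemma ln2_ge : 2^-1 <= ln 2 :> R.
Proof.
rewrite -[leLHS]expRK ler_ln ?posrE ?expR_gt0 //.
have := expR_ge1Dx (- 2^-1 : R); rewrite expRN.
have e0 := expR_gt0 (2^-1 : R); rewrite -(ler_pM2l e0) mulfV ?gt_eqF //; lra.
Qed.

Lemma lg_le_ln N : (3 < N)%N -> ((trunc_log 2 N).+1)%:R <= 3 * ln (N%:R : R).
Proof.
move=> N3; have N0 : (0 < N)%N by exact: leq_trans N3.
have h n : (2 ^ n <= N)%N -> n%:R <= 2 * ln (N%:R : R).
  move=> hn; have : ln ((2 ^ n)%:R : R) <= ln N%:R.
    by rewrite ler_ln ?posrE ?ltr0n ?expn_gt0 // ler_nat.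
  rewrite natrX lnXn // => h1; have := ln2_ge; have : 0 <= n%:R :> R by exact: ler0n.
  by move: h1; rewrite -mulr_natr; nra.
have := h _ (trunc_logP (isT : 1 < 2)%N N0); have := h 2 N3; rewrite -natr1; lra.
Qed.

(** By minimality [M - 1] is less than the root of [32 * N], hence less than 6 times the root of
    [N]; the missing 1 is at most that root. *)
Lemma sqrt_bound N M : (0 < N)%N -> (forall i, (i < M)%N -> (i ^ 2 < 32 * N)%N) ->
  M%:R <= 7 * Num.sqrt (N%:R : R).
Proof.
move=> N0 h; have s1 : 1 <= Num.sqrt (N%:R : R).
  by rewrite -[leLHS]sqrtr1 ler_sqrt ?ler0n // ler1n.
case: M h => [|M] h; first by rewrite mulr_ge0 // sqrtr_ge0.
have : M%:R <= 6 * Num.sqrt (N%:R : R).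
  rewrite -ler_sqr ?nnegrE ?ler0n ?mulr_ge0 ?sqrtr_ge0 // exprMn sqr_sqrtr ?ler0n //.
  have := h M (ltnSn _); rewrite -(ltr_nat R) natrX natrM => /ltW.
  have : 0 <= N%:R :> R by exact: ler0n.
  lra.
rewrite -natr1; lra.
Qed.

End Numerics.

Theorem theorem1p2 (R : realType) :
  exists p q : {poly R},
  forall k : nat, (3 < k)%N ->
  exists (A : cmd) (c : nat) (C : R) (b : nat), (0 < c)%N /\
  forall (N d : nat) (eps : rat) (G : sgraph N) (nb : 'I_N -> seq 'I_N),
    0 < eps ->
    max_degree_le G d ->
    neighbor_lists G nb ->
    far d eps (fun G' => no_long_cycle G' k) G ->
    let w := word_length c N d eps in
    let start : config := ([:: A], input N d eps) in
    let f : R := p.[d%:R ^+ k / ratr eps] * Num.sqrt N%:R in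
    let found (m : memory) := exists cyc : seq 'I_N,
      [/\ outputs m cyc, simple_cycle G cyc, (k <= size cyc)%N &
          (size cyc)%:R <= q.[d%:R ^+ k * (ratr eps)^-1 * ln N%:R]] in
    success_prob w nb R found start = 1%E /\
    (expected_time w nb R start <= (C * f * ln f ^+ b)%:E)%E.
Proof.
(* A round takes time of order [M * Y ^ 56] and succeeds with probability at least [Y ^ (- 13)],
   whence 69. The cycle has length at most [3 * Y ^ 55], where [Y <= 6 * x * ln N]. *)
exists 'X^69, ((3 * 6 ^+ 55) *: 'X^55) => k k_gt3.
(* The factor 7 comes from [sqrt_bound] and [12 ^+ 69] from [Y <= 12 * x * ln f], which also yields
   the power 69 of the logarithm. *)
exists (algorithm k), (55 * (k + 2) + 10)%N, ((20 * k + 600)%:R * 7 * 12 ^+ 69), 69.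
split=> [|N d eps G nb eps_gt0 G_deg nb_lists G_far]; first by rewrite addn_gt0 orbT.
have N_ge := far_N k_gt3 eps_gt0 G_far; have d_ge := far_d eps_gt0 G_deg G_far.
have num0 := num_gt0 eps_gt0; have eps1 := far_eps k_gt3 eps_gt0 G_deg G_far.
have den0 : (0 < `|denq eps|)%N by rewrite absz_gt0 gt_eqF ?denq_gt0.
have N0 : (0 < N)%N by exact: leq_trans N_ge.
move=> w start; set x : R := d%:R ^+ k / ratr eps; move=> f found.
set num := `|numq eps|%N in num0; set den := `|denq eps|%N in den0.
pose lg := (trunc_log 2 N).+1; pose Z := (den %/ num).+1.
pose Y := (d ^ k * (Z * lg))%N.
have M_ex : exists n, (32 * N <= n ^ 2)%N by exists (32 * N)%N; rewrite -mulnn leq_pmulr // muln_gt0.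
case: (ex_minnP M_ex) => M M_ge M_least.
have M_min i : (i < M)%N -> (i ^ 2 < 32 * N)%N.
  by rewrite ltnNge => h; rewrite ltnNge; apply: contra h; exact: M_least.
have M_le : (M <= 32 * N)%N by apply: M_least; rewrite -mulnn leq_pmulr // muln_gt0.
have M0 : (0 < M)%N.
  by rewrite lt0n; apply/eqP => e; move: M_ge; rewrite e exp0n // leqn0 muln_eq0 /= => /eqP e0; rewrite e0 in N0.
have lg_min i : (i < lg)%N -> (2 ^ i <= N)%N.
  rewrite ltnS => h; apply: leq_trans (trunc_logP (isT : 1 < 2)%N N0).
  by rewrite leq_pexp2l.
have N_lt : (N < 2 ^ lg)%N by rewrite trunc_log_ltn.
have Y0 : (0 < Y)%N by rewrite !muln_gt0 expn_gt0 (ltnW d_ge).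
have lgY : (lg <= Y)%N by rewrite /Y mulnA leq_pmull // muln_gt0 expn_gt0 (ltnW d_ge).
have EY : (d ^ (k - 2) <= Y)%N.
  by apply: leq_trans (leq_pmulr _ _) => //; rewrite leq_pexp2l ?leq_subr // ltnW.
have epsE : ratr eps = num%:R / den%:R :> R.
  by rewrite {1}(eps_frac eps_gt0) fmorph_div !rmorph_nat.
have n0 : 0 < num%:R :> R by rewrite ltr0n.
have dn0 : 0 < den%:R :> R by rewrite ltr0n.
have num_den : (num <= den)%N.
  by move: eps1; rewrite (eps_frac eps_gt0) ltr_pdivrMr ?ltr0n // mul1r ltr_nat; exact: ltnW.
have dk1 : 1 <= d%:R ^+ k :> R by rewrite exprn_ege1 // ler1n ltnW.
have xE : x = d%:R ^+ k * (den%:R / num%:R) by rewrite /x epsE invf_div.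
have dn1 : 1 <= den%:R / num%:R :> R by rewrite ler_pdivlMr // mul1r ler_nat.
have x1 : 1 <= x by rewrite xE -[leLHS]mulr1 ler_pM.
have Z_le : Z%:R <= 2 * (den%:R / num%:R) :> R.
  rewrite mulrA ler_pdivlMr // -!natrM ler_nat mul2n -addnn /Z mulSn leq_add //.
  exact: leq_divM.
have lnN : lg%:R <= 3 * ln N%:R :> R by exact: lg_le_ln.
have Y_le c : 0 <= c -> lg%:R <= c -> Y%:R <= 2 * x * c.
  move=> c0 hc; rewrite /Y mulnA !natrM natrX xE mulrCA.
  apply: ler_pM => //; rewrite ?mulr_ge0 ?exprn_ge0 ?ler0n //.
  by rewrite ler_pM2l // (lt_le_trans ltr01).
have lnN0 : 0 <= 3 * ln N%:R :> R by apply: le_trans lnN.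
have x0 : 0 <= x by apply: le_trans x1.
have wN : (32 * (N.+2 * N.+2) < 2 ^ w)%N by apply: N_word.
have wd : (d.+1 < 2 ^ w)%N by apply: d_word.
have wk : (k < 2 ^ w)%N by apply: k_word.
have wZ : (Z < 2 ^ w)%N by apply: Z_word.
have wY : (2 * Y ^ 55 + 4 < 2 ^ w)%N by apply: Y_word.
have wM : (M ^ 2 + M + M < 2 ^ w)%N by apply: M_word.
have hfound m : success k (Y ^ 55) G m -> found m.
  case=> _ [c [o1 o2 o3 o4]]; exists c; split=> //.
  rewrite hornerZ hornerXn -/x.
  apply: (@le_trans _ _ (3 * Y%:R ^+ 55)).
    rewrite -natrX -natrM ler_nat; apply: leq_trans o4 _.
    have : (0 < Y ^ 55)%N by rewrite expn_gt0 Y0.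
    by move: (Y ^ 55)%N; clear; lia.
  rewrite -mulrA ler_pM2l // -exprMn; apply: lerXn2r; rewrite ?nnegrE ?ler0n //.
    by rewrite mulr_ge0 // mulr_ge0 // -(pmulr_rge0 _ (ltr0n R 3)).
  by apply: le_trans (Y_le _ lnN0 lnN) _; rewrite le_eqVlt; apply/orP; left; apply/eqP; ring.
have [h1 h2] := run_spec R k_gt3 eps_gt0 G_deg nb_lists G_far lg_min N_lt M_ge M_min wN wd wk wZ wY wM hfound.
split=> //; apply: le_trans h2 _; rewrite lee_fin.
have s0 : 0 < Num.sqrt (N%:R : R) by rewrite sqrtr_gt0 ltr0n.
have fE : f = x ^+ 69 * Num.sqrt N%:R by rewrite /f hornerXn.
(* Since [x >= 1], [f] is at least the root of [N]; this lets the logarithm of [f] replace that of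
   [N]. *)
have lnf : ln N%:R <= 2 * ln f.
  have : ln (Num.sqrt N%:R : R) <= ln f.
    rewrite ler_ln ?posrE //; last by rewrite fE mulr_gt0 // exprn_gt0 // (lt_le_trans ltr01).
    by rewrite fE; apply: ler_peMl; [exact: ltW|exact: exprn_ege1].
  rewrite -[in ln N%:R](sqr_sqrtr (ler0n R N)) lnXn // -mulr_natr; lra.
have lgf : lg%:R <= 6 * ln f by apply: le_trans lnN _; lra.
have lnf0 : 0 <= 6 * ln f by apply: le_trans lgf.
have yT : 1 <= Y%:R ^+ 13 :> R by rewrite exprn_ege1 // ler1n.
rewrite exprVn invrK.
apply: (@le_trans _ _ ((20 * k + 600)%:R * (M%:R * Y%:R ^+ 56) * Y%:R ^+ 13)).
  apply: (@le_trans _ _ ((T_run lg M + (T_body k d (Y ^ 55) (M + M)).+2)%:R * Y%:R ^+ 13)).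
    by rewrite natrD; apply: le_scale.
  rewrite ler_wpM2r ?exprn_ge0 // -natrX -!natrM ler_nat.
  exact: run_time.
have -> : (20 * k + 600)%:R * (M%:R * Y%:R ^+ 56) * Y%:R ^+ 13 =
    (20 * k + 600)%:R * (M%:R * Y%:R ^+ 69) :> R.
  by rewrite (exprD _ 56 13) !mulrA.
rewrite [X in _ <= X](_ : _ = (20 * k + 600)%:R * (7 * Num.sqrt N%:R * (12 * x * ln f) ^+ 69)); last first.
  by rewrite fE !exprMn; ring.
apply: ler_wpM2l; first exact: ler0n.
apply: ler_pM; [exact: ler0n|by rewrite exprn_ge0 ?ler0n|exact: sqrt_bound|].
apply: lerXn2r; rewrite ?nnegrE //; last first.
  by apply: le_trans (Y_le _ lnf0 lgf) _; rewrite le_eqVlt; apply/orP; left; apply/eqP; ring.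
by apply: le_trans (ler0n R Y) (le_trans (Y_le _ lnf0 lgf) _); rewrite le_eqVlt; apply/orP; left; apply/eqP; ring.
Qed.
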